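(* Let $(M,g)$ be a smooth closed Riemannian $n$-manifold, $n\ge5$, and let $q,m_1>0$. Let $(x_\alpha)_\alpha$ be a converging sequence of points in $M$, $(\mu_\alpha)_\alpha$ a sequence of positive real numbers with $\mu_\alpha\to0$ as $\alpha\to+\infty$, and let $$B_\alpha(x)=\left(\frac{\mu_\alpha}{\mu_\alpha^2+\frac{d_g(x_\alpha,x)^2}{n(n-2)}}\right)^{\frac{n-2}{2}},\qquad x\in M,$$ where $d_g$ is the Riemannian distance. Then $$\lim_{\alpha\to+\infty}\frac{\int_M\Phi(B_\alpha)B_\alpha^2\,dv_g}{\int_MB_\alpha^2\,dv_g}=\frac1q,$$ where $\Phi$ is the map defined in the context.
   Context: Closed means compact without boundary. $H^1=H^1(M)$ is the Sobolev space of functions in $L^2$ with one derivative in $L^2$. For $u\in H^1$, $\Phi(u)$ is the unique function in $H^1\cap L^\infty$ such that $$\int_M\langle\nabla\Phi(u),\nabla\varphi\rangle_g\,dv_g+\int_M(m_1^2+q^2u^2)\Phi(u)\varphi\,dv_g=q\int_Mu^2\varphi\,dv_g\quad\text{for all }\varphi\in H^1\cap L^\infty,$$ i.e. $\Phi(u)$ solves $\Delta_g\Phi(u)+(m_1^2+q^2u^2)\Phi(u)=qu^2$ with $\Delta_g=-\mathrm{div}_g\nabla$; it satisfies $0\le\Phi(u)\le\frac1q$. *)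

(* Defs.v *)
From HB Require Import structures.
From mathcomp Require Import all_boot all_order all_algebra.
From mathcomp Require Import all_classical all_reals all_analysis.
From mathcomp Require Import measurable_realfun.
Set Implicit Arguments.
Unset Strict Implicit.
Unset Printing Implicit Defensive.
Import Order.TTheory GRing.Theory Num.Theory.
Import numFieldNormedType.Exports.
Local Open Scope classical_set_scope.
Local Open Scope ring_scope.

(* [T] with the sigma-algebra generated by its open sets *)
Definition borel (T : ptopologicalType) := g_sigma_algebraType (@open T).

(* Lebesgue measure on R^n, with R^n represented by the row vectors 'rV[R]_n:
   [leb_rV n.+1] is the image of the product measure [lebesgue_measure \x leb_rV n]
   under (x, v) |-> row_mx x v. *)
Section lebesgue_rV.
Context {R : realType}.

Definition cons_rV n (p : R * borel 'rV[R]_n) : borel 'rV[R]_n.+1 :=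
  row_mx (p.1%:M : 'rV[R]_1) p.2.

Lemma measurable_cons_rV n :
  measurable_fun [set: measurableTypeR R * borel 'rV[R]_n] (@cons_rV n).
Proof.
apply: (@measurability _ _ _ (borel 'rV[R]_n.+1) _ _ (@open 'rV[R]_n.+1)) => // _ [U oU <-].
rewrite setTI.
pose box (t : rat * 'rV[rat]_n * nat) : set (R * borel 'rV[R]_n) :=
  ball (ratr t.1.1 : R) (t.2.+1%:R^-1) `*`
  ball (map_mx ratr t.1.2 : 'rV[R]_n) (t.2.+1%:R^-1).
pose F t := if `[< box t `<=` @cons_rV n @^-1` U >] then box t else set0.
suff -> : @cons_rV n @^-1` U = \bigcup_t F t.
  apply: countable_bigcupT_measurable => [|t]; first exact: countableP.
  rewrite /F; case: ifP => // _; apply: measurableX.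
    exact: measurable_ball.
  by apply: sub_sigma_algebra; exact: ball_open.
apply/seteqP; split => [p Up|p [t _]]; last first.
  by rewrite /F; case: ifP => // /asboolP; exact.
have : nbhs (cons_rV p : 'rV[R]_n.+1) U by exact: open_nbhs_nbhs.
move=> /nbhs_ballP[e /= e0 eU].
have [k _ kP] := near_infty_natSinv_lt (PosNum (divr_gt0 e0 (ltr0Sn R 1))).
have ke := kP k (leqnn k) => {kP}; rewrite /= in ke.
have k0 : 0 < k.+1%:R^-1 :> R by rewrite invr_gt0.
have rt (x : R) : exists a : rat, ball (ratr a : R) k.+1%:R^-1 x.
  have [] := @dense_rat R (ball x k.+1%:R^-1); [|exact: ball_open|].
    by exists x; exact: ballxx.
  by move=> y [h [a _ ay]]; exists a; rewrite ay; exact: ball_sym.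
have [a pa] := rt p.1.
have [q pq] : exists q : 'I_n -> rat, forall i, ball (ratr (q i) : R) k.+1%:R^-1 ((p.2 : 'rV_n) 0 i).
  by have [q qP] := choice (fun i => rt ((p.2 : 'rV_n) 0 i)); exists q.
pose t := (a, \row_i q i, k).
have bp : box t p.
  split => //=; split => // i j.
  by rewrite !mxE ord1; exact: pq.
exists t => //; rewrite /F; case: asboolP => // nb; exfalso; apply: nb.
move=> r [/= br1 [_ /= br2]]; apply: eU; split => // i j.
have [/= bp1 [_ /= bp2]] := bp.
have dbl (c x y : R) : ball c k.+1%:R^-1 x -> ball c k.+1%:R^-1 y -> ball x e y.
  move=> /ball_sym cx cy; apply: (@le_ball _ _ _ (k.+1%:R^-1 + k.+1%:R^-1)).
    by rewrite (splitr e) ltW// ltrD.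
  exact: ball_triangle cx cy.
rewrite /cons_rV !mxE; case: splitP => l _.
  by rewrite !mxE !ord1 eqxx !mulr1n; exact: dbl bp1 br1.
by have := dbl _ _ _ (bp2 i l) (br2 i l).
Qed.

Section step.
Variables (n : nat) (mu : {sigma_finite_measure set (borel 'rV[R]_n) -> \bar R}).

Definition leb_step : set (borel 'rV[R]_n.+1) -> \bar R :=
  pushforward (@lebesgue_measure R \x mu)%E (@cons_rV n).

HB.instance Definition _ := Measure.copy leb_step
  (measure_function_pushforward__canonical__measure_function_Measure
    (@lebesgue_measure R \x mu)%E (@measurable_cons_rV n)).

Let leb_step_sigma_finite : sigma_finite [set: borel 'rV[R]_n.+1] leb_step.
Proof.
have [A AT mA] := sigma_finiteT (@lebesgue_measure R).
have [B BT mB] := sigma_finiteT mu.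
pose g (w : borel 'rV[R]_n.+1) : R * borel 'rV[R]_n :=
  ((w : 'rV_n.+1) 0 0, rsubmx (w : 'rV[R]_(1 + n))).
have gK : cancel (@cons_rV n) g.
  move=> [x v]; rewrite /g /cons_rV row_mxKr; congr pair.
  rewrite mxE; case: splitP => // j _.
  by rewrite mxE !ord1 eqxx mulr1n.
have mg : measurable_fun setT g.
  apply/measurable_fun_pairP; split.
    apply: (measurability _ (RGenOpens.measurableE R)) => _ [_ [a [b ->]] <-].
    rewrite setTI; apply: sub_sigma_algebra.
    apply: (@open_comp _ _ (fun M : 'rV[R]_n.+1 => M 0 0)).
      by move=> M _; exact: coord_continuous.
    exact: interval_open.
  apply: (@measurability _ _ _ (borel 'rV[R]_n) _ _ (@open 'rV[R]_n)) => //.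
  move=> _ [U oU <-]; rewrite setTI; apply: sub_sigma_algebra.
  apply: (@open_comp _ _ (fun w : 'rV[R]_(1 + n) => rsubmx w)) => // w _.
  move=> V /nbhs_ballP[e /= e0 eV].
  apply/nbhs_ballP; exists e => // w' [_ ww']; apply: eV.
  by split => // i j; rewrite !mxE; exact: ww'.
have /card_esym/ppcard_eqP[f] := card_nat2.
exists (fun k => g @^-1` (A (f k).1 `*` B (f k).2)).
  apply/seteqP; split => // w _.
  have [i _ Ai] : (\bigcup_i A i) (g w).1 by rewrite -AT.
  have [j _ Bj] : (\bigcup_i B i) (g w).2 by rewrite -BT.
  have [k _ fk] := @surj _ _ _ _ f (i, j) I.
  by exists k => //=; rewrite fk.
move=> k; have [mAk Ak] := mA (f k).1; have [mBk Bk] := mB (f k).2; split.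
  by rewrite -[X in measurable X]setTI; apply: mg => //; exact: measurableX.
rewrite /leb_step /pushforward -comp_preimage.
rewrite (_ : g \o @cons_rV n = id); last by apply/funext => p /=; rewrite gK.
by rewrite product_measure1E// lte_mul_pinfty// ge0_fin_numE.
Qed.

HB.instance Definition _ := Measure_isSigmaFinite.Build _ _ _ leb_step leb_step_sigma_finite.

End step.

Fixpoint leb_rV n : {sigma_finite_measure set (borel 'rV[R]_n) -> \bar R} :=
  match n with
  | 0 => \d_(0 : borel 'rV[R]_0)
  | m.+1 => leb_step (leb_rV m)
  end.
End lebesgue_rV.

Section smooth_functions.
Context {R : realType} {n : nat}.
Implicit Types (U : set 'rV[R]_n) (f : 'rV[R]_n -> R).

Definition partial (k : 'I_n) f : 'rV[R]_n -> R :=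
  fun y => 'D_(delta_mx 0 k) f y.

Definition iter_partial (s : seq 'I_n) f : 'rV[R]_n -> R := foldr partial f s.

(* C^oo on the open set [U] *)
Definition smooth_on U f :=
  forall (s : seq 'I_n) y, U y -> differentiable (iter_partial s f) y.

(* C^oo functions on R^n with compact support contained in [U] *)
Definition test_function U f :=
  smooth_on setT f /\
  exists K : set 'rV[R]_n,
    [/\ compact K, K `<=` U & forall y, ~ K y -> f y = 0].

Definition loc_integrable U f :=
  measurable_fun (U : set (borel 'rV[R]_n)) f /\
  forall K : set 'rV[R]_n, compact K -> K `<=` U ->
    (leb_rV n).-integrable (K : set (borel 'rV[R]_n)) (EFin \o f).

End smooth_functions.

(* A smooth closed n-manifold is given by a smooth atlas; since the space is
   compact, the atlas may be taken finite, and the topology is then second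
   countable.  The notions below (distance, measure, H^1) do not depend on
   the atlas within its smooth equivalence class.  Connectedness is not
   required.  The chart number [i] is [phi i : dom i -> img i], with inverse
   [psi i]; outside [dom i] and [img i] the values of these are irrelevant. *)
Record closed_manifold (R : realType) (n : nat) (M : ptopologicalType) := {
  chart : finType ;
  dom : chart -> set M ;
  img : chart -> set 'rV[R]_n ;
  phi : chart -> M -> 'rV[R]_n ;
  psi : chart -> 'rV[R]_n -> M ;
  manifold_hausdorff : hausdorff_space M ;
  manifold_compact : compact [set: M] ;
  chart_cover : forall x, exists i, dom i x ;
  dom_open : forall i, open (dom i) ;
  img_open : forall i, open (img i) ;
  phiK : forall i x, dom i x -> img i (phi i x) /\ psi i (phi i x) = x ;
  psiK : forall i y, img i y -> dom i (psi i y) /\ phi i (psi i y) = y ;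
  phi_continuous : forall i x, dom i x -> {for x, continuous (phi i)} ;
  psi_continuous : forall i y, img i y -> {for y, continuous (psi i)} ;
  transition_smooth : forall i j (k : 'I_n),
        smooth_on (img i `&` psi i @^-1` dom j)
                  (fun y => phi j (psi i y) 0 k)
}.

(* [gram i y] is the matrix (g_kl) of the metric in the chart [i] at the point
   of coordinates [y].  Tangent vectors are row vectors, so that a coordinate
   change [f] sends [v] to [v *m 'J f y]. *)
Record riemannian_metric (R : realType) (n : nat) (M : ptopologicalType)
    (X : closed_manifold R n M) := {
  gram : chart X -> 'rV[R]_n -> 'M[R]_n ;
  gram_smooth : forall i k l, smooth_on (img i) (fun y => gram i y k l) ;
  gram_sym : forall i y, img i y -> (gram i y)^T = gram i y ;
  gram_posdef : forall i y (v : 'rV[R]_n), img i y -> v != 0 ->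
        0 < (v *m gram i y *m v^T) 0 0 ;
  gram_change : forall i j y, img i y -> dom j (psi i y) ->
        let J := 'J (phi j \o psi i) y in
        gram i y = J *m gram j (phi j (psi i y)) *m J^T
}.

Section riemannian.
Context {R : realType} {n : nat} {M : ptopologicalType}.
Context {X : closed_manifold R n M} (g : riemannian_metric X).

Section distance.
Implicit Types (c : R -> M) (a b : R).

(* [c] is of class C^1 in a neighbourhood of [t] in R, up to the continuity
   of the derivative, which is only required at [t] *)
Definition C1_at c t :=
  {for t, continuous c} /\
  forall i : chart X, dom i (c t) ->
    (\forall s \near t, derivable (phi i \o c) s 1) /\
    {for t, continuous (derive1 (phi i \o c))}.

Definition C1_on a b c :=
  exists e : R -> M, forall t, a <= t <= b -> e t = c t /\ C1_at e t.

Inductive piecewise_C1 c : R -> R -> Prop :=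
| piecewise_C1_one a b : a < b -> C1_on a b c -> piecewise_C1 c a b
| piecewise_C1_cat a d b : piecewise_C1 c a d -> d < b -> C1_on d b c ->
    piecewise_C1 c a b.

(* |c'(t)|_g, computed in the first chart around c(t) *)
Definition speed c t : R :=
  if [pick i : chart X | c t \in dom i] is Some i then
    let v := derive1 (phi i \o c) t in
    Num.sqrt ((v *m gram g i (phi i (c t)) *m v^T) 0 0)
  else 0.

Definition curve_length a b c : \bar R :=
  (\int[@lebesgue_measure R]_(t in `[a, b]) (speed c t)%:E)%E.

(* +oo when [x] and [y] lie in different components *)
Definition riemannian_dist (x y : M) : \bar R :=
  ereal_inf [set l | exists c a b,
    [/\ piecewise_C1 c a b, c a = x, c b = y & l = curve_length a b c]].

End distance.

(* [vol] is the Riemannian measure dv_g: dv_g = sqrt(det g_kl) dy in every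
   chart.  This determines [vol] on all Borel sets. *)
Definition riemannian_volume (vol : {measure set (borel M) -> \bar R}) :=
  forall (i : chart X) (A : set (borel M)), measurable A -> A `<=` dom i ->
    vol A =
    (\int[leb_rV n]_(y in (img i `&` psi i @^-1` A : set (borel 'rV[R]_n)))
      (Num.sqrt (\det (gram g i y)))%:E)%E.

Section sobolev.
Variable vol : {measure set (borel M) -> \bar R}.
Implicit Types (u v f : borel M -> R) (w : chart X -> 'rV[R]_n -> 'rV[R]_n).

(* [w i y] is the row of the weak partial derivatives at [y] of [u] read in
   the chart [i]. *)
Definition weak_gradient u w :=
  forall (i : chart X) (k : 'I_n),
    loc_integrable (img i) (fun y => w i y 0 k) /\
    forall h : 'rV[R]_n -> R, test_function (img i) h ->
      \int[leb_rV n]_(y in (img i : set (borel 'rV[R]_n)))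
         (u (psi i y) * partial k h y) =
      - \int[leb_rV n]_(y in (img i : set (borel 'rV[R]_n)))
         (w i y 0 k * h y).

(* <grad u, grad u'>_g = g^kl d_k u d_l u' when [w], [w'] hold the partial
   derivatives of u, u'; computed in the first chart around [x] *)
Definition grad_inner w w' (x : M) : R :=
  if [pick i : chart X | x \in dom i] is Some i then
    let y := phi i x in
    (w i y *m invmx (gram g i y) *m (w' i y)^T) 0 0
  else 0.

Definition L2_gradient u w :=
  weak_gradient u w /\ (\int[vol]_x (grad_inner w w x)%:E < +oo)%E.

Definition H1 u := u \in Lfun vol 2%:E /\ exists w, L2_gradient u w.

Definition Linfty u := u \in Lfun vol +oo%E.

(* [v] is (a representative of) Phi(u).  The gradients [w], [w'] are unique up
   to null sets, so the equation does not depend on their choice. *)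
Definition is_Phi (q m1 : R) u v :=
  [/\ H1 v, Linfty v &
    forall f w w', H1 f -> Linfty f -> L2_gradient v w -> L2_gradient f w' ->
      \int[vol]_x grad_inner w w' x +
      \int[vol]_x ((m1 ^+ 2 + q ^+ 2 * u x ^+ 2) * v x * f x) =
      q * \int[vol]_x (u x ^+ 2 * f x)].

End sobolev.

(* The profile B centred at [z] with parameter [mu].  At infinite distance it
   takes its limit value 0 (this does not occur if M is connected). *)
Definition bubble (mu : R) (z x : M) : R :=
  if riemannian_dist z x is r%:E then
    (mu / (mu ^+ 2 + r ^+ 2 / (n%:R * (n%:R - 2)))) `^ ((n%:R - 2) / 2)
  else 0.

End riemannian.

(* Main.v *)
(** Write [v = Phi(B)] and [I = int B^2].  The equation for [v] tested with [v]
    itself gives [int |dv|^2 + m1^2 int v^2 <= I/2] and [q^2 int B^2 v^2 <= I].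
    Tested with a cutoff [eta] equal to 1 on the coordinate ball of radius
    [rho = L mu] around the centre of [B] and supported in the ball of radius
    [2 rho], it bounds [q int B^2 (1 - q v) eta] by
    [t I/4 + (int |d eta|^2 + m1^2 int eta^2) / (2 t)] for every [t > 0].  The energy
    of [eta] is of order [rho^(n-2)], whereas [I] is at least of order [mu^2] and
    the part of [I] outside the ball of radius [rho] is [O(L^(4-n) mu^2)].  As
    [n >= 5], letting first [mu] tend to 0 and then [L] to infinity and [t] to 0
    gives [int B^2 (1 - q v) = o(I)].

    The bubbles and the cutoffs are admissible because Lipschitz functions lie in
    [H^1].  This replaces Rademacher's theorem by a convexity argument: among
    differentiable approximations of a Lipschitz function with the same Lipschitz
    constant, sequences nearly minimising the Dirichlet energy have gradients that
    converge almost everywhere. *)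

From HB Require Import structures.
Require Import Defs.
From mathcomp Require Import all_boot all_order all_algebra.
From mathcomp Require Import all_classical all_reals all_analysis.
From mathcomp Require Import measurable_realfun.
From mathcomp Require Import ring lra zify.
Set Implicit Arguments.
Unset Strict Implicit.
Unset Printing Implicit Defensive.
Import Order.TTheory GRing.Theory Num.Theory.
Import numFieldNormedType.Exports.
Local Open Scope classical_set_scope.
Local Open Scope ring_scope.

(** * Lebesgue measure on [R^n] *)

Section lebesgue_rV_theory.
Context {R : realType}.
Implicit Types n : nat.

(** The exponents dictate the order of the limits. For fixed L the energy of the cutoff is of order
    L^(n-2) mu^(n-2), that is mu^2 times mu^(n-4), negligible against I as mu tends to 0. The tail
    is summed over dyadic shells; the shell of radius s contributes about mu^(n-2) s^(-2(n-2)) s^n =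
    mu^(n-2) s^(4-n), and the smallest radius dominates the sum because n > 4. On the tail the
    factor 1 - q v is absorbed by AM-GM into the bound on q^2 int B^2 v^2, which brings in a second
    small parameter tau. The centres move, so every constant is made uniform over centres in a fixed
    coordinate ball around the limit point. The obstacle is regularity: the distance is only locally
    Lipschitz, and infinite between components, while H^1 asks for weak gradients in all charts at
    once. A gradient is built in one chart and carried to the others by the transition maps; almost
    everywhere convergence survives because transition maps respect null sets, which follows from
    the compatibility of the volume with every chart. *)

Lemma measurable_preimage d d' (T : measurableType d) (U : measurableType d')
    (f : T -> U) (A : set U) :
  measurable_fun setT f -> measurable A -> measurable (f @^-1` A).
Proof. by move=> mf mA; rewrite -[X in measurable X]setTI; exact: mf. Qed.

(** The pushforward under the translation agrees with the Stieltjes measure of the identity on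
    half-open intervals, and these determine it. *)
Lemma lebesgue_measure_shift (a : R) (A : set (measurableTypeR R)) :
  measurable A ->
  lebesgue_measure ((fun x : R => x + a) @^-1` A) = lebesgue_measure A.
Proof.
move=> mA.
have mf : measurable_fun setT (fun x : measurableTypeR R => (x + a : measurableTypeR R)).
  exact: measurable_funD.
pose nu : {measure set (measurableTypeR R) -> \bar R} :=
  
  (measure_function_pushforward__canonical__measure_function_Measure (@lebesgue_measure R) mf).
rewrite -[LHS]/(nu A) -[RHS]/(lebesgue_stieltjes_measure idfun A); apply/esym.
apply: lebesgue_stieltjes_measure_unique mA => _ [[x y] xy <-] /=.
rewrite /nu /pushforward/=.
rewrite (_ : _ @^-1` _ = `](x - a)%R, (y - a)%R]%classic); last first.
  apply/seteqP; split => z /=; rewrite !in_itv /=; lra.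
have := @lebesgue_measure_itv R `](x - a)%R, (y - a)%R].
have := @lebesgue_measure_itv R `]x, y].
rewrite /lebesgue_measure /= => -> ->.
rewrite !lte_fin.
have -> : (x - a < y - a) = (x < y) by apply/idP/idP; lra.
case: ifP => // _; rewrite -!EFinD; congr (_%:E); lra.
Qed.

Lemma leb_rV0 (A : set (borel 'rV[R]_0)) : leb_rV 0 A = \d_(0 : borel 'rV[R]_0) A.
Proof. by []. Qed.

Lemma leb_rVS n (A : set (borel 'rV[R]_n.+1)) :
  leb_rV n.+1 A = (@lebesgue_measure R \x leb_rV n)%E (@cons_rV R n @^-1` A).
Proof. by []. Qed.

Lemma borel_open (T : ptopologicalType) (A : set T) :
  open A -> measurable (A : set (borel T)).
Proof. by move=> oA; exact: sub_sigma_algebra. Qed.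

Lemma borel_closed (T : ptopologicalType) (A : set T) :
  closed A -> measurable (A : set (borel T)).
Proof.
by move=> cA; rewrite -(setCK A); apply: measurableC; apply: borel_open; exact: closed_openC.
Qed.

Lemma borel_continuous (T U : ptopologicalType) (f : T -> U) :
  continuous f -> measurable_fun setT (f : borel T -> borel U).
Proof.
move=> cf; apply: (@measurability _ _ (borel T) (borel U) _ _ (@open U)) => // _ [V oV <-].
by rewrite setTI; apply: borel_open; move: (cf) => /continuousP; exact.
Qed.

Lemma measurable_addrV n (a : 'rV[R]_n) :
  measurable_fun setT (fun v : borel 'rV[R]_n => (v : 'rV_n) + a : borel 'rV[R]_n).
Proof.
have h : continuous (fun v : 'rV[R]_n => v + a).
  by move=> v; apply: (@continuousD _ _ _ idfun (cst a)); [exact: cvg_id|exact: cst_continuous].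
exact: (borel_continuous h).
Qed.

(** By induction on the dimension: a translation splits into a shift of the first coordinate and one
    of the others, and the shifted product measure is identified by its values on rectangles. *)
Lemma leb_rV_shift n (a : 'rV[R]_n) (A : set (borel 'rV[R]_n)) : measurable A ->
  leb_rV n ((fun y : 'rV[R]_n => y + a) @^-1` A) = leb_rV n A.
Proof.
elim: n a A => [a A mA|n IH a A mA].
  by congr (leb_rV 0 _); apply/seteqP; split => z /=; rewrite (thinmx0 (z + a)) (thinmx0 z).
rewrite !leb_rVS.
pose a0 := a 0 0; pose a' : 'rV_n := rsubmx (a : 'rV_(1 + n)).
pose S (p : measurableTypeR R * borel 'rV[R]_n) : measurableTypeR R * borel 'rV[R]_n :=
  (p.1 + a0, ((p.2 : 'rV_n) + a' : 'rV[R]_n)).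
have aE : a = row_mx (a0%:M : 'rV[R]_1) a'.
  apply/rowP => i; rewrite mxE; case: (split_ordP (i : 'I_(1 + n))) => k ik.
    by rewrite mxE !ord1 eqxx mulr1n /a0; congr (a _ _); rewrite ik; apply/val_inj; rewrite /= ord1.
  by rewrite mxE ik.
have mS : measurable_fun setT S.
  apply/measurable_fun_pairP; split.
    by rewrite (_ : _ \o _ = fun p => p.1 + a0)//; exact: measurable_funD.
  exact: (measurableT_comp (measurable_addrV a') measurable_snd).
have -> : @cons_rV R n @^-1` ((fun y : 'rV[R]_n.+1 => y + a) @^-1` A) =
    S @^-1` (@cons_rV R n @^-1` A).
  apply/seteqP; split => -[x v]; rewrite /S /cons_rV /= {1}aE => h.
    move: h; rewrite -[X in A X](_ : row_mx ((x + a0)%:M : 'rV[R]_1) ((v : 'rV_n) + a') = _) //.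
    by rewrite raddfD /= -add_row_mx.
  by rewrite raddfD /= -add_row_mx in h.
pose nu : {measure set (measurableTypeR R * borel 'rV[R]_n)%type -> \bar R} :=
  measure_function_pushforward__canonical__measure_function_Measure (@lebesgue_measure R \x leb_rV n)%E mS.
rewrite [RHS](@product_measure_unique _ _ _ _ _ (@lebesgue_measure R) (leb_rV n) nu)//; last first.
  exact: (measurable_preimage (@measurable_cons_rV R n) mA).
move=> B C mB mC; rewrite /nu /pushforward /=.
rewrite -[LHS]/((lebesgue_measure \x leb_rV n)%E (S @^-1` (B `*` C))).
rewrite (_ : S @^-1` _ = ((fun x : R => x + a0) @^-1` B) `*` ((fun y : 'rV[R]_n => y + a') @^-1` C))//.
rewrite product_measure1E.
- by rewrite IH//; congr (_ * _)%E; exact: lebesgue_measure_shift.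
- have h : measurable_fun setT (fun x : measurableTypeR R => x + a0) by exact: measurable_funD.
  exact: (measurable_preimage h mB).
- exact: (measurable_preimage (measurable_addrV a') mC).
Qed.

Lemma cons_rV0 n (p : R * borel 'rV[R]_n) : (cons_rV p : 'rV[R]_n.+1) 0 0 = p.1.
Proof.
rewrite /cons_rV mxE; case: split_ordP => k e.
  by rewrite mxE !ord1 eqxx mulr1n.
by have := congr1 val e.
Qed.

Lemma cons_rVS n (p : R * borel 'rV[R]_n) (i : 'I_n) :
  (cons_rV p : 'rV[R]_n.+1) 0 (rshift 1 i) = (p.2 : 'rV_n) 0 i.
Proof. by rewrite /cons_rV (@row_mxEr _ 1 1 n). Qed.

(** The norm on row vectors is the sup norm, so balls are cubes of side [s *+ 2]. *)
Lemma leb_rV_ball n (p : 'rV[R]_n) (s : R) : 0 < s ->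
  leb_rV n (ball p s : set (borel 'rV[R]_n)) = ((s *+ 2) ^+ n)%:E.
Proof.
move=> s0; elim: n p => [p|n IH p].
  rewrite leb_rV0 expr0 diracE mem_set//.
  by split => // i; case.
rewrite leb_rVS.
have -> : @cons_rV R n @^-1` (ball p s) =
    (ball (p 0 0) s : set R) `*` (ball (rsubmx (p : 'rV_(1 + n)) : 'rV_n) s : set (borel 'rV_n)).
  apply/seteqP; split => -[x v].
    move=> [_ h]; split.
      by have := h 0 0; rewrite cons_rV0.
    split => // i j; rewrite !ord1 mxE.
    by have := h 0 (rshift 1 j : 'I_(1 + n)); rewrite cons_rVS.
  move=> [/= h1 [_ h2]]; split => // i j; rewrite !ord1.
  case: (split_ordP (j : 'I_(1 + n))) => k ->.
    by rewrite (_ : lshift n k = 0 :> 'I_n.+1) ?cons_rV0//; apply/val_inj; rewrite /= ord1.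
  by rewrite cons_rVS; have := h2 0 k; rewrite mxE.
rewrite product_measure1E.
- by rewrite IH// exprS EFinM; congr (_ * _)%E; exact: (lebesgue_measure_ball _ (ltW s0)).
- exact: measurable_ball.
- by apply: borel_open; exact: ball_open.
Qed.

Lemma ge0_integral_leb_rV_shift n (a : 'rV[R]_n) (f : borel 'rV[R]_n -> \bar R) :
  measurable_fun setT f -> (forall y, 0 <= f y)%E ->
  (\int[leb_rV n]_y f ((y : 'rV[R]_n) + a)%R = \int[leb_rV n]_y f y)%E.
Proof.
move=> mf f0.
have := ge0_integral_pushforward (measurable_addrV a) (leb_rV n) measurableT mf (fun y _ => f0 y).
rewrite preimage_setT => <-.
apply: eq_measure_integral => [|? A mA _]; first exact: measurable_addrV.
exact: leb_rV_shift.
Qed.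

End lebesgue_rV_theory.

(** * Almost everywhere convergence of minimising sequences *)

Section midpoint_convergence.
Context {R : realType}.

Lemma bounded_integrable d (T : measurableType d) (mu : {measure set T -> \bar R})
    (D : set T) (f : T -> R) (C : R) :
  measurable D -> (mu D < +oo)%E -> measurable_fun D f ->
  (forall x, D x -> `|f x| <= C) -> mu.-integrable D (EFin \o f).
Proof.
move=> mD fD mf fC; apply: measurable_bounded_integrable => //.
by exists C; split; [exact: num_real|move=> M CM x Dx; exact: (le_trans (fC _ Dx) (ltW CM))].
Qed.

Lemma fast_cauchy_cvg (u : nat -> R) (c : R) :
  (forall k, `|u k.+1 - u k| <= c * 2^-1 ^+ k) -> cvgn u.
Proof.
move=> uc.
have c0 : 0 <= c by have := uc 0%N; rewrite expr0 mulr1; exact: le_trans.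
have h : cvgn (series (telescope u)).
  apply: normed_cvg; apply: (@series_le_cvg _ _ (geometric c 2^-1)).
  - by move=> k; exact: normr_ge0.
  - by move=> k; rewrite /geometric /=; apply: mulr_ge0 => //; apply: exprn_ge0; rewrite invr_ge0.
  - by move=> k; rewrite /geometric /telescope /=; exact: uc.
  - by apply: is_cvg_geometric_series; rewrite ger0_norm// invf_lt1// ltr1n.
rewrite telescopeK in h.
have -> : u = (fun n => (u n - u 0%N) + u 0%N) by apply/funext => n; rewrite subrK.
by apply: is_cvgD => //; exact: is_cvg_cst.
Qed.

(** Weighted by 4^k, the squared increments still have a summable integral, as 4/8 = 1/2. Their sum
    [S] is therefore finite almost everywhere, and there the k-th increment is at most sqrt(S)
    2^-k. *)
Lemma ae_cvg_of_fast_L2 d (T : measurableType d) (mu : {measure set T -> \bar R})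
    (D : set T) (f : nat -> T -> R) (C : R) :
  measurable D -> (forall k, measurable_fun D (f k)) ->
  (forall k, \int[mu]_(x in D) ((f k.+1 x - f k x) ^+ 2)%:E <= (C * 8^-1 ^+ k)%:E)%E ->
  {ae mu, forall x, D x -> cvgn (f ^~ x)}.
Proof.
move=> mD mf hC.
pose g k x := (4 ^+ k * (f k.+1 x - f k x) ^+ 2).
have g0 k x : 0 <= g k x by apply: mulr_ge0; [exact: exprn_ge0|exact: sqr_ge0].
have mg k : measurable_fun D (fun x => (g k x)%:E).
  apply/measurable_EFinP; apply: measurable_funM; first exact: measurable_cst.
  by apply: measurable_funX; apply: measurable_funB.
pose S x := (\sum_(0 <= k <oo) (g k x)%:E)%E.
have C0 : 0 <= C.
  have := hC 0%N; rewrite expr0 mulr1 => h.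
  rewrite -lee_fin; apply: le_trans h; apply: integral_ge0 => x _.
  by rewrite lee_fin sqr_ge0.
have iS : mu.-integrable D S.
  apply/integrableP; split.
    have := @ge0_emeasurable_sum _ _ R D (fun k x => (g k x)%:E) xpredT.
    apply => [k x _ _|k _]; last exact: mg.
    by rewrite lee_fin.
  under eq_integral => x _.
    rewrite gee0_abs; last by apply: nneseries_ge0 => k _ _; rewrite lee_fin.
    over.
  rewrite integral_nneseries//; last by move=> k x _; rewrite lee_fin.
  apply: (@le_lt_trans _ _ (\sum_(0 <= k <oo) ((C * 2^-1 ^+ k)%:E : \bar R))%E).
    apply: lee_nneseries => [k _ _|k _].
      by apply: integral_ge0 => x _; rewrite lee_fin.
    under eq_integral => x _ do rewrite EFinM.
    rewrite ge0_integralZl//; last 2 first.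
    - apply/measurable_EFinP; apply: measurable_funX; exact: measurable_funB.
    - by move=> x _; rewrite lee_fin sqr_ge0.
    apply: (@le_trans _ _ ((4 ^+ k)%:E * (C * 8^-1 ^+ k)%:E)%E).
      by apply: lee_pmul => //; apply: integral_ge0 => x _; rewrite lee_fin sqr_ge0.
    rewrite -EFinM lee_fin mulrCA -exprMn (_ : 4 / 8 = 2^-1 :> R)//.
    by field.
  have /cvg_ex[l hl] : cvgn (series (geometric C (2^-1 : R))).
    by apply: is_cvg_geometric_series; rewrite ger0_norm// invf_lt1// ltr1n.
  have -> : (\sum_(0 <= k <oo) ((C * 2^-1 ^+ k)%:E : \bar R))%E = l%:E.
    apply/cvg_lim => //.
    rewrite (_ : (fun n => _) = EFin \o series (geometric C (2^-1 : R))); last first.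
      by apply/funext => n /=; rewrite /series /= sumEFin.
    by apply: cvg_EFin => //; exact: nearW.
  exact: ltry.
have := integrable_ae mD iS; apply: filterS => x + Dx => /(_ Dx) Sfin.
have S0 : (0 <= S x)%E by apply: nneseries_ge0 => k _ _; rewrite lee_fin.
apply: (@fast_cauchy_cvg _ (Num.sqrt (fine (S x)))) => k.
have gS : g k x <= fine (S x).
  rewrite -lee_fin fineK//.
  apply: le_trans (nneseries_lim_ge k.+1 _); last by move=> n _ _; rewrite lee_fin.
  rewrite big_nat_recr//= leeDr//.
  by apply: sume_ge0 => i _; rewrite lee_fin.
have h : Num.sqrt (g k x) <= Num.sqrt (fine (S x)) by rewrite ler_sqrt// fine_ge0.
have e : Num.sqrt (g k x) = 2 ^+ k * `|f k.+1 x - f k x|.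
  rewrite /g (_ : 4 ^+ k = (2 ^+ k) ^+ 2); last by rewrite -exprM mulnC exprM; congr (_ ^+ _); ring.
  by rewrite -exprMn sqrtr_sqr normrM ger0_norm// exprn_ge0.
rewrite exprVn ler_pdivlMr ?exprn_gt0// mulrC -e//.
Qed.

Variables (d : measure_display) (T : measurableType d) (mu : {measure set T -> \bar R}).
Variables (D : set T) (I : finType) (X : Type) (mid : X -> X -> X) (W : I -> X -> T -> R).
Variables (P : nat -> set X) (C : R).
Hypotheses (mD : measurable D) (fD : (mu D < +oo)%E).
Hypothesis P0 : forall m, P m !=set0.
Hypothesis Pdecr : forall m k x, (m <= k)%N -> P k x -> P m x.
Hypothesis Pmid : forall m x y, P m x -> P m y -> P m (mid x y).
Hypothesis Wmid : forall i x y t, P 0%N x -> P 0%N y -> W i (mid x y) t = (W i x t + W i y t) / 2.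
Hypothesis mW : forall i x, P 0%N x -> measurable_fun D (W i x).
Hypothesis WC : forall i x t, P 0%N x -> `|W i x t| <= C.

Let Pz m x : P m x -> P 0%N x. Proof. exact: Pdecr. Qed.

Let iW (f : T -> R) (B : R) : measurable_fun D f -> (forall t, `|f t| <= B) -> mu.-integrable D (EFin \o (fun t => f t ^+ 2)).
Proof.
move=> mf fB; apply: (@bounded_integrable _ _ mu D _ (B ^+ 2)) => //.
  exact: measurable_funX.
by move=> t _; rewrite normrX lerXn2r ?nnegrE// (le_trans _ (fB t)).
Qed.

(** The Dirichlet energy of the candidate [x], when [W i x] is read as its i-th partial
    derivative. *)
Let Q x := \sum_i \int[mu]_(t in D) (W i x t) ^+ 2.

Let Q_ge0 x : 0 <= Q x.
Proof. by apply: sumr_ge0 => i _; apply: Rintegral_ge0 => t _; exact: sqr_ge0. Qed.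

Let Qle x : P 0%N x -> Q x <= \sum_(i : I) (C ^+ 2 * fine (mu D)).
Proof.
move=> Px; apply: ler_sum => i _.
rewrite -(Rintegral_cst _ mD); apply: le_Rintegral => //.
- exact: (iW (mW i Px) (fun t => WC i t Px)).
- by apply: (@bounded_integrable _ _ mu D _ `|C ^+ 2|) => //.
- by move=> t _; rewrite -real_normK ?num_real// lerXn2r ?nnegrE ?(le_trans _ (WC i t Px))// WC.
Qed.

(** The parallelogram identity, with [mid x y] in the role of (x + y) / 2. *)
Let Qpar x y : P 0%N x -> P 0%N y ->
  \sum_i \int[mu]_(t in D) (W i x t - W i y t) ^+ 2 = 2 * (Q x + Q y) - 4 * Q (mid x y).
Proof.
move=> Px Py; rewrite /Q -big_split/= !mulr_sumr -sumrB; apply: eq_bigr => i _.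
have ix := iW (mW i Px) (fun t => WC i t Px); have iy := iW (mW i Py) (fun t => WC i t Py).
have imid : mu.-integrable D (EFin \o (fun t => ((W i x t + W i y t) / 2) ^+ 2)).
  apply: (@iW _ C); first by apply: measurable_funM; [apply: measurable_funD; exact: mW|exact: measurable_cst].
  move=> t; rewrite normrM normfV (ger0_norm (ler0n R 2)) ler_pdivrMr// (le_trans (ler_normD _ _))//.
  by have := WC i t Px; have := WC i t Py; lra.
rewrite -RintegralD//.
have -> : \int[mu]_(t in D) W i (mid x y) t ^+ 2 = \int[mu]_(t in D) ((W i x t + W i y t) / 2) ^+ 2.
  by apply: eq_Rintegral => t _; rewrite Wmid.
rewrite -!RintegralZl//; last exact: (integrableD mD ix iy).
rewrite -RintegralB//.
- by apply: eq_Rintegral => t _; field.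
- have := integrableZl mD 2 (integrableD mD ix iy).
  by congr (_.-integrable _ _); apply/funext.
- have := integrableZl mD 4 imid.
  by congr (_.-integrable _ _); apply/funext.
Qed.

(* The infimum over the nested sets [P m] of the total energy is nondecreasing in
   [m]; near-minimisers are Cauchy by the parallelogram identity. *)
Lemma midpoint_ae_cvg : exists x : nat -> X, (forall m, P m (x m)) /\
  {ae mu, forall t, D t -> forall i, cvgn (fun m => W i (x m) t)}.
Proof.
pose e m := inf [set Q x | x in P m].
have hinf m : has_inf [set Q x | x in P m].
  split; first by have [x Px] := P0 m; exists (Q x), x.
  by exists 0 => _ [x _ <-]; exact: Q_ge0.
have e_le m x : P m x -> e m <= Q x.
  by move=> Px; apply: (ge_inf (proj2 (hinf m))); exists x.
have e_nd m k : (m <= k)%N -> e m <= e k.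
  move=> mk; apply: lb_le_inf; first exact: (proj1 (hinf k)).
  by move=> _ [x Px <-]; apply: e_le; exact: Pdecr Px.
have hsup : has_sup (range e).
  split; first by exists (e 0%N), 0%N.
  exists (\sum_(i : I) (C ^+ 2 * fine (mu D))) => _ [m _ <-].
  have [x Px] := P0 m; apply: (le_trans (e_le _ _ Px)); apply: Qle; exact: Pz Px.
(* The tolerance 8^-k is the rate of decay that [ae_cvg_of_fast_L2] asks for. *)
pose l := sup (range e); pose del k : R := 8^-1 ^+ k.
have del0 k : 0 < del k by rewrite exprn_gt0// invr_gt0.
have del_nd k : del k.+1 <= del k.
  by rewrite /del exprS; have := del0 k; rewrite /del; lra.
have /choice[N hN] k : exists N, l - del k < e N.
  by have [_ [N _ <-] h] := sup_adherent (del0 k) hsup; exists N.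
(* The index k puts the k-th term into [P k]; the index [N k] puts midpoints of consecutive terms
   into a set whose infimal energy is already close to [l]. *)
have /choice[x hx] k : exists x, P (maxn k (N k)) x /\ Q x < l + del k.
  have [_ [x Px <-] h] := inf_adherent (del0 k) (hinf (maxn k (N k))).
  exists x; split => //; apply: (lt_le_trans h); rewrite lerD2r.
  by apply: (sup_upper_bound hsup); exists (maxn k (N k)).
have Px k : P k (x k) by apply: (Pdecr _ (proj1 (hx k))); exact: leq_maxl.
exists x; split => //.
(* The midpoint has energy above l - del k, while each end point has energy below l plus its
   tolerance; the parallelogram identity leaves 6 del k + 2 del (k+1). *)
have key k : \sum_i \int[mu]_(t in D) (W i (x k.+1) t - W i (x k) t) ^+ 2 <= 8 * del k.
  rewrite Qpar; [|exact: Pz (Px _)|exact: Pz (Px _)].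
  pose m := minn (N k) (N k.+1).
  have Pm : P m (mid (x k.+1) (x k)).
    apply: Pmid; [apply: (Pdecr _ (proj1 (hx k.+1)))|apply: (Pdecr _ (proj1 (hx k)))].
      by rewrite /m; apply: (leq_trans (geq_minr _ _)); exact: leq_maxr.
    by rewrite /m; apply: (leq_trans (geq_minl _ _)); exact: leq_maxr.
  have h : l - del k < e m.
    rewrite /m; case: (leqP (N k) (N k.+1)) => _; first exact: hN.
    by apply: le_lt_trans (hN k.+1); rewrite lerB.
  have := e_le _ _ Pm; have := proj2 (hx k); have := proj2 (hx k.+1); have := del_nd k.
  by lra.
have ae_i i : {ae mu, forall t, D t -> cvgn (fun m => W i (x m) t)}.
  apply: (@ae_cvg_of_fast_L2 _ _ mu D (fun m => W i (x m)) 8) => //.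
    by move=> k; apply: mW; exact: Pz (Px k).
  move=> k.
  have mf : measurable_fun D (fun t => W i (x k.+1) t - W i (x k) t).
    by apply: measurable_funB; apply: mW; exact: Pz (Px _).
  have bf t : `|W i (x k.+1) t - W i (x k) t| <= C + C.
    by apply: (le_trans (ler_normB _ _)); rewrite lerD// WC//; exact: Pz (Px _).
  have int := iW mf bf.
  rewrite -[leLHS]fineK; last exact: integrable_fin_num.
  rewrite lee_fin; apply: le_trans (key k).
  rewrite (bigD1 i)//= lerDl; apply: sumr_ge0 => j _; apply: Rintegral_ge0 => t _; exact: sqr_ge0.
have : {ae mu, forall t, forall i, D t -> cvgn (fun m => W i (x m) t)}.
  by apply: filter_forall.
by apply: filterS => t h Dt i; exact: h.
Qed.
End midpoint_convergence.

(** * Differential calculus on row vectors *)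

Section rV_calculus.
Context {R : realType}.

Lemma rV_norm_coord n (v : 'rV[R]_n) (k : 'I_n) : `|v 0 k| <= `|v|.
Proof.
rewrite {2}/Num.Def.normr /= mx_normrE.
exact: (@le_bigmax _ _ _ 0 (fun ij : 'I_1 * 'I_n => `|v ij.1 ij.2|) (0, k)).
Qed.

Lemma rV_norm_le n (v : 'rV[R]_n) (C : R) : 0 <= C ->
  (forall k, `|v 0 k| <= C) -> `|v| <= C.
Proof.
move=> C0 h; rewrite {1}/Num.Def.normr /= mx_normrE.
by apply: bigmax_le => // -[i k] _ /=; rewrite ord1.
Qed.

Lemma rV_norm_delta n (k : 'I_n) : `|delta_mx 0 k : 'rV[R]_n| <= 1.
Proof.
by apply: rV_norm_le => // j; rewrite mxE eqxx /=; case: eqP => _; rewrite ?normr1 ?normr0.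
Qed.

Lemma rV_ballE n (p : 'rV[R]_n) s y : ball p s y = (`|p - y| < s) :> Prop.
Proof. by rewrite -ball_normE. Qed.

Lemma differentiable_zero (V W : normedModType R) (g : V -> W) (x : V) :
  (forall e, 0 < e -> \forall h \near (0 : V), `|g (h + x) - g x| <= e * `|h|) ->
  differentiable g x.
Proof.
move=> H.
have E : g \o shift x = cst (g x) + (\0 : V -> W) +o_ (0 : V) id.
  apply/eqaddoP => e e0; near=> h.
  rewrite /= !fctE /= addr0; near: h; exact: H.
have c0 : continuous (\0 : V -> W) by move=> y; exact: cvg_cst.
have d0 : 'd g x = \0 :> (V -> W) by exact: (@diff_unique _ _ _ g (\0 : {linear V -> W}) x c0 E).
by apply/diff_locallyP; rewrite d0.
Unshelve. all: by end_near. Qed.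

Lemma near_eq_differentiable (V W : normedModType R) (f g : V -> W) (x : V) :
  (\forall y \near x, f y = g y) -> differentiable f x -> differentiable g x.
Proof.
move=> fg df.
have -> : g = (g - f) + f by apply/funext => y; rewrite !fctE subrK.
apply: differentiableD => //; apply: differentiable_zero => e e0.
have h : \forall h \near (0 : V), f (h + x) = g (h + x).
  by move: fg; rewrite (near_shift 0 x) subr0.
near=> y.
rewrite !fctE (_ : f (y + x) = g (y + x)); last by near: y.
by rewrite (nbhs_singleton fg) !subrr normr0 mulr_ge0// ltW.
Unshelve. all: by end_near. Qed.

(** Subtracting the linear form with coefficients [G] leaves a function with zero differential.
    Mollified integrals are differentiated through this criterion, from a remainder bound uniform in
    the integration variable. *)
Lemma differentiable_quadratic n (f : 'rV[R]_n -> R) x (G : 'I_n -> R) (C d : R) :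
  0 < d ->
  (forall h, `|h| < d -> `|f (h + x) - f x - \sum_k h 0 k * G k| <= C * `|h| ^+ 2) ->
  differentiable f x.
Proof.
move=> d0 H.
pose lin (y : 'rV[R]_n) := \sum_k (G k *: (fun y : 'rV[R]_n => y 0 k : R)) y.
have dlin : differentiable lin x.
  have -> : lin = \sum_k (G k *: (fun y : 'rV[R]_n => y 0 k : R)).
    by apply/funext => y; rewrite /lin fct_sumE.
  by apply: differentiable_sum => k; apply: differentiableZ; exact: differentiable_coord.
have linB h y : lin (h + y) - lin y = \sum_k h 0 k * G k.
  rewrite /lin -sumrB; apply: eq_bigr => k _; rewrite !fctE mxE /GRing.scale/=; ring.
have -> : f = (f - lin) + lin by apply/funext => y; rewrite !fctE subrK.
apply: differentiableD => //; apply: differentiable_zero => e e0.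
have cC : 0 < Num.max C 1 by rewrite lt_max ltr01 orbT.
near=> h.
have hd : `|h| < Num.min d (e / Num.max C 1).
  near: h; have : 0 < Num.min d (e / Num.max C 1) by rewrite lt_min d0 divr_gt0.
  move=> m0; have := @nbhsx_ballx _ _ (0 : 'rV[R]_n) _ m0.
  by apply: filterS => h; rewrite rV_ballE sub0r normrN.
move: hd; rewrite lt_min => /andP[hd he].
rewrite !fctE (_ : _ - _ = f (h + x) - f x - \sum_k h 0 k * G k); last by rewrite -(linB h x); ring.
apply: (le_trans (H h hd)); rewrite expr2 mulrA; apply: ler_wpM2r => //.
rewrite ltr_pdivlMr// in he; apply: le_trans (ltW he); rewrite mulrC.
by apply: ler_wpM2l => //; rewrite le_max lexx.
Unshelve. all: by end_near. Qed.

Lemma differentiable_rV (V : normedModType R) n (f : V -> 'rV[R]_n) x :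
  (forall k, differentiable (fun y => f y 0 k) x) -> differentiable f x.
Proof.
move=> H.
have -> : f = \sum_k (fun y => f y 0 k *: (delta_mx 0 k : 'rV[R]_n)).
  by apply/funext => y; rewrite fct_sumE; exact: row_sum_delta.
by apply: differentiable_sum => k; exact: differentiableZl.
Qed.

Lemma derive_partial n (W : normedModType R) (F : 'rV[R]_n -> W) y v : differentiable F y ->
  'D_v F y = \sum_k v 0 k *: 'D_(delta_mx 0 k) F y.
Proof.
move=> dF; rewrite deriveE// {1}(row_sum_delta v) linear_sum.
by apply: eq_bigr => k _; rewrite linearZ deriveE.
Qed.

Lemma derive_coord n (V : normedModType R) (T : V -> 'rV[R]_n) (x v : V) k :
  differentiable T x -> 'D_v T x 0 k = 'D_v (fun y => T y 0 k) x.
Proof.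
move=> dT; have dv := @diff_derivable _ _ _ T x v dT.
by rewrite (derive_mx dv) mxE.
Qed.

Lemma derive_chain n (V W : normedModType R) (T : V -> 'rV[R]_n) (F : 'rV[R]_n -> W) x v :
  differentiable T x -> differentiable F (T x) ->
  'D_v (F \o T) x = \sum_k 'D_v (fun y => T y 0 k) x *: 'D_(delta_mx 0 k) F (T x).
Proof.
move=> dT dF.
rewrite deriveE; last exact: differentiable_comp.
rewrite diff_comp//= -deriveE//= derive_partial//.
by apply: eq_bigr => k _; rewrite -derive_coord// (deriveE _ dT).
Qed.

Lemma derive_lipschitz (V : normedModType R) (F : V -> R) (L : R) x v :
  derivable F x v -> (forall y z, `|F y - F z| <= L * `|y - z|) -> `|'D_v F x| <= L * `|v|.
Proof.
move=> dF FL.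
have h : `|h^-1 *: (F (h *: v + x) - F x)| @[h --> (0 : R)^'] --> `|'D_v F x|.
  by apply: cvg_norm; exact: dF.
apply: (cvgr_to_le h); near=> t.
have t0 : t != 0 by near: t; exact: nbhs_dnbhs_neq.
rewrite normrZ normfV ler_pdivrMl ?normr_gt0//.
by apply: (le_trans (FL _ _)); rewrite addrK normrZ mulrCA.
Unshelve. all: by end_near. Qed.

End rV_calculus.

(** * Mollification of Lipschitz functions *)

Section mollification.
Context {R : realType}.

Lemma borel_continuous_on (T : ptopologicalType) (U : set T) (f : T -> R) :
  open U -> (forall x, U x -> {for x, continuous f}) ->
  measurable_fun (U : set (borel T)) (f : borel T -> R).
Proof.
move=> oU cf; apply: (measurability _ (RGenOpens.measurableE R)) => _ [_ [a [b ->]] <-].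
apply: borel_open; rewrite openE => x [Ux fx].
rewrite /interior; have /= h : \forall y \near x, `]a, b[%classic (f y).
  by apply: (cf x Ux); apply: open_nbhs_nbhs; split => //; exact: interval_open.
near=> y; split; near: y => //; exact: open_nbhs_nbhs.
Unshelve. all: by end_near. Qed.

Lemma borel_continuousR (T : ptopologicalType) (f : T -> R) :
  continuous f -> measurable_fun setT (f : borel T -> R).
Proof. by move=> cf; apply: borel_continuous_on => [|x _]; [exact: openT|exact: cf]. Qed.

Lemma lipschitz_continuous (V W : normedModType R) (F : V -> W) L :
  (forall y z, `|F y - F z| <= L * `|y - z|) -> continuous F.
Proof.
move=> FL x; apply/cvgrPdist_lt => e e0.
have L1 : 0 < `|L| + 1 by rewrite ltr_pwDr.
near=> y; apply: (le_lt_trans (FL _ _)); apply: (@le_lt_trans _ _ ((`|L| + 1) * `|x - y|)).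
  by apply: ler_wpM2r => //; apply: (le_trans (ler_norm L)); rewrite lerDl.
rewrite mulrC -ltr_pdivlMr//; near: y; rewrite nearE.
have := @nbhsx_ballx _ _ x _ (divr_gt0 e0 L1).
by apply: filterS => y; rewrite -ball_normE.
Unshelve. all: by end_near. Qed.

Lemma measurable_coord n k : measurable_fun setT (fun y : borel 'rV[R]_n => (y : 'rV_n) 0 k).
Proof. by apply: borel_continuousR => y; exact: coord_continuous. Qed.

Lemma leb_rV_ball_lty n (p : 'rV[R]_n) s : 0 < s ->
  (leb_rV n (ball p s : set (borel 'rV[R]_n)) < +oo)%E.
Proof. by move=> s0; rewrite leb_rV_ball// ltry. Qed.

Lemma leb_integrable n (f : borel 'rV[R]_n -> R) (C : R) (p : 'rV[R]_n) s :
  measurable_fun setT f -> (forall y, `|f y| <= C) -> 0 < s ->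
  (forall y : 'rV[R]_n, s <= `|p - y| -> f y = 0) ->
  (leb_rV n).-integrable setT (EFin \o f).
Proof.
move=> mf fC s0 f0.
have mB : measurable (ball p s : set (borel 'rV[R]_n)) by apply: borel_open; exact: ball_open.
have iB : (leb_rV n).-integrable (ball p s : set (borel 'rV[R]_n)) (EFin \o f).
  apply: (@bounded_integrable _ _ _ (leb_rV n) _ _ C) => //.
    exact: leb_rV_ball_lty.
  exact: (measurable_funS measurableT).
have := (integrable_mkcond (EFin \o f) mB).1 iB.
congr (_.-integrable _ _); apply/funext => y; rewrite patchE.
case: ifPn => // /negP yB; rewrite /= f0//; rewrite leNgt; apply/negP => h; apply: yB.
by rewrite inE rV_ballE.
Qed.

Lemma Rintegral_sum d (T : measurableType d) (mu : {measure set T -> \bar R}) (D : set T)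
    (I : finType) (f : I -> T -> R) : measurable D ->
  (forall i, mu.-integrable D (EFin \o f i)) ->
  \int[mu]_(x in D) (\sum_i f i x) = \sum_i \int[mu]_(x in D) f i x.
Proof.
move=> mD int; rewrite /Rintegral.
under eq_integral do rewrite -sumEFin.
rewrite integral_sum//; apply: EFin_inj; rewrite -sumEFin fineK.
  by apply: eq_bigr => i _; rewrite fineK//; exact: (integrable_fin_num mD (int i)).
by apply/sum_fin_numP => i _ _; exact: (integrable_fin_num mD (int i)).
Qed.

Lemma integral_leb_rV_shift n (a : 'rV[R]_n) (f : borel 'rV[R]_n -> R) :
  measurable_fun setT f ->
  \int[leb_rV n]_y f ((y : 'rV[R]_n) + a) = \int[leb_rV n]_y f y.
Proof.
move=> mf; rewrite /Rintegral; congr fine; rewrite [LHS]integralE [RHS]integralE; congr (_ - _)%E.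
- rewrite -[RHS](ge0_integral_leb_rV_shift a).
  + by apply: eq_integral => y _; rewrite !funeposE.
  + by apply: measurable_funepos; exact/measurable_EFinP.
  + by move=> y; exact: funepos_ge0.
- rewrite -[RHS](ge0_integral_leb_rV_shift a).
  + by apply: eq_integral => y _; rewrite !funenegE.
  + by apply: measurable_funeneg; exact/measurable_EFinP.
  + by move=> y; exact: funeneg_ge0.
Qed.

Definition hat n (z : 'rV[R]_n) : R := Num.max 0 (1 - \sum_k z 0 k ^+ 2).
(** The truncated paraboloid [hat] is only Lipschitz; its square has a quadratic Taylor remainder,
    which is the regularity the mollification uses. The sum of squares dominates the square of the
    sup norm, so the support lies in the unit cube. *)
Definition bump n (z : 'rV[R]_n) : R := hat z ^+ 2.

Lemma sqsum_le n (z : 'rV[R]_n) c : `|z| <= c -> \sum_k z 0 k ^+ 2 <= n%:R * c ^+ 2.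
Proof.
move=> zc; apply: (@le_trans _ _ (\sum_(k < n) c ^+ 2)).
  apply: ler_sum => k _; rewrite -real_normK ?num_real// lerXn2r ?nnegrE//.
    exact: le_trans zc.
  exact: le_trans (rV_norm_coord z k) zc.
by rewrite sumr_const card_ord mulr_natl.
Qed.

Lemma hat_ge0 n (z : 'rV[R]_n) : 0 <= hat z.
Proof. by rewrite le_max lexx. Qed.

Lemma hat_le1 n (z : 'rV[R]_n) : hat z <= 1.
Proof. by rewrite ge_max ler01 lerBlDr lerDl sumr_ge0// => k _; exact: sqr_ge0. Qed.

Lemma hat_eq0 n (z : 'rV[R]_n) : 1 <= `|z| -> hat z = 0.
Proof.
move=> z1; apply/max_idPl; rewrite subr_le0.
have z0 : mx_norm z != 0 by apply/eqP => h; move: z1; rewrite /Num.Def.normr /= h; lra.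
have [[i k] /= e] := mx_norm_neq0 z0.
have zk : 1 <= `|z 0 k| by move: z1; rewrite {1}/Num.Def.normr /= e ord1.
rewrite (bigD1 k)//=; apply: (@le_trans _ _ (z 0 k ^+ 2)).
  by rewrite -real_normK ?num_real// expr_ge1.
by rewrite lerDl sumr_ge0// => j _; exact: sqr_ge0.
Qed.

Lemma bump_ge0 n (z : 'rV[R]_n) : 0 <= bump z. Proof. exact: sqr_ge0. Qed.

Lemma bump_le1 n (z : 'rV[R]_n) : bump z <= 1.
Proof. by rewrite expr_le1 ?hat_ge0 ?hat_le1. Qed.

Lemma bump_eq0 n (z : 'rV[R]_n) : 1 <= `|z| -> bump z = 0.
Proof. by move=> z1; rewrite /bump hat_eq0// expr0n. Qed.

(** Serves the positivity of the normalising constant of the mollifier. On this cube the sum of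
    squares is at most n/(n+1)^2 <= 1/2, so [hat] is at least 1/2. *)
Lemma bump_ge n (z : 'rV[R]_n) : `|z| <= n.+1%:R^-1 -> 4^-1 <= bump z.
Proof.
move=> zn; have h := sqsum_le zn.
have h2 : n%:R * (n.+1%:R^-1 : R) ^+ 2 <= 2^-1.
  rewrite exprVn ler_pdivrMr ?exprn_gt0// -natrX.
  rewrite ler_pdivlMl// -natrM ler_nat; nia.
have h4 := le_trans h h2.
have : 2^-1 <= hat z by rewrite le_max; apply/orP; right; clear -h4; lra.
rewrite /bump => h3; have : 0 <= (hat z - 2^-1) * (hat z + 2^-1) by apply: mulr_ge0; lra.
nra.
Qed.

Lemma measurable_hat n : measurable_fun setT (@hat n : borel 'rV[R]_n -> R).
Proof.
apply: measurable_maxr; first exact: measurable_cst.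
apply: measurable_funB; first exact: measurable_cst.
by apply: measurable_sum => k; apply: measurable_funX; exact: measurable_coord.
Qed.

(** Writing [hat z] as max(0, a) and [hat (z + h)] as max(0, a + b), the square of the positive part
    has Taylor remainder at most b^2. For |z| < 2 and |h| < 1 one has |b| <= 5 n |h|, whence 25 n^2;
    the term 2 n pays for the part of b that is quadratic in h. For |z| >= 2 everything vanishes. *)
Lemma bump_quadratic n (z h : 'rV[R]_n) : `|h| < 1 ->
  `|bump (z + h) - bump z - \sum_k h 0 k * (- (4 * hat z) * z 0 k)| <=
    (25 * n%:R ^+ 2 + 2 * n%:R) * `|h| ^+ 2.
Proof.
move=> h1; have [z2|z2] := lerP 2 `|z|.
  have zh : 1 <= `|z + h| by have := lerB_normD z h; lra.
  rewrite !bump_eq0// ?(le_trans _ z2)//; last by rewrite ler1n.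
  rewrite big1 ?subrr ?normr0; last first.
    by move=> k _; rewrite hat_eq0 ?(le_trans _ z2) ?ler1n//; ring.
  by rewrite mulr_ge0 ?exprn_ge0// addr_ge0// mulr_ge0 ?exprn_ge0.
pose b := - \sum_k (2 * z 0 k * h 0 k + h 0 k ^+ 2).
pose a := 1 - \sum_k z 0 k ^+ 2.
have hE : hat (z + h) = Num.max 0 (a + b).
  rewrite /hat /a /b; congr Num.max; rewrite -addrA -opprD -big_split/=; congr (1 - _).
  by apply: eq_bigr => k _; rewrite mxE; ring.
have bE : - \sum_k h 0 k * (- (4 * hat z) * z 0 k) = - (2 * hat z * b) - 2 * hat z * \sum_k h 0 k ^+ 2.
  rewrite /b mulrN opprK !mulr_sumr -sumrN -sumrB; apply: eq_bigr => k _; ring.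
have b_le : `|b| <= n%:R * (5 * `|h|).
  rewrite /b normrN; apply: (le_trans (ler_norm_sum _ _ _)).
  apply: (@le_trans _ _ (\sum_(k < n) (5 * `|h|))); last by rewrite sumr_const card_ord -[leLHS]mulr_natl.
  apply: ler_sum => k _.
  have zk := rV_norm_coord z k; have hk := rV_norm_coord h k.
  apply: (le_trans (ler_normD _ _)); rewrite !normrM ger0_norm//.
  have e1 : `|z 0 k| * `|h 0 k| <= 2 * `|h| by apply: ler_pM => //; exact: le_trans (ltW z2).
  have e2 : `|h 0 k| ^+ 2 <= 1 * `|h| by rewrite expr2; apply: ler_pM => //; exact: le_trans (ltW h1).
  by rewrite -expr2 -mulrA; lra.
have core : `|bump (z + h) - bump z - 2 * hat z * b| <= b ^+ 2.
  rewrite /bump hE /hat -/a.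
  case: (leP 0 (a + b)) => hab; case: (leP 0 a) => ha.
  - by rewrite [X in `|X|](_ : _ = b ^+ 2) ?ger0_norm ?sqr_ge0//; ring.
  - rewrite expr0n /= mulr0 mul0r !subr0 ger0_norm ?sqr_ge0// lerXn2r ?nnegrE//; lra.
  - rewrite expr0n /=; have -> : 0 - a ^+ 2 - 2 * a * b = - (a * (a + b) + a * b) by ring.
    rewrite normrN ler_norml; apply/andP; split; nra.
  - by rewrite !expr0n /= mulr0 mul0r !subr0 normr0 sqr_ge0.
have hs := sqsum_le (lexx `|h|).
rewrite bE addrA (_ : _ - _ = (bump (z + h) - bump z - 2 * hat z * b) - 2 * hat z * \sum_k h 0 k ^+ 2); last ring.
apply: (le_trans (ler_normB _ _)).
have hz0 := hat_ge0 z; have hz1 := hat_le1 z.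
have s0 : 0 <= \sum_k h 0 k ^+ 2 by rewrite sumr_ge0// => k _; exact: sqr_ge0.
have e3 : `|2 * hat z * \sum_k h 0 k ^+ 2| <= 2 * (n%:R * `|h| ^+ 2).
  rewrite ger0_norm ?mulr_ge0//; rewrite -mulrA; apply: ler_wpM2l => //.
  apply: le_trans hs; rewrite -[leRHS]mul1r; exact: ler_wpM2r.
have e4 : b ^+ 2 <= (n%:R * (5 * `|h|)) ^+ 2.
  by rewrite -real_normK ?num_real// lerXn2r ?nnegrE// ?mulr_ge0.
apply: (le_trans (lerD core e3)); apply: (le_trans (lerD e4 (lexx _))).
by rewrite le_eqVlt; apply/orP; left; apply/eqP; ring.
Qed.

Variables (n : nat) (F : 'rV[R]_n -> R) (L s : R) (p : 'rV[R]_n).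
Hypotheses (s0 : 0 < s) (L0 : 0 <= L) (FL : forall y z, `|F y - F z| <= L * `|y - z|).
Hypothesis F0 : forall y, s <= `|p - y| -> F y = 0.

Let mF : measurable_fun setT (F : borel 'rV[R]_n -> R).
Proof. apply: borel_continuousR; exact: lipschitz_continuous FL. Qed.

Let B := `|F p| + L * s.

Let B0 : 0 <= B. Proof. by rewrite addr_ge0// mulr_ge0// ltW. Qed.

Let FB y : `|F y| <= B.
Proof.
have [ys|ys] := lerP s `|p - y|; first by rewrite F0// normr0.
rewrite -[F y](subrK (F p)) addrC; apply: (le_trans (ler_normD _ _)); rewrite lerD2l.
by apply: (le_trans (FL _ _)); rewrite distrC; apply: ler_wpM2l => //; exact: ltW.
Qed.

Variable l : R.
Hypothesis l0 : 0 < l.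

Let c := \int[leb_rV n]_z bump (l *: (z : 'rV[R]_n)).

Let mZ (y : 'rV[R]_n) : measurable_fun setT (fun z : borel 'rV[R]_n => l *: ((z : 'rV[R]_n) - y) : borel 'rV[R]_n).
Proof.
have h : continuous (fun z : 'rV[R]_n => l *: (z - y)).
  apply: (@lipschitz_continuous _ _ _ l) => a b.
  by rewrite -scalerBr normrZ gtr0_norm// opprB addrA subrK.
exact: (borel_continuous h).
Qed.

Let mhat y : measurable_fun setT (fun z : borel 'rV[R]_n => hat (l *: ((z : 'rV[R]_n) - y))).
Proof. exact: (measurableT_comp (@measurable_hat n) (mZ y)). Qed.

Let mbump y : measurable_fun setT (fun z : borel 'rV[R]_n => bump (l *: ((z : 'rV[R]_n) - y))).
Proof. by apply: measurable_funX; exact: mhat. Qed.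

Let scale_ge1 (y z : 'rV[R]_n) : l^-1 <= `|y - z| -> 1 <= `|l *: (z - y)|.
Proof. by move=> h; rewrite normrZ gtr0_norm// distrC -ler_pdivrMl// mulr1. Qed.

Let mbump0 : measurable_fun setT (fun z : borel 'rV[R]_n => bump (l *: (z : 'rV[R]_n))).
Proof. by have := mbump 0; congr (measurable_fun _ _); apply/funext => z; rewrite subr0. Qed.

Let ibump : (leb_rV n).-integrable setT (EFin \o (fun z : borel 'rV[R]_n => bump (l *: (z : 'rV[R]_n)))).
Proof.
apply: (@leb_integrable _ _ 1 0 l^-1) => //; last first.
- move=> z h; rewrite bump_eq0//; have := scale_ge1 h; by rewrite subr0.
- by rewrite invr_gt0.
- by move=> z; rewrite ger0_norm ?bump_ge0 ?bump_le1.
Qed.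

Let c_gt0 : 0 < c.
Proof.
have r0 : 0 < (l * n.+1%:R)^-1 by rewrite invr_gt0 mulr_gt0.
have mb : measurable (ball (0 : 'rV[R]_n) (l * n.+1%:R)^-1 : set (borel 'rV[R]_n)).
  by apply: borel_open; exact: ball_open.
apply: (@lt_le_trans _ _ (4^-1 * ((l * n.+1%:R)^-1 *+ 2) ^+ n)).
  by rewrite mulr_gt0// exprn_gt0// pmulrn_rgt0.
pose U := ball (0 : 'rV[R]_n) (l * n.+1%:R)^-1 : set (borel 'rV[R]_n).
have h1 : ((4^-1 * ((l * n.+1%:R)^-1 *+ 2) ^+ n)%:E <= \int[leb_rV n]_(z in U) (4^-1)%:E)%E.
  by rewrite integral_cst// EFinM -(leb_rV_ball 0 r0).
have h2 : (\int[leb_rV n]_(z in U) (4^-1)%:E <= \int[leb_rV n]_(z in U) (bump (l *: (z : 'rV[R]_n)))%:E)%E.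
  apply: ge0_le_integral => //.
  - by apply/measurable_EFinP; exact: measurable_funS mbump0.
  - move=> z; rewrite /U rV_ballE sub0r normrN => hz; rewrite lee_fin bump_ge//.
    by rewrite normrZ gtr0_norm// -ler_pdivlMl// -invfM ltW.
have h3 : (\int[leb_rV n]_(z in U) (bump (l *: (z : 'rV[R]_n)))%:E <= \int[leb_rV n]_z (bump (l *: (z : 'rV[R]_n)))%:E)%E.
  apply: ge0_subset_integral => //.
  - by apply/measurable_EFinP.
  - by move=> z _; rewrite lee_fin bump_ge0.
have := le_trans h1 (le_trans h2 h3).
by rewrite -(fineK (integrable_fin_num measurableT ibump)) lee_fin.
Qed.

Definition mollify (y : 'rV[R]_n) : R := c^-1 * \int[leb_rV n]_z (F z * bump (l *: ((z : 'rV[R]_n) - y))).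

(** Translation moves [y] from the kernel to [F]. This form shows that the Lipschitz constant is
    inherited; the original form is the one that can be differentiated. *)
Let mollify_shift y : mollify y = c^-1 * \int[leb_rV n]_z (F ((z : 'rV[R]_n) + y) * bump (l *: (z : 'rV[R]_n))).
Proof.
rewrite /mollify; congr (_ * _); rewrite -(integral_leb_rV_shift y); last exact: measurable_funM.
by apply: eq_Rintegral => z _ /=; rewrite addrK.
Qed.

Let ish y : (leb_rV n).-integrable setT (EFin \o (fun z : borel 'rV[R]_n => F ((z : 'rV[R]_n) + y) * bump (l *: (z : 'rV[R]_n)))).
Proof.
apply: (@leb_integrable _ _ B 0 l^-1) => //; last first.
- by move=> z h; rewrite bump_eq0 ?mulr0//; have := scale_ge1 h; rewrite subr0.
- by rewrite invr_gt0.
- move=> z; rewrite normrM -[B]mulr1; apply: ler_pM => //.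
  by rewrite ger0_norm ?bump_ge0 ?bump_le1.
- apply: measurable_funM => //.
  exact: (measurableT_comp mF (measurable_addrV y)).
Qed.

(** Averages against the same kernel are as close as the averaged functions are on its support. The
    three lemmas below take for [u] a translate of [F], the constant [F y], and 0. *)
Let mollify_diff (u : 'rV[R]_n -> R) (y : 'rV[R]_n) (K t : R) :
  (leb_rV n).-integrable setT (EFin \o (fun z : borel 'rV[R]_n => u z * bump (l *: (z : 'rV[R]_n)))) ->
  t = c^-1 * \int[leb_rV n]_z (u z * bump (l *: (z : 'rV[R]_n))) ->
  (forall z : 'rV[R]_n, `|z| < l^-1 -> `|F (z + y) - u z| <= K) ->
  `|mollify y - t| <= K.
Proof.
move=> iu -> uK; have ci : 0 < c^-1 by rewrite invr_gt0.
rewrite mollify_shift -mulrBr normrM (gtr0_norm ci) ler_pdivrMl// mulrC.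
have h := le_normr_Rintegral measurableT (integrableB measurableT (ish y) iu).
rewrite -RintegralB//; apply: (le_trans h).
rewrite -RintegralZl//; apply: le_Rintegral => //.
- exact: (integrable_norm (integrableB measurableT (ish y) iu)).
- have := integrableZl measurableT K ibump.
  by congr (_.-integrable _ _); apply/funext.
- move=> z _ /=; rewrite -mulrBl normrM (ger0_norm (bump_ge0 _)).
  have [zl|zl] := ltrP `|z| l^-1; first by apply: ler_wpM2r; [exact: bump_ge0|exact: uK].
  by rewrite bump_eq0 ?mulr0//; have := @scale_ge1 0 z; rewrite sub0r normrN subr0; exact.
Qed.

Lemma mollify_lipschitz y z : `|mollify y - mollify z| <= L * `|y - z|.
Proof.
apply: (mollify_diff (u := fun w => F (w + z))) => //.
by move=> w _; apply: (le_trans (FL _ _)); rewrite opprD addrACA subrr add0r.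
Qed.

Lemma mollify_close y : `|mollify y - F y| <= L / l.
Proof.
apply: (mollify_diff (u := fun w => F y)) => //.
- have := integrableZl measurableT (F y) ibump.
  by congr (_.-integrable _ _); apply/funext.
- by rewrite RintegralZl// -/c mulrCA mulVf ?mulr1// gt_eqF.
- move=> w wl; apply: (le_trans (FL _ _)); rewrite addrK; apply: ler_wpM2l => //; exact: ltW.
Qed.

Lemma mollify_supp y : s + l^-1 <= `|p - y| -> mollify y = 0.
Proof.
move=> h; apply/eqP; rewrite -normr_le0 -[mollify y]subr0.
apply: (mollify_diff (u := fun=> 0)) => //.
- have := integrableZl measurableT 0 ibump.
  by congr (_.-integrable _ _); apply/funext.
- by rewrite RintegralZl// mul0r mulr0.
- move=> w wl; rewrite subr0 F0 ?normr0//.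
  have := lerB_dist (p - y) w; rewrite opprD addrA => h2.
  by rewrite addrAC; lra.
Qed.

(** The derivative falls on the kernel: the remainder of [bump_quadratic] is uniform in the
    integration variable and is integrated against |F|. *)
Lemma mollify_differentiable y : differentiable mollify y.
Proof.
(* [F z] times the k-th partial derivative in [y] of the kernel; the two signs, from the square of
   [hat] and from z - y, cancel. *)
pose g k (z : borel 'rV[R]_n) := F z * (l * (4 * hat (l *: ((z : 'rV[R]_n) - y)) * (l *: ((z : 'rV[R]_n) - y)) 0 k)).
have ig k : (leb_rV n).-integrable setT (EFin \o g k).
  apply: (@leb_integrable _ _ (B * (l * 4)) y l^-1) => //; last first.
  - by move=> z h; rewrite /g hat_eq0 ?scale_ge1//; ring.
  - by rewrite invr_gt0.
  - move=> z; rewrite /g normrM; apply: ler_pM => //.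
    rewrite normrM (gtr0_norm l0); apply: ler_wpM2l; first exact: ltW.
    rewrite !normrM (ger0_norm (hat_ge0 _)) (ger0_norm (ler0n R 4)).
    rewrite -[leRHS]mulr1 -mulrA; apply: ler_wpM2l => //.
    have [zl|zl] := ltrP `|l *: ((z : 'rV[R]_n) - y)| 1; last by rewrite hat_eq0// mul0r.
    rewrite -[leRHS]mulr1; apply: ler_pM => //; [exact: hat_ge0|exact: hat_le1|].
    by apply: le_trans (ltW zl); exact: rV_norm_coord.
  - apply: measurable_funM => //; apply: measurable_funM => //.
    apply: measurable_funM; first by apply: measurable_funM => //; exact: mhat.
    exact: (measurableT_comp (measurable_coord k) (mZ y)).
have iFb x : (leb_rV n).-integrable setT (EFin \o (fun z : borel 'rV[R]_n => F z * bump (l *: ((z : 'rV[R]_n) - x)))).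
  apply: (@leb_integrable _ _ B p s) => //.
  - exact: measurable_funM.
  - move=> z; rewrite normrM -[B]mulr1; apply: ler_pM => //.
    by rewrite ger0_norm ?bump_ge0 ?bump_le1.
  - by move=> z /F0 ->; rewrite mul0r.
have iF : (leb_rV n).-integrable setT (EFin \o (fun z : borel 'rV[R]_n => `|F z|)).
  apply: (@leb_integrable _ _ B p s) => //.
  - exact: measurableT_comp.
  - by move=> z; rewrite normr_id.
  - by move=> z /F0 ->; rewrite normr0.
pose Q : R := 25 * n%:R ^+ 2 + 2 * n%:R.
apply: (@differentiable_quadratic _ _ _ _ (fun k => c^-1 * \int[leb_rV n]_z g k z)
   (c^-1 * ((\int[leb_rV n]_z `|F z|) * (Q * l ^+ 2))) l^-1); first by rewrite invr_gt0.
move=> h hl.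
have ihg : (leb_rV n).-integrable setT (EFin \o (fun z => \sum_k h 0 k * g k z)).
  have -> : EFin \o (fun z => \sum_k h 0 k * g k z) = (fun z => (\sum_k (h 0 k)%:E * (g k z)%:E)%E).
    by apply/funext => z /=; rewrite -sumEFin; apply: eq_bigr => k _.
  by apply: integrable_sum => // k _; exact: (integrableZl measurableT (h 0 k) (ig k)).
have -> : \sum_k h 0 k * (c^-1 * \int[leb_rV n]_z g k z) = c^-1 * \int[leb_rV n]_z (\sum_k h 0 k * g k z).
  rewrite Rintegral_sum//; last first.
    by move=> k; have := integrableZl measurableT (h 0 k) (ig k); congr (_.-integrable _ _); apply/funext.
  by rewrite mulr_sumr; apply: eq_bigr => k _; rewrite RintegralZl// mulrCA.
have ci : 0 < c^-1 by rewrite invr_gt0.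
rewrite /mollify -mulrBr -mulrBr normrM (gtr0_norm ci) -[leRHS]mulrA; apply: ler_wpM2l; first exact: ltW.
have i1 := integrableB measurableT (iFb (h + y)) (iFb y).
have i2 := integrableB measurableT i1 ihg.
rewrite -RintegralB// -RintegralB//.
apply: (le_trans (le_normr_Rintegral measurableT i2)).
apply: (@le_trans _ _ (\int[leb_rV n]_z (`|F z| * (`|h| ^+ 2 * (Q * l ^+ 2))))); last first.
  by rewrite RintegralZr// le_eqVlt; apply/orP; left; apply/eqP; ring.
apply: le_Rintegral => //.
- exact: (integrable_norm i2).
- have := integrableZr measurableT (`|h| ^+ 2 * (Q * l ^+ 2)) iF.
  by congr (_.-integrable _ _); apply/funext => z /=; rewrite -EFinM; congr EFin; ring.
- move=> z _ /=.
  pose w := l *: ((z : 'rV[R]_n) - y).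
  have wl : `|- (l *: h)| < 1 by rewrite normrN normrZ gtr0_norm// -ltr_pdivlMl// mulr1.
  have key := bump_quadratic w wl.
  have -> : F z * bump (l *: ((z : 'rV[R]_n) - (h + y))) - F z * bump (l *: ((z : 'rV[R]_n) - y)) - \sum_k h 0 k * g k z =
    F z * (bump (w + - (l *: h)) - bump w - \sum_k (- (l *: h)) 0 k * (- (4 * hat w) * w 0 k)).
    rewrite [RHS]mulrBr [in RHS]mulrBr; congr (_ - _ - _).
      by rewrite /w -scalerBr -addrA [- y - h]addrC -opprD.
    rewrite mulr_sumr; apply: eq_bigr => k _; rewrite /g -/w !mxE; ring.
  rewrite normrM; apply: ler_wpM2l => //; apply: (le_trans key).
  by rewrite normrN normrZ gtr0_norm// exprMn -/Q le_eqVlt; apply/orP; left; apply/eqP; ring.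
Qed.
End mollification.

(** * Almost everywhere gradients of Lipschitz functions *)

Section gradient_limit.
Context {R : realType}.

Lemma harmonic_dnbhs : (fun m : nat => m.+1%:R^-1 : R) @ \oo --> (0 : R)^'.
Proof.
move=> A hA; have h : nbhs (0 : R) [set x | x != 0 -> A x] := hA.
have h2 : \forall m \near \oo, (m.+1%:R^-1 : R) != 0 -> A m.+1%:R^-1 := @cvg_harmonic R _ h.
suff : \forall m \near \oo, A (m.+1%:R^-1) by [].
apply: filterS h2 => m hm; apply: hm.
by rewrite gt_eqF// invr_gt0.
Qed.

Lemma near0_derive (V W : normedModType R) (f : V -> W) (x v : V) :
  (\forall y \near x, f y = 0) -> 'D_v f x = 0.
Proof.
move=> h; by rewrite (@near_eq_derive _ _ _ f (cst 0) x v h) derive_cst.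
Qed.

Lemma measurable_derive n (G : 'rV[R]_n -> R) v : (forall y, derivable G y v) ->
  continuous G -> measurable_fun setT ('D_v G : borel 'rV[R]_n -> R).
Proof.
move=> dG cG.
apply: (@measurable_fun_cvg _ _ _ setT
  (fun m (y : borel 'rV[R]_n) => (m.+1%:R^-1)^-1 * (G (m.+1%:R^-1 *: v + (y : 'rV[R]_n)) - G y))).
  move=> m; apply: measurable_funM; first exact: measurable_cst.
  have mG : measurable_fun setT (G : borel 'rV[R]_n -> R) by exact: borel_continuousR.
  apply: measurable_funB => //.
  have := measurableT_comp mG (measurable_addrV (m.+1%:R^-1 *: v)).
  by congr (measurable_fun _ _); apply/funext => y /=; rewrite addrC.
move=> y _; exact: (cvg_comp _ _ harmonic_dnbhs (dG y)).
Qed.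

(* The admissible approximations are stable under midpoints, so that a sequence
   nearly minimising the Dirichlet energy has gradients converging a.e. *)
Lemma lipschitz_gradient n (F : 'rV[R]_n -> R) (L s : R) (p : 'rV[R]_n) :
  0 < s -> 0 <= L -> (forall y z, `|F y - F z| <= L * `|y - z|) ->
  (forall y, s <= `|p - y| -> F y = 0) ->
  exists (G : nat -> 'rV[R]_n -> R) (W : 'rV[R]_n -> 'rV[R]_n),
  (forall m y, differentiable (G m) y) /\
  (forall m y z, `|G m y - G m z| <= L * `|y - z|) /\
  (forall m y, `|G m y - F y| <= L * m.+1%:R^-1) /\
  (forall m y, s + m.+1%:R^-1 <= `|p - y| -> G m y = 0) /\
  (forall k, measurable_fun setT (fun y : borel 'rV[R]_n => W y 0 k)) /\
  (forall y k, `|W y 0 k| <= L) /\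
  (forall y, s < `|p - y| -> W y = 0) /\
  {ae leb_rV n, forall y : borel 'rV[R]_n, forall k, (fun m => partial k (G m) y) @ \oo --> W y 0 k}.
Proof.
move=> s0 L0 FL F0.
pose P m := [set G : 'rV[R]_n -> R | [/\ forall y, differentiable G y,
  forall y z, `|G y - G z| <= L * `|y - z|, forall y, `|G y - F y| <= L * m.+1%:R^-1 &
  forall y, s + m.+1%:R^-1 <= `|p - y| -> G y = 0]].
pose mid (G H : 'rV[R]_n -> R) := 2^-1 *: (G + H).
have partial_le k G m y : P m G -> `|partial k G y| <= L.
  move=> [dG GL _ _]; rewrite /partial; apply: (le_trans (derive_lipschitz _ GL)).
    exact: diff_derivable.
  by rewrite -[leRHS]mulr1; apply: ler_wpM2l => //; exact: rV_norm_delta.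
have mpartial k G m : P m G -> measurable_fun setT (partial k G : borel 'rV[R]_n -> R).
  move=> [dG GL _ _]; apply: measurable_derive.
    by move=> y; exact: diff_derivable.
  exact: lipschitz_continuous GL.
(* The convergence argument runs on a set of finite measure containing the closed ball of radius
   [s]; beyond that radius the gradients are eventually zero, by [out0] below. *)
pose D : set (borel 'rV[R]_n) := ball p (s + 1).
have s1 : 0 < s + 1 by rewrite addr_gt0.
have mD : measurable D by apply: borel_open; exact: ball_open.
have [||||||G [PG Gae]] := @midpoint_ae_cvg R _ _ (leb_rV n) D 'I_n _ mid (@partial R n) P L mD (leb_rV_ball_lty p s1).
- move=> m; exists (mollify F m.+1%:R); split.
  + by apply: mollify_differentiable FL F0 _ _.
  + by apply: mollify_lipschitz FL F0 _ _.
  + by move=> y; apply: (mollify_close (s := s) (p := p)).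
  + by apply: mollify_supp FL F0 _ _.
- move=> m k G mk [dG GL GF G0]; have le1 : k.+1%:R^-1 <= m.+1%:R^-1 :> R.
    by rewrite lef_pV2 ?posrE// ler_nat.
  split => //.
  + by move=> y; apply: (le_trans (GF y)); exact: ler_wpM2l.
  + by move=> y h; apply: G0; apply: le_trans h; rewrite lerD2l.
- move=> m G H [dG GL GF G0] [dH HL HF H0]; split.
  + by move=> y; apply: differentiableZ; apply: differentiableD.
  + move=> y z; rewrite /mid !fctE -scalerBr normrZ ger0_norm// opprD addrACA.
    rewrite /GRing.scale/= ler_pdivrMl//; apply: (le_trans (ler_normD _ _)).
    by have := GL y z; have := HL y z; lra.
  + move=> y; rewrite /mid !fctE (_ : _ - _ = 2^-1 * ((G y - F y) + (H y - F y))); last first.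
      by rewrite /GRing.scale/=; field.
    rewrite normrM ger0_norm// ler_pdivrMl//; apply: (le_trans (ler_normD _ _)).
    by apply: (le_trans (lerD (GF y) (HF y))); rewrite mulr_natl mulr2n.
  + by move=> y h; rewrite /mid !fctE G0// H0// addr0 scaler0.
- move=> k G H y [dG _ _ _] [dH _ _ _]; rewrite /partial /mid.
  have dg := @diff_derivable _ _ _ G y (delta_mx 0 k) (dG y).
  have dh := @diff_derivable _ _ _ H y (delta_mx 0 k) (dH y).
  rewrite deriveZ; last exact: derivableD.
  by rewrite (deriveD dg dh) /GRing.scale/= mulrC.
- by move=> k G PG; apply: measurable_funS (mpartial k G 0%N PG).
- by move=> k G y PG; exact: (partial_le _ _ 0%N).
have aux (x y z t i : R) : x <= z + y -> y < x - (t + i) -> t + i <= z by lra.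
have out0 y k : s < `|p - y| -> (fun m => partial k (G m) y) @ \oo --> (0 : R).
  move=> sy; apply: cvg_near_cst.
  have d0 : 0 < `|p - y| - s by rewrite subr_gt0.
  have := near_infty_natSinv_lt (PosNum d0); apply: filterS => m /= hm.
  apply: near0_derive.
  have [_ _ _ G0] := PG m.
  have e0 : 0 < `|p - y| - (s + m.+1%:R^-1) by rewrite subr_gt0 -ltrBrDl.
  have := @nbhsx_ballx _ _ y _ e0; apply: filterS => z; rewrite rV_ballE => hz.
  apply: G0; apply: aux hz; rewrite (distrC y); exact: ler_distD.
(* The upper limit is measurable and equals the limit wherever there is one; the clamping keeps the
   bound [L] at the remaining points. *)
pose W (y : 'rV[R]_n) : 'rV[R]_n := \row_k Num.max (- L) (Num.min L (limn_sup (fun m => partial k (G m) y))).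
have WE y k a : (fun m => partial k (G m) y) @ \oo --> a -> W y 0 k = a.
  move=> h; rewrite mxE cvg_limn_supE; last by apply/cvg_ex; exists a.
  rewrite (cvg_lim _ h)//.
  have aL : `|a| <= L.
    apply: (cvgr_to_le (cvg_norm h)); apply: nearW => m; exact: (partial_le _ _ _ _ (PG m)).
  by move: aL; rewrite ler_norml => /andP[a1 a2]; rewrite (min_idPr a2) (max_idPr a1).
exists G, W; (split; [|split; [|split; [|split; [|split; [|split; [|split]]]]]]).
- by move=> m y; have [] := PG m.
- by move=> m y z; have [_ h _ _] := PG m; exact: h.
- by move=> m y; have [_ _ h _] := PG m; exact: h.
- by move=> m y; have [_ _ _ h] := PG m; exact: h.
- move=> k; under eq_fun do rewrite mxE.
  apply: measurable_maxr; first exact: measurable_cst.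
  apply: measurable_minr; first exact: measurable_cst.
  apply: measurable_fun_limn_sup.
  + move=> y _; exists L => _ [m _ <-]; have := partial_le k _ _ y (PG m); by rewrite ler_norml => /andP[].
  + move=> y _; exists (- L) => _ [m _ <-]; have := partial_le k _ _ y (PG m); by rewrite ler_norml => /andP[].
  + by move=> m; exact: mpartial (PG m).
- move=> y k; rewrite mxE ler_norml le_max lexx /= ge_max ge_min lexx /= andbT; lra.
- by move=> y h; apply/rowP => k; rewrite (WE _ _ _ (out0 y k h)) mxE.
- move: Gae; apply: filterS => y h k.
  have [sy|sy] := ltrP s `|p - y|.
    by have h0 := out0 y k sy; rewrite (WE _ _ _ h0).
  have Dy : D y by rewrite /D rV_ballE; apply: (le_lt_trans sy); rewrite ltrDl.
  by have /cvg_ex[a ha] := h Dy k; rewrite (WE _ _ _ ha).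
Qed.
End gradient_limit.

(** * Integration by parts *)

Section integration_by_parts.
Context {R : realType}.

Lemma line_is_derive (V W : normedModType R) (f : V -> W) y v (t : R) :
  derivable f (t *: v + y) v ->
  is_derive t 1 (fun t : R => f (t *: v + y)) ('D_v f (t *: v + y)).
Proof.
move=> df.
have E : (fun h : R => h^-1 *: (((fun t : R => f (t *: v + y)) \o shift t) (h *: 1) - f (t *: v + y))) =
         (fun h : R => h^-1 *: ((f \o shift (t *: v + y)) (h *: v) - f (t *: v + y))).
  by apply/funext => h /=; rewrite [h%:A]mulr1 scalerDl addrA.
split; first by rewrite /derivable /= E; exact: df.
by rewrite /derive E.
Qed.

Lemma mean_value_line (V : normedModType R) (f : V -> R) y v (t C : R) : 0 <= t ->
  (forall a, 0 <= a <= t -> derivable f (a *: v + y) v /\ `|'D_v f (a *: v + y)| <= C) ->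
  `|f (t *: v + y) - f y| <= C * t.
Proof.
move=> t0 H; have [->|tn0] := eqVneq t 0.
  by rewrite scale0r add0r subrr normr0 mulr0.
have tp : 0 < t by rewrite lt_def tn0.
have dg a : 0 <= a <= t -> is_derive a 1 (fun t : R => f (t *: v + y)) ('D_v f (a *: v + y)).
  by move=> /H[d _]; exact: line_is_derive.
have [||c ct] := @MVT_segment _ (fun t : R => f (t *: v + y)) (fun a => 'D_v f (a *: v + y)) 0 t t0.
- by move=> a; rewrite in_itv /= => /andP[a0 at_]; apply: dg; rewrite !ltW.
- apply: derivable_within_continuous => a; rewrite in_itv /= => h; have [] := dg a h; by [].
rewrite scale0r add0r subr0 => ->; rewrite normrM (ger0_norm t0).
by apply: ler_wpM2r => //; move: ct; rewrite in_itv /= => /H[].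
Qed.

Lemma locally_bounded_compact (T : topologicalType) (K : set T) (f : T -> R) :
  compact K -> (forall x, K x -> exists C : R, \forall y \near x, `|f y| <= C) ->
  exists C : R, forall x, K x -> `|f x| <= C.
Proof.
move=> /compact_near_coveringP cK H.
have := cK R (pinfty_nbhs R) (fun C x => `|f x| <= C) _ _.
move=> /(_ _ _) [] //.
  move=> x /H[C hC]; exists ([set y | `|f y| <= C], [set D | C <= D]) => /=.
    by split => //; apply: nbhs_pinfty_ge; exact: num_real.
  by move=> [y D] /= [h1 h2]; exact: le_trans h1 h2.
move=> C [Cr h]; exists (C + 1) => x Kx; by apply: h => //; rewrite ltrDl.
Qed.

Lemma continuous_bounded_compact (T : topologicalType) (K : set T) (f : T -> R) :
  compact K -> (forall x, K x -> {for x, continuous f}) ->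
  exists C : R, forall x, K x -> `|f x| <= C.
Proof.
move=> cK cf; apply: locally_bounded_compact => // x Kx; exists (`|f x| + 1).
have /cvgrPdist_le/(_ 1 ltr01) := cf x Kx; apply: filterS => z hz.
by rewrite -lerBlDl; apply: le_trans hz; rewrite distrC; exact: lerB_dist.
Qed.

Lemma rV_closed_ball_compact n (p : 'rV[R]_n) s : compact [set y | `|p - y| <= s].
Proof.
have [s0|s0] := ltrP s 0.
  rewrite (_ : [set y | _] = set0); first exact: compact0.
  by apply/seteqP; split => // y /= h; have := le_lt_trans h s0; rewrite normr_lt0.
have := @rV_compact R n (fun k => `[p 0 k - s, p 0 k + s]%classic) (fun k => @segment_compact _ _ _).
congr compact; apply/seteqP; split => y /= h.
  by apply: rV_norm_le => // k; have := h k; rewrite in_itv/= !mxE ler_norml => /andP[]; lra.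
move=> k; have := le_trans (rV_norm_coord _ k) h.
by rewrite !mxE in_itv/= ler_norml => /andP[]; lra.
Qed.

Lemma Rdominated_cvg d (T : measurableType d) (mu : {measure set T -> \bar R}) (D : set T)
    (f_ : nat -> T -> R) (f g : T -> R) : measurable D ->
  (forall m, measurable_fun D (f_ m)) -> measurable_fun D f ->
  {ae mu, forall x, D x -> (fun m => f_ m x) @ \oo --> f x} ->
  mu.-integrable D (EFin \o g) -> (forall m x, D x -> `|f_ m x| <= g x) ->
  (fun m => \int[mu]_(x in D) f_ m x) @ \oo --> \int[mu]_(x in D) f x.
Proof.
move=> mD mf_ mf f_f ig f_g.
have [||||//|if_ _ cv] := @dominated_convergence _ _ _ mu D mD (fun m x => (f_ m x)%:E)
  (fun x => (f x)%:E) (fun x => (g x)%:E).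
- by move=> m; exact/measurable_EFinP.
- exact/measurable_EFinP.
- move: f_f; apply: filterS => x h Dx; apply: cvg_EFin; [exact: nearW|exact: h].
- exact: ig.
- by apply: aeW => x m Dx; rewrite lee_fin; exact: f_g.
have h := integrable_fin_num mD if_.
by rewrite -(fineK h) in cv; have /fine_cvgP[_] := cv.
Qed.

(** Difference quotients integrate to zero by translation invariance. With steps at most 1 they are
    bounded by [C] and supported in the ball of radius s + 1, so dominated convergence applies. *)
Lemma Rintegral_partial_eq0 n (f : 'rV[R]_n -> R) (k : 'I_n) (C s : R) (p : 'rV[R]_n) :
  0 < s -> (forall y, differentiable f y) -> (forall y, `|partial k f y| <= C) ->
  (forall y, s <= `|p - y| -> f y = 0) ->
  \int[leb_rV n]_y partial k f y = 0.
Proof.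
move=> s0 df fC f0.
have C0 : 0 <= C by apply: le_trans (fC 0).
have cf : continuous f by move=> y; exact: differentiable_continuous.
have mf : measurable_fun setT (f : borel 'rV[R]_n -> R) by exact: borel_continuousR.
pose e : 'rV[R]_n := delta_mx 0 k.
have dfe y : derivable f y e by exact: diff_derivable.
pose q m (y : borel 'rV[R]_n) := (m.+1%:R^-1)^-1 * (f (m.+1%:R^-1 *: e + (y : 'rV[R]_n)) - f y).
have mshift m : measurable_fun setT (fun y : borel 'rV[R]_n => f (m.+1%:R^-1 *: e + (y : 'rV[R]_n))).
  have := measurableT_comp mf (measurable_addrV (m.+1%:R^-1 *: e)).
  by congr (measurable_fun _ _); apply/funext => y /=; rewrite addrC.
have mq m : measurable_fun setT (q m).
  by apply: measurable_funM => //; apply: measurable_funB.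
have i0 m : 0 < m.+1%:R^-1 :> R by rewrite invr_gt0.
have qC m y : `|q m y| <= C.
  rewrite normrM gtr0_norm ?invr_gt0// ler_pdivrMl// mulrC.
  by apply: mean_value_line => [|a _]; [exact: ltW|split; [exact: dfe|exact: fC]].
have le1 m : m.+1%:R^-1 <= 1 :> R by rewrite invf_le1// ler1n.
have f1 m (y : 'rV[R]_n) : s + 1 <= `|p - y| -> f (m.+1%:R^-1 *: e + y) = 0.
  move=> h; apply: f0; have h2 := ler_distD (m.+1%:R^-1 *: e + y) p y.
  have h3 : `|m.+1%:R^-1 *: e + y - y| <= 1.
    rewrite addrK normrZ gtr0_norm// -[leRHS]mulr1; apply: ler_pM => //; exact: rV_norm_delta.
  have aux (a b c d : R) : a <= b + c -> c <= 1 -> d + 1 <= a -> d <= b by lra.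
  exact: aux h2 h3 h.
have q0 m (y : 'rV[R]_n) : s + 1 <= `|p - y| -> q m y = 0.
  by move=> h; rewrite /q f1// f0 ?subr0 ?mulr0//; apply: le_trans h; rewrite lerDl.
have s1 : 0 < s + 1 by rewrite addr_gt0.
have [B fB] : exists B : R, forall y, `|f y| <= B.
  have [B hB] : exists B : R, forall y, `|p - y| <= s -> `|f y| <= B.
    have [y _|B hB] := @locally_bounded_compact _ _ f (@rV_closed_ball_compact n p s); last by exists B.
    exists (`|f y| + 1); have /cvgrPdist_le/(_ 1 ltr01) := cf y; apply: filterS => z hz.
    by rewrite -lerBlDl; apply: le_trans hz; rewrite distrC; exact: lerB_dist.
  exists (Num.max B 0) => y; rewrite le_max; have [h|h] := lerP s `|p - y|.
    by rewrite f0// normr0 lexx orbT.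
  by rewrite hB// ltW.
have if_ : (leb_rV n).-integrable setT (EFin \o (f : borel 'rV[R]_n -> R)).
  exact: (leb_integrable mf fB s0 f0).
have ifs m : (leb_rV n).-integrable setT (EFin \o (fun y : borel 'rV[R]_n => f (m.+1%:R^-1 *: e + (y : 'rV[R]_n)))).
  by apply: (leb_integrable (mshift m) _ s1 (f1 m)).
have q_int0 m : \int[leb_rV n]_y q m y = 0.
  have iB : (leb_rV n).-integrable setT (EFin \o (fun y : borel 'rV[R]_n => f (m.+1%:R^-1 *: e + (y : 'rV[R]_n)) - f y)).
    by have := integrableB measurableT (ifs m) if_; congr (_.-integrable _ _); apply/funext.
  rewrite /q RintegralZl// RintegralB//.
  have -> : \int[leb_rV n]_y f (m.+1%:R^-1 *: e + (y : 'rV[R]_n)) = \int[leb_rV n]_y f y.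
    rewrite -[RHS](integral_leb_rV_shift (m.+1%:R^-1 *: e))//.
    by apply: eq_Rintegral => y _; rewrite addrC.
  by rewrite subrr mulr0.
have iC : (leb_rV n).-integrable setT (EFin \o (fun y : borel 'rV[R]_n => C * \1_(ball p (s + 1) : set (borel 'rV[R]_n)) y)).
  apply: (@leb_integrable _ _ _ C p (s + 1)) => //.
  - apply: measurable_funM => //; apply: measurable_indic; apply: borel_open; exact: ball_open.
  - by move=> y; rewrite indicE normrM ger0_norm// -[leRHS]mulr1; apply: ler_wpM2l => //; case: (_ \in _); rewrite ?normr1 ?normr0.
  - move=> y h; rewrite indicE memNset ?mulr0// rV_ballE; apply/negP; rewrite -leNgt//.
have mp : measurable_fun setT (partial k f : borel 'rV[R]_n -> R) by exact: measurable_derive.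
have qp : (fun m => \int[leb_rV n]_y q m y) @ \oo --> \int[leb_rV n]_y partial k f y.
  apply: (Rdominated_cvg measurableT _ mp _ iC) => //.
  - by apply: aeW => y _; exact: (cvg_comp _ _ harmonic_dnbhs (dfe y)).
  - move=> m y _; rewrite indicE; have [yB|yB] := boolP (y \in _); first by rewrite mulr1.
    rewrite q0 ?normr0 ?mulr0// leNgt; apply/negP => h; move/negP: yB; apply.
    by rewrite inE rV_ballE.
have qE : (fun m => \int[leb_rV n]_y q m y) = cst 0 by apply/funext => m; exact: q_int0.
by rewrite qE in qp; rewrite -(cvg_lim _ qp)// lim_cst.
Qed.

End integration_by_parts.

Section test_functions.
Context {R : realType} {n : nat}.
Implicit Types (U K : set 'rV[R]_n) (h : 'rV[R]_n -> R).

Lemma compact_rV_bounded K : compact K -> exists2 s, 0 < s & forall y, s <= `|0 - y| -> ~ K y.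
Proof.
move=> cK; have [y _|C hC] := @continuous_bounded_compact R _ _ (fun y : 'rV[R]_n => `|y|) cK.
  exact: norm_continuous.
exists (Num.max (C + 1) 1); first by rewrite lt_max ltr01 orbT.
move=> y h Ky; have := hC _ Ky; rewrite normr_id; move: h; rewrite sub0r normrN ge_max => /andP[]; lra.
Qed.

Lemma continuous_bounded_support h K : compact K -> continuous h ->
  (forall y, ~ K y -> h y = 0) -> exists2 C, 0 <= C & forall y, `|h y| <= C.
Proof.
move=> cK ch h0; have [C hC] := continuous_bounded_compact cK (fun y _ => ch y).
exists (Num.max C 0) => [|y]; first by rewrite le_max lexx orbT.
rewrite le_max; have [/hC ->//|/h0 ->] := pselect (K y); by rewrite normr0 lexx orbT.
Qed.

Lemma smooth_on_differentiable U h y : smooth_on U h -> U y -> differentiable h y.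
Proof. by move=> sh Uy; exact: (sh [::] y Uy). Qed.

Lemma smooth_on_partial U h k y : smooth_on U h -> U y -> differentiable (partial k h) y.
Proof. by move=> sh Uy; exact: (sh [:: k] y Uy). Qed.

Lemma support_partial h K k : compact K -> (forall y, ~ K y -> h y = 0) ->
  forall y, ~ K y -> partial k h y = 0.
Proof.
move=> cK h0 y Ky; apply: near0_derive.
have oK : open (~` K) by apply: closed_openC; apply: compact_closed => //; exact: norm_hausdorff.
by have := open_nbhs_nbhs (conj oK Ky); apply: filterS => z; exact: h0.
Qed.

Lemma integrable_compact_support (U : set (borel 'rV[R]_n)) (f : borel 'rV[R]_n -> R) K C :
  measurable U -> measurable_fun U f -> compact K ->
  (forall y, U y -> `|f y| <= C) -> (forall y : 'rV[R]_n, U y -> ~ K y -> f y = 0) ->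
  (leb_rV n).-integrable U (EFin \o f).
Proof.
move=> mU mf cK fC f0; have [s s0 hs] := compact_rV_bounded cK.
apply/(integrable_mkcond _ mU).
have -> : (EFin \o f) \_ U = EFin \o (f \_ U).
  by apply/funext => y; rewrite /= !patchE; case: ifP.
apply: (@leb_integrable _ _ _ (Num.max C 0) 0 s) => //.
- by apply/(measurable_restrictT _ mU).
- move=> y; rewrite patchE; case: ifPn => [|_]; last by rewrite normr0 le_max lexx orbT.
  by rewrite inE => Uy; rewrite le_max fC.
- by move=> y h; rewrite patchE; case: ifPn => //; rewrite inE => Uy; apply: f0 => //; exact: hs.
Qed.

(** The product u h, extended by 0 outside [U], is differentiable everywhere because the support of
    [h] is a compact subset of [U]; its partial derivative then integrates to zero. *)
Lemma integration_by_parts_test U (u h : 'rV[R]_n -> R) k C : open U ->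
  (forall y, U y -> differentiable u y) -> test_function U h ->
  (forall y, U y -> h y != 0 -> `|u y| <= C /\ `|partial k u y| <= C) ->
  (forall y, U y -> `|u y * partial k h y| <= C) ->
  \int[leb_rV n]_(y in (U : set (borel 'rV[R]_n))) (u y * partial k h y) =
  - \int[leb_rV n]_(y in (U : set (borel 'rV[R]_n))) (partial k u y * h y).
Proof.
move=> oU du [sh [K [cK KU h0]]] uC uhC.
have dh y : differentiable h y by exact: (smooth_on_differentiable sh).
have ch : continuous h by move=> y; exact: differentiable_continuous.
have dph y : differentiable (partial k h) y by exact: (smooth_on_partial k sh).
have cph : continuous (partial k h) by move=> y; exact: differentiable_continuous.
have [Bh Bh0 hB] := continuous_bounded_support cK ch h0.
have [s s0 hs] := compact_rV_bounded cK.
have mU : measurable (U : set (borel 'rV[R]_n)) by exact: borel_open.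
have mu_ : measurable_fun (U : set (borel 'rV[R]_n)) (u : borel 'rV[R]_n -> R).
  by apply: borel_continuous_on => // y Uy; apply: differentiable_continuous; exact: du.
have mh : measurable_fun setT (h : borel 'rV[R]_n -> R) by exact: borel_continuousR.
have mph : measurable_fun setT (partial k h : borel 'rV[R]_n -> R) by exact: borel_continuousR.
pose f y := if y \in U then u y * h y else 0.
have oK : open (~` K) by apply: closed_openC; apply: compact_closed => //; exact: norm_hausdorff.
have fK y : ~ K y -> f y = 0 by move=> /h0 e; rewrite /f e mulr0; case: ifP.
have fU y : U y -> \forall z \near y, u z * h z = f z.
  move=> Uy; have := open_nbhs_nbhs (conj oU Uy); apply: filterS => z Uz.
  by rewrite /f mem_set.
have fE y : U y -> partial k f y = partial k u y * h y + u y * partial k h y.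
  move=> Uy; rewrite /partial -(near_eq_derive _ (fU y Uy)).
  have du' := @diff_derivable _ _ _ u y (delta_mx 0 k) (du y Uy).
  have dh' := @diff_derivable _ _ _ h y (delta_mx 0 k) (dh y).
  by rewrite (deriveM du' dh') /GRing.scale/= addrC [h y * _]mulrC.
have fnU y : ~ U y -> \forall z \near y, f z = 0.
  move=> Uy; have Ky : (~` K) y by move=> /KU.
  by have := open_nbhs_nbhs (conj oK Ky); apply: filterS => z; exact: fK.
have df y : differentiable f y.
  have [Uy|Uy] := pselect (U y).
    by apply: (near_eq_differentiable (fU y Uy)); apply: differentiableM => //; exact: du.
  apply: (@near_eq_differentiable _ _ _ (cst 0)); last exact: differentiable_cst.
  by have := fnU y Uy; apply: filterS => z ->.
have pf0 y : ~ U y -> partial k f y = 0 by move=> /fnU; exact: near0_derive.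
have C0 : forall y, U y -> h y != 0 -> 0 <= C.
  by move=> y Uy hy; have [h1 _] := uC y Uy hy; apply: le_trans h1.
have pC y : U y -> `|partial k u y * h y| <= `|C| * Bh.
  move=> Uy; have [->|hy] := eqVneq (h y) 0; first by rewrite mulr0 normr0 mulr_ge0.
  rewrite normrM; apply: ler_pM => //; have [_ h1] := uC y Uy hy.
  by apply: (le_trans h1); exact: ler_norm.
have fC y : `|partial k f y| <= `|C| * Bh + `|C|.
  have [Uy|Uy] := pselect (U y); last by rewrite pf0// normr0 addr_ge0// mulr_ge0.
  rewrite fE//; apply: (le_trans (ler_normD _ _)); apply: lerD; first exact: pC.
  by apply: (le_trans (uhC y Uy)); exact: ler_norm.
have int0 := Rintegral_partial_eq0 s0 df fC (fun y hy => fK y (hs y hy)).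
have cf : continuous f by move=> y; exact: differentiable_continuous.
have mpf : measurable_fun setT (partial k f : borel 'rV[R]_n -> R).
  by apply: measurable_derive => // y; exact: diff_derivable.
have i1 : (leb_rV n).-integrable (U : set (borel 'rV[R]_n)) (EFin \o (fun y => u y * partial k h y)).
  apply: (integrable_compact_support mU _ cK uhC).
  - by apply: measurable_funM => //; exact: measurable_funS mph.
  - by move=> y Uy Ky; rewrite (support_partial k cK h0 Ky) mulr0.
have i2 : (leb_rV n).-integrable (U : set (borel 'rV[R]_n)) (EFin \o (fun y => partial k u y * h y)).
  apply: (integrable_compact_support mU _ cK pC).
  - apply: (@eq_measurable_fun _ _ _ _ (U : set (borel 'rV[R]_n)) (fun y => partial k f y - u y * partial k h y)).
      by move=> y; rewrite inE => Uy; rewrite fE// addrK.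
    apply: measurable_funB; first exact: measurable_funS mpf.
    by apply: measurable_funM => //; exact: measurable_funS mph.
  - by move=> y Uy Ky; rewrite h0// mulr0.
apply/eqP; rewrite -addr_eq0 -RintegralD//; apply/eqP; rewrite -[RHS]int0 Rintegral_mkcond.
apply: eq_Rintegral => y _; rewrite patchE; case: ifPn => [|]; first by rewrite inE => Uy; rewrite fE// addrC.
by move=> /negP Uy; rewrite pf0// => Uy'; apply: Uy; rewrite inE.
Qed.

End test_functions.

(** * Charts *)

Section charts.
Context {R : realType} {n : nat} {M : ptopologicalType} (X : closed_manifold R n M).
Implicit Types (i j : chart X) (y : 'rV[R]_n) (x : M).

Lemma borel_continuous_on_map (T T' : ptopologicalType) (U : set T) (f : T -> T') :
  open U -> (forall t, U t -> {for t, continuous f}) ->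
  measurable_fun (U : set (borel T)) (f : borel T -> borel T').
Proof.
move=> oU cf; apply: (@measurability _ _ (borel T) (borel T') _ _ (@open T')) => // _ [V oV <-].
apply: borel_open; rewrite openE => x [Ux fx].
have h : \forall y \near x, V (f y) by apply: (cf x Ux); exact: open_nbhs_nbhs.
rewrite /interior; near=> y; split; near: y => //; exact: open_nbhs_nbhs.
Unshelve. all: by end_near. Qed.

Definition overlap i j : set 'rV[R]_n := img i `&` psi i @^-1` dom j.
Definition trans i j y : 'rV[R]_n := phi j (psi i y).

Lemma dom_psi i y : img i y -> dom i (psi i y). Proof. by move=> /psiK[]. Qed.
Lemma psi_phi i x : dom i x -> psi i (phi i x) = x. Proof. by move=> /phiK[]. Qed.
Lemma phi_psi i y : img i y -> phi i (psi i y) = y. Proof. by move=> /psiK[]. Qed.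
Lemma img_phi i x : dom i x -> img i (phi i x). Proof. by move=> /phiK[]. Qed.

Lemma near_psi i y (U : set M) : img i y -> nbhs (psi i y) U ->
  \forall z \near y, img i z /\ U (psi i z).
Proof.
move=> iy nU; have h1 := open_nbhs_nbhs (conj (@img_open _ _ _ X i) iy).
have h2 := psi_continuous iy nU; near=> z; split; near: z => //.
Unshelve. all: by end_near. Qed.

Lemma near_phi i x (V : set 'rV[R]_n) : dom i x -> nbhs (phi i x) V ->
  \forall z \near x, dom i z /\ V (phi i z).
Proof.
move=> ix nV; have h1 := open_nbhs_nbhs (conj (dom_open i) ix).
have h2 := phi_continuous ix nV; near=> z; split; near: z => //.
Unshelve. all: by end_near. Qed.

Lemma open_psi_preimage i (U : set M) : open U -> open (img i `&` psi i @^-1` U).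
Proof.
move=> oU; rewrite openE => y [iy Uy].
by have := near_psi iy (open_nbhs_nbhs (conj oU Uy)); apply: filterS => z [].
Qed.

Lemma open_phi_preimage i (V : set 'rV[R]_n) : open V -> open (dom i `&` phi i @^-1` V).
Proof.
move=> oV; rewrite openE => x [ix Vx].
by have := near_phi ix (open_nbhs_nbhs (conj oV Vx)); apply: filterS => z [].
Qed.

Lemma open_overlap i j : open (overlap i j).
Proof. by apply: open_psi_preimage; exact: dom_open. Qed.

Lemma measurable_psi i : measurable_fun (img i : set (borel 'rV[R]_n)) (psi i : borel 'rV[R]_n -> borel M).
Proof. by apply: borel_continuous_on_map; [exact: img_open|move=> y; exact: psi_continuous]. Qed.

Lemma measurable_phi i : measurable_fun (dom i : set (borel M)) (phi i : borel M -> borel 'rV[R]_n).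
Proof. by apply: borel_continuous_on_map; [exact: dom_open|move=> y; exact: phi_continuous]. Qed.

Lemma measurable_img i : measurable (img i : set (borel 'rV[R]_n)).
Proof. by apply: borel_open; exact: img_open. Qed.

Lemma measurable_dom i : measurable (dom i : set (borel M)).
Proof. by apply: borel_open; exact: dom_open. Qed.

Lemma measurable_psi_preimage i (A : set (borel M)) : measurable A ->
  measurable (img i `&` psi i @^-1` A : set (borel 'rV[R]_n)).
Proof. by move=> mA; apply: measurable_psi => //; exact: measurable_img. Qed.

Lemma measurable_phi_preimage i (E : set (borel 'rV[R]_n)) : measurable E ->
  measurable (dom i `&` phi i @^-1` E : set (borel M)).
Proof. by move=> mE; apply: measurable_phi => //; exact: measurable_dom. Qed.

Lemma trans_img i j y : overlap i j y -> img j (trans i j y).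
Proof. by move=> [iy jy]; exact: img_phi. Qed.

Lemma psi_trans i j y : overlap i j y -> psi j (trans i j y) = psi i y.
Proof. by move=> [iy jy]; exact: psi_phi. Qed.

Lemma trans_coord_differentiable i j y k : overlap i j y ->
  differentiable (fun z => trans i j z 0 k) y.
Proof. by move=> oy; exact: (smooth_on_differentiable (@transition_smooth _ _ _ X i j k) oy). Qed.

Lemma trans_differentiable i j y : overlap i j y -> differentiable (trans i j) y.
Proof. by move=> oy; apply: differentiable_rV => k; exact: trans_coord_differentiable. Qed.

Lemma trans_partial_continuous i j y k l : overlap i j y ->
  {for y, continuous (partial k (fun z => trans i j z 0 l))}.
Proof.
move=> oy; apply: differentiable_continuous.
exact: (smooth_on_partial k (@transition_smooth _ _ _ X i j l) oy).
Qed.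

Lemma closed_psi_image j (K : set 'rV[R]_n) : compact K -> K `<=` img j -> closed (psi j @` K).
Proof.
move=> cK Kj; apply: compact_closed; first exact: (manifold_hausdorff X).
apply: continuous_compact => //; apply: continuous_in_subspaceT => y; rewrite inE => /Kj iy.
exact: psi_continuous.
Qed.

Definition extend0 j (F : 'rV[R]_n -> R) x : R := if x \in dom j then F (phi j x) else 0.

(* The gradient in the chart [i] of a function with gradient [W] in the chart [j]. *)
Definition pullback i j (W : 'rV[R]_n -> 'rV[R]_n) y : 'rV[R]_n :=
  if y \in overlap i j then
    \row_k \sum_l partial k (fun z => trans i j z 0 l) y * W (trans i j y) 0 l
  else 0.

Lemma extend0_dom j F x : dom j x -> extend0 j F x = F (phi j x).
Proof. by move=> jx; rewrite /extend0 mem_set. Qed.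

Section compact_support.
Variables (j : chart X) (K : set 'rV[R]_n).
Hypotheses (cK : compact K) (Kj : K `<=` img j).

Lemma extend0_supp F x : (forall y, ~ K y -> F y = 0) -> ~ (psi j @` K) x -> extend0 j F x = 0.
Proof.
move=> F0 Kx; rewrite /extend0; case: ifPn => //; rewrite inE => jx.
by apply: F0 => Ky; apply: Kx; exists (phi j x) => //; exact: psi_phi.
Qed.

Lemma near_psi_out i y : img i y -> ~ (psi j @` K) (psi i y) ->
  \forall z \near y, img i z /\ ~ (psi j @` K) (psi i z).
Proof.
move=> iy Ky; have oC : open (~` (psi j @` K)) by apply: closed_openC; exact: closed_psi_image.
exact: (near_psi iy (open_nbhs_nbhs (conj oC Ky))).
Qed.

Lemma overlap_psi_image i y : img i y -> (psi j @` K) (psi i y) -> overlap i j y /\ K (trans i j y).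
Proof.
move=> iy [z Kz e]; have jz := Kj Kz; split; first by split => //=; rewrite -e; exact: dom_psi.
by rewrite /trans -e phi_psi.
Qed.

Lemma near_extend0 i y F : overlap i j y ->
  \forall z \near y, F (trans i j z) = extend0 j F (psi i z).
Proof.
move=> oy; have := open_nbhs_nbhs (conj (@open_overlap i j) oy).
by apply: filterS => z [iz jz]; rewrite extend0_dom.
Qed.

Lemma near_extend0_eq0 i y F : (forall y, ~ K y -> F y = 0) -> img i y -> ~ dom j (psi i y) ->
  \forall z \near y, extend0 j F (psi i z) = 0.
Proof.
move=> F0 iy jy; have Ky : ~ (psi j @` K) (psi i y).
  by move=> /(overlap_psi_image iy)[[]].
by have := near_psi_out iy Ky; apply: filterS => z [_]; exact: extend0_supp.
Qed.

Lemma extend0_differentiable i y F : (forall y, differentiable F y) ->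
  (forall y, ~ K y -> F y = 0) -> img i y -> differentiable (extend0 j F \o psi i) y.
Proof.
move=> dF F0 iy; have [jy|jy] := pselect (dom j (psi i y)).
  have oy : overlap i j y by [].
  apply: (near_eq_differentiable (near_extend0 F oy)); apply: differentiable_comp => //.
  exact: trans_differentiable.
apply: (@near_eq_differentiable _ _ _ (cst 0)); last exact: differentiable_cst.
by have := near_extend0_eq0 F0 iy jy; apply: filterS => z /= ->.
Qed.

Lemma extend0_partial i y F k : (forall y, differentiable F y) ->
  (forall y, ~ K y -> F y = 0) -> img i y ->
  partial k (extend0 j F \o psi i) y = pullback i j (fun z => \row_l partial l F z) y 0 k.
Proof.
move=> dF F0 iy; rewrite /pullback; have [jy|jy] := pselect (dom j (psi i y)).
  have oy : overlap i j y by [].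
  rewrite mem_set// mxE /partial -(near_eq_derive _ (near_extend0 F oy)).
  rewrite (derive_chain _ (trans_differentiable oy) (dF _)).
  by apply: eq_bigr => l _; rewrite mxE.
rewrite memNset ?mxE; first by apply: near0_derive; exact: near_extend0_eq0.
by move=> [].
Qed.

(** Sum of the absolute entries of the Jacobian of the transition map, cut off to the points carried
    into [K]. Near the boundary of the overlap these entries may be unbounded; with the cutoff they
    are bounded on compact subsets of [img i]. *)
Definition trans_bound i y : R :=
  if y \in overlap i j `&` [set z | K (trans i j z)] then
    \sum_k \sum_l `|partial k (fun z => trans i j z 0 l) y| else 0.

Lemma trans_bound_ge0 i y : 0 <= trans_bound i y.
Proof. by rewrite /trans_bound; case: ifP => // _; rewrite sumr_ge0// => k _; rewrite sumr_ge0. Qed.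

Lemma pullback_le i (W : 'rV[R]_n -> 'rV[R]_n) (L : R) y k : (forall y, ~ K y -> W y = 0) -> 0 <= L ->
  (forall y l, `|W y 0 l| <= L) -> `|pullback i j W y 0 k| <= L * trans_bound i y.
Proof.
move=> W0 L0 WL; rewrite /pullback.
case: ifPn => [oy|_]; last by rewrite mxE normr0 mulr_ge0// trans_bound_ge0.
rewrite mxE /trans_bound; case: ifPn => [_|/negP nK]; last first.
  rewrite big1 ?normr0 ?mulr0// => l _; rewrite W0 ?mxE ?mulr0// => Ky; apply: nK.
  by rewrite inE in oy; rewrite inE.
apply: (@le_trans _ _ (L * \sum_l `|partial k (fun z => trans i j z 0 l) y|)).
  apply: (le_trans (ler_norm_sum _ _ _)); rewrite mulr_sumr; apply: ler_sum => l _.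
  by rewrite normrM mulrC; apply: ler_wpM2r.
apply: ler_wpM2l => //; rewrite [leRHS](bigD1 k)//= lerDl.
by rewrite sumr_ge0// => a _; rewrite sumr_ge0.
Qed.

(** Local boundedness suffices. At a point whose image on the manifold comes from [K], the overlap
    is a neighbourhood and the partial derivatives are continuous; at any other point the bound
    vanishes nearby, since the image of [K] is closed. *)
Lemma trans_bound_compact i (K' : set 'rV[R]_n) : compact K' -> K' `<=` img i ->
  exists2 C : R, 0 <= C & forall y, K' y -> trans_bound i y <= C.
Proof.
move=> cK' Ki; have [y K'y|C hC] := @locally_bounded_compact R _ _ (trans_bound i) cK'.
  have iy := Ki _ K'y; have [Ky|Ky] := pselect ((psi j @` K) (psi i y)); last first.
    exists 0; have := near_psi_out iy Ky; apply: filterS => z [iz Kz].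
    rewrite /trans_bound memNset ?normr0// => -[oz Kt]; apply: Kz; exists (trans i j z) => //.
    exact: psi_trans.
  have [oy _] := overlap_psi_image iy Ky.
  exists (\sum_(k < n) \sum_(l < n) (`|partial k (fun z => trans i j z 0 l) y| + 1)).
  have h k l : \forall z \near y, `|partial k (fun z => trans i j z 0 l) z| <=
      `|partial k (fun z => trans i j z 0 l) y| + 1.
    have /cvgrPdist_le/(_ 1 ltr01) := @trans_partial_continuous i j y k l oy; apply: filterS => z hz.
    by rewrite -lerBlDl; apply: le_trans hz; rewrite distrC; exact: lerB_dist.
  have h2 : \forall z \near y, forall k l, `|partial k (fun z => trans i j z 0 l) z| <=
      `|partial k (fun z => trans i j z 0 l) y| + 1.
    apply: (@filter_forall _ 'I_n (fun k => [set z | forall l, `|partial k (fun z => trans i j z 0 l) z| <=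
      `|partial k (fun z => trans i j z 0 l) y| + 1]) (nbhs y)) => k.
    apply: (@filter_forall _ 'I_n (fun l => [set z | `|partial k (fun z => trans i j z 0 l) z| <=
      `|partial k (fun z => trans i j z 0 l) y| + 1]) (nbhs y)) => l.
    exact: h.
  move: h2; apply: filterS => z h2; rewrite ger0_norm ?trans_bound_ge0// /trans_bound.
  case: ifP => _; first by apply: ler_sum => k _; apply: ler_sum => l _; exact: h2.
  by rewrite sumr_ge0// => k _; rewrite sumr_ge0// => l _; rewrite addr_ge0.
exists (Num.max C 0) => [|y Ky]; first by rewrite le_max lexx orbT.
by rewrite le_max; apply/orP; left; apply: le_trans (hC y Ky); exact: ler_norm.
Qed.

Lemma measurable_pullback i (W : 'rV[R]_n -> 'rV[R]_n) k : (forall l, measurable_fun setT (fun y : borel 'rV[R]_n => W y 0 l)) ->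
  measurable_fun (img i : set (borel 'rV[R]_n)) (fun y : borel 'rV[R]_n => pullback i j W y 0 k).
Proof.
move=> mW; have mo : measurable (overlap i j : set (borel 'rV[R]_n)) by apply: borel_open; exact: open_overlap.
pose f (y : borel 'rV[R]_n) := \sum_l partial k (fun z => trans i j z 0 l) y * W (trans i j y) 0 l.
have mf : measurable_fun (overlap i j : set (borel 'rV[R]_n)) f.
  apply: measurable_sum => l; apply: measurable_funM.
    apply: borel_continuous_on; first exact: open_overlap.
    by move=> y; exact: trans_partial_continuous.
  have mt : measurable_fun (overlap i j : set (borel 'rV[R]_n)) (trans i j : borel 'rV[R]_n -> borel 'rV[R]_n).
    apply: borel_continuous_on_map; first exact: open_overlap.
    by move=> y oy; apply: differentiable_continuous; exact: trans_differentiable.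
  exact: (measurableT_comp (mW l) mt).
have -> : (fun y : borel 'rV[R]_n => pullback i j W y 0 k) = f \_ (overlap i j).
  by apply/funext => y; rewrite patchE /pullback; case: ifP => _; rewrite mxE.
apply: measurable_funTS; by apply/(measurable_restrictT _ mo).
Qed.

End compact_support.
End charts.

(** * The metric tensor *)

Section matrix_continuity.
Context {R : realType} {T : topologicalType}.

Lemma continuous_at_sum (x : T) (I : Type) (r : seq I) (f : I -> T -> R) :
  (forall i, {for x, continuous (f i)}) -> {for x, continuous (fun y => \sum_(i <- r) f i y)}.
Proof.
move=> cf; elim: r => [|i r IH].
  have -> : (fun y => \sum_(i <- [::]) f i y) = cst 0 by apply/funext => y; rewrite big_nil.
  exact: cvg_cst.
have -> : (fun y => \sum_(i <- i :: r) f i y) = (fun y => f i y + \sum_(i <- r) f i y).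
  by apply/funext => y; rewrite big_cons.
by apply: (@continuousD _ _ _ (f i)) => //; exact: cf.
Qed.

Lemma continuous_at_prod (x : T) (I : Type) (r : seq I) (f : I -> T -> R) :
  (forall i, {for x, continuous (f i)}) -> {for x, continuous (fun y => \prod_(i <- r) f i y)}.
Proof.
move=> cf; elim: r => [|i r IH].
  have -> : (fun y => \prod_(i <- [::]) f i y) = cst 1 by apply/funext => y; rewrite big_nil.
  exact: cvg_cst.
have -> : (fun y => \prod_(i <- i :: r) f i y) = (fun y => f i y * \prod_(i <- r) f i y).
  by apply/funext => y; rewrite big_cons.
by apply: (@continuousM _ _ (f i)) => //; exact: cf.
Qed.

Lemma continuous_at_det n (A : T -> 'M[R]_n) x :
  (forall k l, {for x, continuous (fun y => A y k l)}) -> {for x, continuous (fun y => \det (A y))}.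
Proof.
move=> cA; rewrite /determinant; apply: continuous_at_sum => s.
apply: (@continuousM _ _ (cst _)); first exact: cvg_cst.
by apply: continuous_at_prod.
Qed.

Lemma continuous_at_cofactor n (A : T -> 'M[R]_n) x i j :
  (forall k l, {for x, continuous (fun y => A y k l)}) -> {for x, continuous (fun y => cofactor (A y) i j)}.
Proof.
move=> cA; rewrite /cofactor; apply: (@continuousM _ _ (cst _)); first exact: cvg_cst.
apply: continuous_at_det => k l.
have -> : (fun y => row' i (col' j (A y)) k l) = (fun y => A y (lift i k) (lift j l)).
  by apply/funext => y; rewrite !mxE.
exact: cA.
Qed.

(** The adjugate divided by the determinant. The formula holds only for invertible matrices, as
    [invmx] takes a default value elsewhere; hence the condition on a neighbourhood. *)
Lemma continuous_at_invmx n (A : T -> 'M[R]_n) x k l :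
  (forall k l, {for x, continuous (fun y => A y k l)}) ->
  (\forall y \near x, \det (A y) != 0) -> \det (A x) != 0 ->
  {for x, continuous (fun y => invmx (A y) k l)}.
Proof.
move=> cA nA Ax.
have E y : \det (A y) != 0 -> invmx (A y) k l = (\det (A y))^-1 * cofactor (A y) l k.
  by move=> dA; rewrite /invmx unitmxE unitfE dA !mxE.
have h : {for x, continuous (fun y => (\det (A y))^-1 * cofactor (A y) l k)}.
  apply: (@continuousM _ _ (fun y => (\det (A y))^-1)); last exact: continuous_at_cofactor.
  by apply: continuousV => //; exact: continuous_at_det.
suff : (fun y => invmx (A y) k l) @ x --> invmx (A x) k l by [].
rewrite E//; apply: cvg_trans h; apply: near_eq_cvg.
by move: nA; apply: filterS => y /E ->.
Qed.

End matrix_continuity.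

(** * Positive definite matrices *)

Section positive_definite.
Context {R : realType} {n : nat}.
Implicit Types (A : 'M[R]_n) (v : 'rV[R]_n).

Definition posdef A := forall v, v != 0 -> 0 < (v *m A *m v^T) 0 0.

Lemma posdef_det_neq0 A : posdef A -> \det A != 0.
Proof.
move=> pA; apply/negP => /det0P[v v0 vA].
by have := pA v v0; rewrite vA mul0mx mxE ltxx.
Qed.

Lemma sqnorm_gt0 v : v != 0 -> 0 < (v *m v^T) 0 0.
Proof.
move=> v0; rewrite mxE; have [k vk] : exists k, v 0 k != 0.
  apply/existsP; apply: contraNT v0; rewrite negb_exists => /forallP h.
  by apply/eqP/rowP => k; rewrite mxE; apply/eqP; have := h k; rewrite negbK.
rewrite (bigD1 k)//= ltr_pwDl//.
  by rewrite mxE -expr2 exprn_even_gt0.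
by apply: sumr_ge0 => l _; rewrite mxE -expr2 sqr_ge0.
Qed.

(* The segment from the identity to [A] consists of invertible matrices. *)
Lemma posdef_det_gt0 A : posdef A -> 0 < \det A.
Proof.
move=> pA; pose B (t : R) : 'M[R]_n := t *: A + (1 - t) *: 1%:M.
have BE t k l : B t k l = t * A k l + (1 - t) * (1%:M : 'M[R]_n) k l by rewrite /B !mxE.
have cB : continuous (fun t => \det (B t)).
  move=> t; apply: continuous_at_det => k l.
  have -> : (fun t => B t k l) = (fun t => t * A k l + (1 - t) * (1%:M : 'M[R]_n) k l) by apply/funext => a; exact: BE.
  apply: (@lipschitz_continuous R R^o R^o _ `|A k l - (1%:M : 'M[R]_n) k l|) => a b.
  rewrite -[leRHS]normrM (_ : _ - _ = (A k l - (1%:M : 'M[R]_n) k l) * (a - b))//; ring.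
have pB t : 0 <= t <= 1 -> posdef (B t).
  move=> /andP[t0 t1] v v0; rewrite /B mulmxDr mulmxDl mxE -!scalemxAr -!scalemxAl mulmx1 !mxE.
  have a1 := pA v v0; have a2 := sqnorm_gt0 v0.
  rewrite !mxE in a1 a2.
  have [->|tn0] := eqVneq t 0; first by rewrite mul0r add0r subr0 mul1r.
  apply: ltr_pwDl; first by rewrite mulr_gt0// lt_def tn0.
  by rewrite mulr_ge0 ?subr_ge0// ltW.
have B1 : B 1 = A by rewrite /B scale1r subrr scale0r addr0.
have B0 : \det (B 0) = 1 by rewrite /B scale0r add0r subr0 scale1r det1.
rewrite -B1 ltNge; apply/negP => d1.
have [|c c01 /eqP] := @IVT R (fun t => \det (B t)) 0 1 0 ler01 (continuous_subspaceT cB).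
  by rewrite B0 ge_min le_max ler01 d1 orbT.
by apply/negP; apply: posdef_det_neq0; apply: pB; rewrite in_itv in c01.
Qed.

Lemma posdef_unitmx A : posdef A -> A \in unitmx.
Proof. by move=> pA; rewrite unitmxE unitfE posdef_det_neq0. Qed.

Lemma posdef_inv_ge0 A v : A^T = A -> posdef A -> 0 <= (v *m invmx A *m v^T) 0 0.
Proof.
move=> sA pA; pose u := v *m invmx A.
have vE : v = u *m A by rewrite /u mulmxKV// posdef_unitmx.
rewrite -/u vE trmx_mul sA mulmxA; have [->|u0] := eqVneq u 0; first by rewrite !mul0mx mxE.
by rewrite ltW// pA.
Qed.

Lemma quadratic_form_le A v (u : 'rV[R]_n) (c d : R) : 0 <= c -> 0 <= d ->
  (forall k, `|v 0 k| <= c) -> (forall k, `|u 0 k| <= d) ->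
  `|(v *m A *m u^T) 0 0| <= c * d * \sum_k \sum_l `|A k l|.
Proof.
move=> c0 d0 vc ud; rewrite mxE exchange_big/= mulr_sumr.
apply: (le_trans (ler_norm_sum _ _ _)); apply: ler_sum => l _.
rewrite !mxE mulr_suml mulr_sumr; apply: (le_trans (ler_norm_sum _ _ _)); apply: ler_sum => k _.
rewrite !normrM mulrAC; apply: ler_wpM2r => //; exact: ler_pM.
Qed.

End positive_definite.

(** * The metric in charts and the inner product of gradients *)

Section metric.
Context {R : realType} {n : nat} {M : ptopologicalType} {X : closed_manifold R n M}.
Variable g : riemannian_metric X.
Implicit Types (i j : chart X) (y : 'rV[R]_n) (x : M).

Lemma gram_posdefW i y : img i y -> posdef (gram g i y).
Proof. by move=> iy v; exact: gram_posdef. Qed.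

Lemma gram_continuous i y k l : img i y -> {for y, continuous (fun y => gram g i y k l)}.
Proof.
move=> iy; apply: differentiable_continuous.
exact: (smooth_on_differentiable (@gram_smooth _ _ _ _ g i k l) iy).
Qed.

Lemma gram_inv_continuous i y k l : img i y ->
  {for y, continuous (fun y => invmx (gram g i y) k l)}.
Proof.
move=> iy; apply: continuous_at_invmx.
- by move=> a b; exact: gram_continuous.
- have := open_nbhs_nbhs (conj (@img_open _ _ _ X i) iy); apply: filterS => z iz.
  by apply: posdef_det_neq0; exact: gram_posdefW.
- by apply: posdef_det_neq0; exact: gram_posdefW.
Qed.

Lemma gram_det_continuous i y : img i y -> {for y, continuous (fun y => \det (gram g i y))}.
Proof. by move=> iy; apply: continuous_at_det => k l; exact: gram_continuous. Qed.

Lemma gram_det_gt0 i y : img i y -> 0 < \det (gram g i y).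
Proof. by move=> iy; apply: posdef_det_gt0; exact: gram_posdefW. Qed.

Lemma jacobian_trans i j y k l : overlap i j y ->
  ('J (phi j \o psi i) y) k l = partial k (fun z => trans i j z 0 l) y.
Proof.
move=> oy; have d := trans_differentiable oy.
rewrite /jacobian /lin1_mx mxE /partial.
by rewrite -(derive_coord _ _ d) -[phi j \o psi i]/(trans i j) deriveE.
Qed.

Lemma pullbackE i j W y : overlap i j y ->
  pullback i j W y = W (trans i j y) *m ('J (phi j \o psi i) y)^T.
Proof.
move=> oy; rewrite /pullback mem_set//; apply/rowP => k; rewrite !mxE.
by apply: eq_bigr => l _; rewrite mxE jacobian_trans// mulrC.
Qed.

(** Inverting G_i = J G_j J^T gives J^T G_i^-1 J = G_j^-1. Hence the inner product of gradients does
    not depend on the chart in which it is computed. *)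
Lemma gram_inv_change i j y (v u : 'rV[R]_n) : overlap i j y ->
  let J := 'J (phi j \o psi i) y in
  v *m J^T *m invmx (gram g i y) *m (u *m J^T)^T = v *m invmx (gram g j (trans i j y)) *m u^T.
Proof.
move=> oy J; have [iy jy] := oy.
have GE : gram g i y = J *m gram g j (trans i j y) *m J^T by exact: gram_change.
have Gi := posdef_unitmx (gram_posdefW iy).
have Gj := posdef_unitmx (gram_posdefW (trans_img oy)).
have uJ : J \in unitmx.
  by move: Gi; rewrite GE !unitmx_mul => /andP[/andP[]].
have uJT : J^T \in unitmx by rewrite unitmx_tr.
set Gj' := gram g j _ in GE Gj *; set Gi' := gram g i y in GE Gi *.
have key : J^T *m invmx Gi' *m J = invmx Gj'.
  have h : J^T *m invmx Gi' *m J *m Gj' = 1%:M.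
    apply: (can_inj (mulmxK uJT)); rewrite mul1mx -!mulmxA [J *m (Gj' *m _)]mulmxA -GE.
    by rewrite mulVmx// mulmx1.
  by rewrite -[LHS](mulmxK Gj) h mul1mx.
by rewrite trmx_mul trmxK -key !mulmxA.
Qed.

Lemma pick_dom x : exists i, [pick i : chart X | x \in dom i] = Some i /\ dom i x.
Proof.
case: pickP => [i ix|h]; first by exists i; split => //; rewrite inE in ix.
by have [i ix] := chart_cover X x; have := h i; rewrite mem_set.
Qed.

Lemma grad_inner_pullback j W x : dom j x ->
  let w i := pullback i j W in
  grad_inner g w w x =
    (W (phi j x) *m invmx (gram g j (phi j x)) *m (W (phi j x))^T) 0 0.
Proof.
move=> jx w; rewrite /grad_inner; have [i [-> ix]] := pick_dom x.
have oy : overlap i j (phi i x) by split; [exact: img_phi|rewrite /= psi_phi].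
have tE : trans i j (phi i x) = phi j x by rewrite /trans psi_phi.
by rewrite /w pullbackE// gram_inv_change// tE.
Qed.

Lemma grad_inner_pullback0 j W x : ~ dom j x ->
  let w i := pullback i j W in grad_inner g w w x = 0.
Proof.
move=> jx w; rewrite /grad_inner; have [i [-> ix]] := pick_dom x.
by rewrite /w /pullback memNset ?mul0mx ?mxE// => -[_ /=]; rewrite psi_phi.
Qed.

Lemma grad_inner_ge0 (w : chart X -> 'rV[R]_n -> 'rV[R]_n) x : 0 <= grad_inner g w w x.
Proof.
rewrite /grad_inner; have [i [-> ix]] := pick_dom x.
apply: posdef_inv_ge0; first by apply: gram_sym; exact: img_phi.
by apply: gram_posdefW; exact: img_phi.
Qed.

(** [grad_inner] uses the first chart around the point, so the manifold is cut into finitely many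
    Borel pieces according to the set of charts that contain the point; on each piece the selected
    chart is constant. *)
Lemma measurable_grad_inner (w w' : chart X -> 'rV[R]_n -> 'rV[R]_n) :
  (forall i k, measurable_fun (img i : set (borel 'rV[R]_n)) (fun y : borel 'rV[R]_n => w i y 0 k)) ->
  (forall i k, measurable_fun (img i : set (borel 'rV[R]_n)) (fun y : borel 'rV[R]_n => w' i y 0 k)) ->
  measurable_fun setT (grad_inner g w w' : borel M -> R).
Proof.
move=> mw mw'.
pose q i (y : borel 'rV[R]_n) := (w i y *m invmx (gram g i y) *m (w' i y)^T) 0 0.
have mq i : measurable_fun (img i : set (borel 'rV[R]_n)) (q i).
  have -> : q i = (fun y => \sum_l (\sum_k w i y 0 k * invmx (gram g i y) k l) * w' i y 0 l).
    by apply/funext => y; rewrite /q mxE; apply: eq_bigr => l _; rewrite !mxE.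
  apply: measurable_sum => l; apply: measurable_funM => //.
  apply: measurable_sum => k; apply: measurable_funM => //.
  apply: borel_continuous_on; first exact: img_open.
  by move=> y; exact: gram_inv_continuous.
have mqphi i : measurable_fun (dom i : set (borel M)) (q i \o phi i).
  apply: (measurable_comp (measurable_img i) _ (mq i) (@measurable_phi _ _ _ X i)).
  by move=> _ [x ix <-]; exact: img_phi.
pose A (S : {set chart X}) : set (borel M) := [set x | forall i, (x \in dom i) = (i \in S)].
have mA S : measurable (A S).
  have -> : A S = \bigcap_(i in [set: chart X]) (if i \in S then dom i else ~` (dom i)).
    apply/seteqP; split => x h i.
      move=> _; have := h i; case: (i \in S) => e; first exact: set_mem e.
      by move=> ix; rewrite (mem_set ix) in e.
    have := h i I; case: (i \in S) => ix; first by rewrite mem_set.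
    by rewrite memNset.
  apply: fin_bigcap_measurable => [|i _]; first exact: finite_finset.
  case: ifP => _; first exact: measurable_dom.
  by apply: measurableC; exact: measurable_dom.
pose f (S : {set chart X}) (x : borel M) := if [pick i in S] is Some i then q i (phi i x) else 0.
have mf S : measurable_fun (A S) (f S).
  rewrite /f; case: pickP => [i iS|_]; last exact: measurable_cst.
  by apply: measurable_funS (mqphi i); [exact: measurable_dom|move=> x /(_ i); rewrite iS => /set_mem].
have -> : (grad_inner g w w' : borel M -> R) = (fun x => \sum_(S : {set chart X}) (f S \_ (A S)) x).
  apply/funext => x; pose S0 := [set i : chart X | x \in dom i]%SET.
  have AS0 : A S0 x by move=> i; rewrite /S0 finset.inE.
  rewrite (bigD1 S0)//= patchE mem_set// big1 ?addr0; last first.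
    move=> S SS0; rewrite patchE memNset// => AS; move/eqP: SS0; apply; apply/setP => i.
    by rewrite -AS finset.inE.
  rewrite /grad_inner /f; have -> : [pick i in S0] = [pick i | x \in dom i].
    by apply: eq_pick => i; rewrite finset.inE.
  by case: pickP.
apply: measurable_sum => S; apply/(measurable_restrictT _ (mA S)); exact: mf.
Qed.

End metric.

(** * The Riemannian measure *)

Section volume.
Context {R : realType} {n : nat} {M : ptopologicalType} {X : closed_manifold R n M}.
Variables (g : riemannian_metric X) (vol : {measure set (borel M) -> \bar R}).
Hypothesis hv : riemannian_volume g vol.
Implicit Types (i j : chart X) (y : 'rV[R]_n) (x : M).

Let dens i y := Num.sqrt (\det (gram g i y)).

Lemma density_continuous i y : img i y -> {for y, continuous (dens i)}.
Proof.
move=> iy; apply: (@continuous_comp _ _ _ (fun y => \det (gram g i y)) (@Num.sqrt R)).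
  exact: gram_det_continuous.
exact: sqrt_continuous.
Qed.

Lemma density_gt0 i y : img i y -> 0 < dens i y.
Proof. by move=> iy; rewrite sqrtr_gt0 gram_det_gt0. Qed.

Lemma measurable_density i : measurable_fun (img i : set (borel 'rV[R]_n)) (dens i : borel 'rV[R]_n -> R).
Proof. by apply: borel_continuous_on; [exact: img_open|move=> y; exact: density_continuous]. Qed.

Lemma volE j (E : set (borel 'rV[R]_n)) : measurable E -> E `<=` img j ->
  vol (dom j `&` phi j @^-1` E) = (\int[leb_rV n]_(y in E) (dens j y)%:E)%E.
Proof.
move=> mE Ej; rewrite (hv (i := j) (measurable_phi_preimage j mE)); last by move=> x [].
congr integral; apply/seteqP; split => y /=.
  by move=> [iy [_]]; rewrite phi_psi.
by move=> Ey; have iy := Ej _ Ey; split => //; split; [exact: dom_psi|rewrite phi_psi].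
Qed.

Lemma continuous_le_compact (K : set 'rV[R]_n) (f : 'rV[R]_n -> R) : compact K ->
  (forall y, K y -> {for y, continuous f}) -> exists2 C : R, 0 < C & forall y, K y -> f y <= C.
Proof.
move=> cK cf; have [C hC] := continuous_bounded_compact cK cf.
exists (Num.max C 1) => [|y Ky]; first by rewrite lt_max ltr01 orbT.
by rewrite le_max; apply/orP; left; apply: le_trans (hC y Ky); exact: ler_norm.
Qed.

Lemma vol_le j (K : set 'rV[R]_n) : compact K -> K `<=` img j ->
  exists2 C : R, 0 < C & forall E : set (borel 'rV[R]_n), measurable E -> E `<=` K ->
    (vol (dom j `&` phi j @^-1` E) <= C%:E * leb_rV n E)%E.
Proof.
move=> cK Kj; have [|C C0 hC] := @continuous_le_compact K (dens j) cK.
  by move=> y /Kj; exact: density_continuous.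
exists C => // E mE EK; rewrite volE//; last exact: subset_trans Kj.
rewrite -(integral_cst (leb_rV n) mE C%:E); apply: ge0_le_integral => //.
- by move=> y Ey; rewrite lee_fin ltW// density_gt0//; apply: Kj; exact: EK.
- apply/measurable_EFinP; apply: measurable_funS (@measurable_density j); first exact: measurable_img.
  exact: subset_trans Kj.
- by move=> y Ey; rewrite lee_fin hC//; exact: EK.
Qed.

Lemma vol_ge j (K : set 'rV[R]_n) : compact K -> K `<=` img j ->
  exists2 C : R, 0 < C & forall E : set (borel 'rV[R]_n), measurable E -> E `<=` K ->
    (C%:E * leb_rV n E <= vol (dom j `&` phi j @^-1` E))%E.
Proof.
move=> cK Kj; have [|C C0 hC] := @continuous_le_compact K (fun y => (dens j y)^-1) cK.
  move=> y /Kj iy; apply: continuousV; first by rewrite gt_eqF// density_gt0.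
  exact: density_continuous.
exists C^-1; first by rewrite invr_gt0.
move=> E mE EK; rewrite volE//; last exact: subset_trans Kj.
rewrite -(integral_cst (leb_rV n) mE (C^-1)%:E); apply: ge0_le_integral => //.
- by move=> y _; rewrite lee_fin invr_ge0 ltW.
- apply/measurable_EFinP; apply: measurable_funS (@measurable_density j); first exact: measurable_img.
  exact: subset_trans Kj.
- move=> y Ey; rewrite lee_fin -[leRHS]invrK lef_pV2 ?posrE ?invr_gt0//; first by apply: hC; exact: EK.
  by apply: density_gt0; apply: Kj; exact: EK.
Qed.

(** The constant is the same for all centres [p'] and radii within the fixed ball, as the centres of
    bubbles and cutoffs vary with the sequence. *)
Lemma vol_ball_le j p r : [set y | `|p - y| <= r] `<=` img j ->
  exists2 C : R, 0 < C & forall p' s, 0 < s -> `|p - p'| + s <= r ->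
    (vol (dom j `&` phi j @^-1` (ball p' s)) <= (C * s ^+ n)%:E)%E.
Proof.
move=> Kj; have [C C0 hC] := vol_le (@rV_closed_ball_compact R n p r) Kj.
exists (C * 2 ^+ n) => [|p' s s0 ps]; first by rewrite mulr_gt0// exprn_gt0.
have mb : measurable (ball p' s : set (borel 'rV[R]_n)) by apply: borel_open; exact: ball_open.
have sb : ball p' s `<=` [set y | `|p - y| <= r].
  move=> y; rewrite rV_ballE /= => h; apply: le_trans ps.
  by apply: (le_trans (ler_distD p' p y)); rewrite lerD2l ltW.
have e : (C%:E * leb_rV n (ball p' s : set (borel 'rV[R]_n)))%E = (C * 2 ^+ n * s ^+ n)%:E.
  by rewrite (leb_rV_ball p' s0) -EFinM; congr EFin; rewrite -mulrA -exprMn mulr_natl.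
by rewrite -e; exact: hC.
Qed.

Lemma vol_ball_ge j p r : [set y | `|p - y| <= r] `<=` img j ->
  exists2 C : R, 0 < C & forall p' s, 0 < s -> `|p - p'| + s <= r ->
    ((C * s ^+ n)%:E <= vol (dom j `&` phi j @^-1` (ball p' s)))%E.
Proof.
move=> Kj; have [C C0 hC] := vol_ge (@rV_closed_ball_compact R n p r) Kj.
exists (C * 2 ^+ n) => [|p' s s0 ps]; first by rewrite mulr_gt0// exprn_gt0.
have mb : measurable (ball p' s : set (borel 'rV[R]_n)) by apply: borel_open; exact: ball_open.
have sb : ball p' s `<=` [set y | `|p - y| <= r].
  move=> y; rewrite rV_ballE /= => h; apply: le_trans ps.
  by apply: (le_trans (ler_distD p' p y)); rewrite lerD2l ltW.
have e : (C%:E * leb_rV n (ball p' s : set (borel 'rV[R]_n)))%E = (C * 2 ^+ n * s ^+ n)%:E.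
  by rewrite (leb_rV_ball p' s0) -EFinM; congr EFin; rewrite -mulrA -exprMn mulr_natl.
by rewrite -e; exact: hC.
Qed.

Lemma closed_ball_chart x : exists j r, [/\ 0 < r, dom j x & [set y | `|phi j x - y| <= r] `<=` img j].
Proof.
have [j jx] := chart_cover X x.
have := open_nbhs_nbhs (conj (@img_open _ _ _ X j) (img_phi jx)).
move=> /nbhs_ballP[e /= e0 he]; exists j, (e / 2); split => //; first by rewrite divr_gt0.
move=> y /= h; apply: he; rewrite rV_ballE; apply: (le_lt_trans h).
by rewrite ltr_pdivrMr// ltr_pMr// ltr1n.
Qed.

Lemma finite_ball_cover : exists (D : seq M) (c : M -> chart X) (r : M -> R),
  (forall x, 0 < r x /\ dom (c x) x) /\
  (forall x, [set y | `|phi (c x) x - y| <= r x] `<=` img (c x)) /\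
  (forall z, exists2 x, x \in D & dom (c x) z /\ ball (phi (c x) x) (r x) (phi (c x) z)).
Proof.
have [c hc] := choice closed_ball_chart; have [r hr] := choice hc.
have := manifold_compact X; rewrite compact_cover.
move=> /(_ _ setT (fun x => dom (c x) `&` phi (c x) @^-1` ball (phi (c x) x) (r x))) [].
- by move=> x _; apply: open_phi_preimage; exact: ball_open.
- move=> x _; exists x => //; have [r0 jx _] := hr x; split => //; exact: ballxx.
move=> D _ hD; exists (finmap.enum_fset D), c, r; do ![split].
- by have [] := hr x.
- by have [] := hr x.
- by move=> x; have [] := hr x.
- by move=> z; have [x xD [h1 h2]] := hD z I; exists x.
Qed.

Lemma vol_lty : (vol setT < +oo)%E.
Proof.
have [D [c [r [hr [hc hD]]]]] := finite_ball_cover.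
pose U x : set (borel M) := dom (c x) `&` phi (c x) @^-1` ball (phi (c x) x) (r x).
have mU x : measurable (U x) by apply: borel_open; apply: open_phi_preimage; exact: ball_open.
have Ufin x : (vol (U x) < +oo)%E.
  have [C C0 hC] := vol_ball_le (hc x); have [r0 _] := hr x.
  by apply: le_lt_trans (hC (phi (c x) x) (r x) r0 _) (ltry _); rewrite subrr normr0 add0r.
have mB (s : seq M) : measurable (\big[setU/set0]_(x <- s) U x) by exact: bigsetU_measurable.
have fB (s : seq M) : (vol (\big[setU/set0]_(x <- s) U x) < +oo)%E.
  elim: s => [|x s IH]; first by rewrite big_nil measure0 ltry.
  rewrite big_cons; have h := @measureU2 _ _ _ vol _ _ (mU x) (mB s).
  by apply: (le_lt_trans h); exact: (lte_add_pinfty (Ufin x) IH).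
apply: le_lt_trans (fB D); apply: le_measure; [exact: mem_set|exact: mem_set|].
by move=> z _; have [x xD hz] := hD z; rewrite -bigcup_seq; exists x.
Qed.

(** The volume mediates between the charts: a null set of chart [j] has zero volume, and since the
    density in chart [i] is positive, zero volume forces measure zero there. *)
Lemma null_transfer i j (E : set (borel 'rV[R]_n)) : measurable E -> leb_rV n E = 0%E ->
  leb_rV n (overlap i j `&` trans i j @^-1` E : set (borel 'rV[R]_n)) = 0%E.
Proof.
move=> mE E0; pose A : set (borel M) := dom i `&` (dom j `&` phi j @^-1` E).
have mA : measurable A by apply: measurableI; [exact: measurable_dom|exact: measurable_phi_preimage].
have vA0 : vol A = 0%E.
  rewrite (hv (i := j) mA); last by move=> x [_ []].
  have mB := measurable_psi_preimage j mA.
  apply: null_set_integral => //.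
    apply/measurable_EFinP; apply: measurable_funS (@measurable_density j); first exact: measurable_img.
    by move=> y [].
  apply: (subset_measure0 (mu := leb_rV n) mB mE) => //.
  by move=> y [jy [_ [_ /=]]]; rewrite phi_psi.
have := vA0; rewrite (hv (i := i) mA); last by move=> x [].
have mB := measurable_psi_preimage i mA.
have -> : img i `&` psi i @^-1` A = overlap i j `&` trans i j @^-1` E.
  apply/seteqP; split => y /=.
    by move=> [iy [_ [jy Ey]]].
  by move=> [[iy jy] Ey]; split => //; split => //; exact: dom_psi.
set N := _ `&` _ => I0.
have Ni : N `<=` img i by move=> y [[]].
have mN : measurable (N : set (borel 'rV[R]_n)).
  have := mB; congr (measurable _); apply/seteqP; split => y /=.
    by move=> [iy [_ [jy Ey]]].
  by move=> [[iy jy] Ey]; split => //; split => //; exact: dom_psi.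
have md : measurable_fun (N : set (borel 'rV[R]_n)) (fun y : borel 'rV[R]_n => (dens i y)%:E).
  apply/measurable_EFinP; apply: measurable_funS (@measurable_density i) => //; exact: measurable_img.
have : ae_eq (leb_rV n) (N : set (borel 'rV[R]_n)) (fun y => (dens i y)%:E) (cst 0%E).
  apply/(ae_eq_integral_abs _ mN md); rewrite -[RHS]I0; apply: eq_integral => y _.
  by rewrite gee0_abs// lee_fin sqrtr_ge0.
move=> [B [mB' B0 hB]]; apply: (subset_measure0 (mu := leb_rV n) mN mB') => // y Ny; apply: hB => /= h.
have := h Ny; rewrite /= => -[] /eqP; rewrite gt_eqF//; apply: density_gt0; exact: Ni.
Qed.

End volume.

(** * Lipschitz functions supported in a chart *)

Section lipschitz_sobolev.
Context {R : realType} {n : nat} {M : ptopologicalType} {X : closed_manifold R n M}.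
Variables (g : riemannian_metric X) (vol : {measure set (borel M) -> \bar R}).
Hypothesis hv : riemannian_volume g vol.
Implicit Types (i j : chart X) (y : 'rV[R]_n) (x : M).

Lemma loc_integrable_pullback i j (K : set 'rV[R]_n) (W : 'rV[R]_n -> 'rV[R]_n) (L : R) k :
  compact K -> K `<=` img j -> 0 <= L ->
  (forall l, measurable_fun setT (fun y : borel 'rV[R]_n => W y 0 l)) ->
  (forall y l, `|W y 0 l| <= L) -> (forall y, ~ K y -> W y = 0) ->
  loc_integrable (img i) (fun y => pullback i j W y 0 k).
Proof.
move=> cK Kj L0 mW WL W0; have mp := @measurable_pullback R n M X j i W k mW.
split => // K' cK' Ki.
have [C C0 hC] := @trans_bound_compact R n M X j K cK Kj i K' cK' Ki.
have mK' : measurable (K' : set (borel 'rV[R]_n)).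
  by apply: borel_closed; apply: compact_closed => //; exact: norm_hausdorff.
apply: (integrable_compact_support (K := K') (C := L * C) mK') => //.
- by apply: measurable_funS mp => //; exact: measurable_img.
- move=> y K'y; apply: (le_trans (@pullback_le R n M X j K i W L y k W0 L0 WL)).
  by apply: ler_wpM2l => //; exact: hC.
Qed.

(** Integration by parts holds in every chart for the differentiable approximations of [F], and both
    sides pass to the limit by dominated convergence. Their gradients converge almost everywhere in
    chart [j]; [null_transfer] carries the exceptional set to chart [i]. *)
Lemma weak_gradient_extend0 j (F : 'rV[R]_n -> R) (L s s1 : R) p :
  0 < s -> s < s1 -> [set y | `|p - y| <= s1] `<=` img j -> 0 <= L ->
  (forall y z, `|F y - F z| <= L * `|y - z|) -> (forall y, s <= `|p - y| -> F y = 0) ->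
  exists W : 'rV[R]_n -> 'rV[R]_n,
  [/\ forall l, measurable_fun setT (fun y : borel 'rV[R]_n => W y 0 l),
      forall y l, `|W y 0 l| <= L, forall y, s < `|p - y| -> W y = 0 &
      weak_gradient (extend0 j F : borel M -> R) (fun i => pullback i j W)].
Proof.
move=> s0 ss1 Kj L0 FL F0.
have [G0_ [W [dG [GL [GF [GS [mW [WL [W0 Wae]]]]]]]]] := lipschitz_gradient s0 L0 FL F0.
exists W; split => //.
pose K := [set y | `|p - y| <= s1]; have cK : compact K by exact: rV_closed_ball_compact.
(* The support of the m-th approximation may exceed radius [s] by 1/(m+1); starting at [m0] keeps
   all supports inside [K]. *)
have [m0 hm0] : exists m0 : nat, s + m0.+1%:R^-1 <= s1.
  have d0 : 0 < s1 - s by rewrite subr_gt0.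
  have [m0 _ h] := near_infty_natSinv_lt (PosNum d0); exists m0.
  by rewrite -lerBrDl ltW//; apply: h => /=.
pose G m := G0_ (m + m0)%N.
have G_K m y : ~ K y -> G m y = 0.
  move=> /negP; rewrite -ltNge => h; apply: GS; apply: ltW; apply: le_lt_trans h.
  apply: le_trans hm0; rewrite lerD2l lef_pV2 ?posrE// ler_nat ltnS; exact: leq_addl.
have W_K y : ~ K y -> W y = 0.
  by move=> /negP; rewrite -ltNge => h; apply: W0; exact: lt_trans h.
have F_K y : ~ K y -> F y = 0.
  by move=> /negP; rewrite -ltNge => h; apply: F0; rewrite ltW//; exact: lt_trans h.
have cF : continuous F by exact: lipschitz_continuous FL.
have [B0 B00 hB0] := continuous_bounded_support cK cF F_K.
pose B := B0 + L.
have B_ge0 : 0 <= B by rewrite addr_ge0.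
have GB m y : `|G m y| <= B.
  rewrite -[G m y](subrK (F y)) addrC; apply: (le_trans (ler_normD _ _)); apply: lerD => //.
  apply: (le_trans (GF _ _)); rewrite -[leRHS]mulr1; apply: ler_wpM2l => //.
  by rewrite invf_le1// ler1n.
have FB y : `|F y| <= B by apply: (le_trans (hB0 y)); rewrite lerDl.
have extB H x : (forall y, `|H y| <= B) -> `|extend0 j H x| <= B.
  by move=> HB; rewrite /extend0; case: ifP => // _; rewrite normr0.
pose gr m y : 'rV[R]_n := \row_l partial l (G m) y.
have grL m y l : `|gr m y 0 l| <= L.
  rewrite mxE; apply: (le_trans (derive_lipschitz _ (GL _))).
    by apply: diff_derivable; exact: dG.
  by rewrite -[leRHS]mulr1; apply: ler_wpM2l => //; exact: rV_norm_delta.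
have gr_K m y : ~ K y -> gr m y = 0.
  by move=> Ky; apply/rowP => l; rewrite !mxE; exact: (support_partial l cK (G_K m)).
have mgr m l : measurable_fun setT (fun y : borel 'rV[R]_n => gr m y 0 l).
  under eq_fun do rewrite mxE.
  apply: measurable_derive; first by move=> y; apply: diff_derivable; exact: dG.
  by move=> y; apply: differentiable_continuous; exact: dG.
move=> i k; split; first exact: (loc_integrable_pullback i k cK Kj L0 mW WL W_K).
move=> h th; have [sh [Kh [cKh Khi h0]]] := th.
have [C C0 hC] := @trans_bound_compact R n M X j K cK Kj i Kh cKh Khi.
have dh y : differentiable h y by exact: (smooth_on_differentiable sh).
have ch : continuous h by move=> y; exact: differentiable_continuous.
have dph y : differentiable (partial k h) y by exact: (smooth_on_partial k sh).
have cph : continuous (partial k h) by move=> y; exact: differentiable_continuous.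
have ph0 := support_partial k cKh h0.
have [Bp Bp0 hBp] := continuous_bounded_support cKh cph ph0.
have [Bh Bh0 hBh] := continuous_bounded_support cKh ch h0.
have mh : measurable_fun setT (h : borel 'rV[R]_n -> R) by exact: borel_continuousR.
have mph : measurable_fun setT (partial k h : borel 'rV[R]_n -> R) by exact: borel_continuousR.
have mi := @measurable_img R n M X i.
pose D : set (borel 'rV[R]_n) := img i.
have pb_le (V : 'rV[R]_n -> 'rV[R]_n) y : (forall y, ~ K y -> V y = 0) -> (forall y l, `|V y 0 l| <= L) ->
    Kh y -> `|pullback i j V y 0 k| <= L * C.
  move=> V0 VL Khy; apply: (le_trans (@pullback_le R n M X j K i V L y k V0 L0 VL)).
  by apply: ler_wpM2l => //; exact: hC.
have pbh_le (V : 'rV[R]_n -> 'rV[R]_n) y : (forall y, ~ K y -> V y = 0) -> (forall y l, `|V y 0 l| <= L) ->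
    `|pullback i j V y 0 k * h y| <= (L * C) * `|h y|.
  move=> V0 VL; have [Khy|Khy] := pselect (Kh y); last by rewrite h0// mulr0 normr0 mulr0.
  by rewrite normrM; apply: ler_wpM2r => //; exact: pb_le.
have dext m y : img i y -> differentiable (extend0 j (G m) \o psi i) y.
  by move=> iy; apply: (extend0_differentiable cK Kj) => //; move=> z; [exact: dG|exact: G_K].
have pext m y : img i y -> partial k (extend0 j (G m) \o psi i) y = pullback i j (gr m) y 0 k.
  by move=> iy; apply: (extend0_partial cK Kj) => //; move=> z; [exact: dG|exact: G_K].
have ibp m : \int[leb_rV n]_(y in D) (extend0 j (G m) (psi i y) * partial k h y) =
    - \int[leb_rV n]_(y in D) (pullback i j (gr m) y 0 k * h y).
  rewrite (@integration_by_parts_test R n (img i) (extend0 j (G m) \o psi i) h k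
    (Num.max (Num.max B (L * C)) (B * Bp))) //.
  - congr (- _); apply: eq_Rintegral => y; rewrite inE => iy; by rewrite pext.
  - exact: img_open.
  - exact: dext.
  - move=> y iy hy; have Khy : Kh y by apply: contrapT => /h0 e; rewrite e eqxx in hy.
    split; first by rewrite /= !le_max extB.
    rewrite pext// !le_max; apply/orP; left; apply/orP; right; apply: pb_le => //; exact: gr_K.
  - move=> y iy; rewrite /= normrM !le_max; apply/orP; right; apply: ler_pM => //; exact: extB.
have lim1 : (fun m => \int[leb_rV n]_(y in D) (extend0 j (G m) (psi i y) * partial k h y)) @ \oo
   --> \int[leb_rV n]_(y in D) (extend0 j F (psi i y) * partial k h y).
  have mext H : continuous H -> (forall y, ~ K y -> H y = 0) ->
      measurable_fun D (fun y : borel 'rV[R]_n => extend0 j H (psi i y)).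
    move=> cH H0; apply: borel_continuous_on; first exact: img_open.
    move=> y iy; have [jy|jy] := pselect (dom j (psi i y)).
      have oy : overlap i j y by [].
      have cc : {for y, continuous (H \o trans i j)}.
        by apply: continuous_comp; [apply: differentiable_continuous; exact: trans_differentiable|exact: cH].
      suff : (fun z => extend0 j H (psi i z)) @ y --> extend0 j H (psi i y) by [].
      rewrite extend0_dom//; apply: cvg_trans cc; apply: near_eq_cvg; first exact: nbhs_filter.
      by apply: filterS (near_extend0 H oy) => z /= ->.
    have h0' := near_extend0_eq0 cK Kj H0 iy jy.
    suff : (fun z => extend0 j H (psi i z)) @ y --> extend0 j H (psi i y) by [].
    by rewrite (nbhs_singleton h0'); apply: cvg_near_cst; (exact: h0' || exact: nbhs_filter).
  apply: (@Rdominated_cvg _ _ _ (leb_rV n) D _ _ (fun y => B * `|partial k h y|)) => //.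
  - move=> m; apply: measurable_funM; last exact: measurable_funS mph.
    by apply: mext; [move=> y; apply: differentiable_continuous; exact: dG|exact: G_K].
  - by apply: measurable_funM; [exact: mext|exact: measurable_funS mph].
  - apply: aeW => y iy; apply: cvgMl => //; rewrite /extend0; case: ifP => _; last exact: cvg_cst.
    apply/cvgrPdist_le => e e0.
    have eL : 0 < e / (L + 1) by rewrite divr_gt0// ltr_pwDr.
    have := near_infty_natSinv_lt (PosNum eL); apply: filterS => m /= hm.
    rewrite distrC; apply: (le_trans (GF _ _)); apply: (@le_trans _ _ ((L + 1) * m.+1%:R^-1)).
      apply: ler_pM => //; first by rewrite lerDl.
      by rewrite lef_pV2 ?posrE// ler_nat ltnS leq_addr.
    by rewrite mulrC -ler_pdivlMr ?ltr_pwDr// ltW.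
  - apply: (integrable_compact_support (K := Kh) (C := B * Bp) mi) => //.
    + by apply: measurable_funM => //; apply: measurableT_comp => //; exact: measurable_funS mph.
    + by move=> y _; rewrite normrM normr_id ger0_norm//; exact: ler_wpM2l.
    + by move=> y _ /ph0 ->; rewrite normr0 mulr0.
  - by move=> m y iy; rewrite normrM; apply: ler_wpM2r => //; exact: extB.
have lim2 : (fun m => \int[leb_rV n]_(y in D) (pullback i j (gr m) y 0 k * h y)) @ \oo
   --> \int[leb_rV n]_(y in D) (pullback i j W y 0 k * h y).
  apply: (@Rdominated_cvg _ _ _ (leb_rV n) D _ _ (fun y => (L * C) * `|h y|)) => //.
  - move=> m; apply: measurable_funM; last exact: measurable_funS mh.
    exact: (@measurable_pullback R n M X j i (gr m) k (mgr m)).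
  - apply: measurable_funM; last exact: measurable_funS mh.
    exact: (@measurable_pullback R n M X j i W k mW).
  - have [E [mE E0 hE]] := Wae.
    exists (overlap i j `&` trans i j @^-1` E); split.
    + have mt : measurable_fun (overlap i j : set (borel 'rV[R]_n)) (trans i j : borel 'rV[R]_n -> borel 'rV[R]_n).
        apply: borel_continuous_on_map; first exact: open_overlap.
        by move=> y oy; apply: differentiable_continuous; exact: trans_differentiable.
      by apply: mt => //; apply: borel_open; exact: open_overlap.
    + exact: (null_transfer hv i j mE E0).
    + move=> y /= hy; apply: contrapT => nE; apply: hy => iy.
      apply: cvgMl => //; rewrite /pullback; case: ifPn => [|_]; last by under eq_fun do rewrite mxE; rewrite mxE; exact: cvg_cst.
      rewrite inE => oy; have nEy : ~ E (trans i j y) by move=> Ey; apply: nE.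
      have hW : forall l, (fun m => partial l (G0_ m) (trans i j y)) @ \oo --> W (trans i j y) 0 l.
        by apply: contrapT => h'; apply: nEy; apply: hE.
      under eq_fun do rewrite mxE; rewrite mxE.
      apply: cvg_big => //=; first exact: add_continuous.
      move=> l _; apply: cvgMr; rewrite /gr.
      under eq_fun do rewrite mxE.
      by have := hW l; rewrite -(cvg_shiftn m0).
  - apply: (integrable_compact_support (K := Kh) (C := (L * C) * Bh) mi) => //.
    + by apply: measurable_funM => //; apply: measurableT_comp => //; exact: measurable_funS mh.
    + by move=> y _; rewrite normrM normr_id ger0_norm ?mulr_ge0//; apply: ler_wpM2l => //; exact: mulr_ge0.
    + by move=> y _ /h0 ->; rewrite normr0 mulr0.
  - by move=> m y iy; apply: pbh_le => //; exact: gr_K.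
have e : (fun m => \int[leb_rV n]_(y in D) (extend0 j (G m) (psi i y) * partial k h y)) =
   - (fun m => \int[leb_rV n]_(y in D) (pullback i j (gr m) y 0 k * h y)).
  by apply/funext => m; rewrite ibp.
rewrite -[LHS](cvg_lim _ lim1)// e; apply: cvg_lim => //; exact: cvgN.
Qed.

(** The energy density is at most L^2 times the entries of the inverse Gram matrix, and it lives on
    a ball of volume of order s^n. Doubling the radius puts the closed ball of radius [s] inside an
    open one. With L = 1/rho and s = 2 rho this yields the order rho^(n-2). *)
Lemma energy_pullback_le j p0 r0 : [set y | `|p0 - y| <= r0] `<=` img j ->
  exists2 C : R, 0 < C & forall (W : 'rV[R]_n -> 'rV[R]_n) (L : R) p s, 0 < s -> 0 <= L ->
    `|p0 - p| + s *+ 2 <= r0 ->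
    (forall l, measurable_fun setT (fun y : borel 'rV[R]_n => W y 0 l)) ->
    (forall y l, `|W y 0 l| <= L) -> (forall y, s < `|p - y| -> W y = 0) ->
    (\int[vol]_x (grad_inner g (fun i => pullback i j W) (fun i => pullback i j W) x)%:E <= (C * L ^+ 2 * s ^+ n)%:E)%E.
Proof.
move=> Kj; have cK := @rV_closed_ball_compact R n p0 r0.
have [C2 C20 hC2] := vol_ball_le hv Kj.
have [C1 C10 hC1] : exists2 C : R, 0 < C & forall y, `|p0 - y| <= r0 ->
    \sum_k \sum_l `|invmx (gram g j y) k l| <= C.
  apply: (continuous_le_compact cK) => y /Kj iy.
  apply: continuous_at_sum => k; apply: continuous_at_sum => l.
  apply: (@continuous_comp _ _ _ (fun y => invmx (gram g j y) k l) (@Num.norm _ R)).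
    exact: gram_inv_continuous.
  exact: norm_continuous.
exists (C1 * (C2 * 2 ^+ n)); first by rewrite !mulr_gt0// exprn_gt0.
move=> W L p s s0 L0 ps mW WL W0; set w := fun i => pullback i j W.
have s2 : 0 < s *+ 2 by rewrite pmulrn_rgt0.
pose A : set (borel M) := dom j `&` phi j @^-1` ball p (s *+ 2).
have mA : measurable A by apply: borel_open; apply: open_phi_preimage; exact: ball_open.
pose K' := [set y | `|p - y| <= s].
have cK' : compact K' by exact: rV_closed_ball_compact.
have K'K : K' `<=` [set y | `|p0 - y| <= r0].
  move=> y /= h; apply: le_trans ps; apply: (le_trans (ler_distD p p0 y)); rewrite lerD2l.
  by apply: (le_trans h); rewrite mulr2n lerDl ltW.
have W0' y : ~ K' y -> W y = 0 by move=> /negP; rewrite -ltNge; exact: W0.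
have mw i k := proj1 (loc_integrable_pullback i k cK' (subset_trans K'K Kj) L0 mW WL W0').
have mg := measurable_grad_inner g mw mw.
have key x : grad_inner g w w x <= (L ^+ 2 * C1) * \1_A x.
  have [jx|jx] := pselect (dom j x); last first.
    by rewrite grad_inner_pullback0// mulr_ge0// mulr_ge0 ?sqr_ge0// ltW.
  rewrite grad_inner_pullback//; have [h|h] := lerP `|p - phi j x| s; last first.
    by rewrite W0// !mul0mx mxE mulr_ge0// mulr_ge0 ?sqr_ge0// ltW.
  rewrite indicE mem_set ?mulr1; last first.
    split => //=; rewrite rV_ballE; apply: (le_lt_trans h); by rewrite mulr2n ltrDl.
  apply: (le_trans (ler_norm _)); apply: (le_trans (quadratic_form_le _ L0 L0 (WL _) (WL _))).
  by rewrite -expr2; apply: ler_wpM2l; [exact: sqr_ge0|apply: hC1; exact: K'K].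
apply: (@le_trans _ _ (\int[vol]_x ((L ^+ 2 * C1)%:E * (\1_A x)%:E))%E).
  apply: ge0_le_integral => //.
  - by move=> x _; rewrite lee_fin grad_inner_ge0.
  - exact/measurable_EFinP.
  - apply/measurable_EFinP; apply: measurable_funM => //; exact: measurable_indic.
  - by move=> x _; rewrite -EFinM lee_fin.
have E : (\int[vol]_x ((L ^+ 2 * C1)%:E * (\1_A x)%:E) = (L ^+ 2 * C1)%:E * vol A)%E.
  rewrite (@ge0_integralZl_EFin _ _ _ vol setT measurableT (fun x => (\1_A x)%:E)).
  - by rewrite integral_indic// setIT.
  - by move=> x _; rewrite lee_fin.
  - by apply/measurable_EFinP; exact: measurable_indic.
  - by rewrite mulr_ge0 ?sqr_ge0// ltW.
rewrite E.
have := hC2 p (s *+ 2) s2 ps; rewrite -/A => hA.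
have Lc : (0 <= (L ^+ 2 * C1)%:E)%E by rewrite lee_fin mulr_ge0 ?sqr_ge0// ltW.
apply: (le_trans (lee_wpmul2l Lc hA)); rewrite -EFinM lee_fin -[s *+ 2]mulr_natl exprMn.
by rewrite le_eqVlt; apply/orP; left; apply/eqP; ring.
Qed.

End lipschitz_sobolev.

(** * The Riemannian distance *)

Section speed.
Context {R : realType} {n : nat} {M : ptopologicalType} {X : closed_manifold R n M}.
Variable g : riemannian_metric X.
Implicit Types (i j : chart X) (y : 'rV[R]_n) (x : M) (c : R -> M).

Lemma speed_ge0 c t : 0 <= speed g c t.
Proof. by rewrite /speed; case: pickP => // i _; exact: sqrtr_ge0. Qed.

Lemma near_in_chart c t i : {for t, continuous c} -> dom i (c t) -> \forall s \near t, dom i (c s).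
Proof. by move=> cc ict; apply: (cc (dom i)); exact: open_nbhs_nbhs (conj (dom_open i) ict). Qed.

Lemma near_trans_curve c t i j : {for t, continuous c} -> dom i (c t) ->
  \forall s \near t, phi j (c s) = trans i j (phi i (c s)).
Proof.
move=> cc ict; have := near_in_chart cc ict; apply: filterS => s ics.
by rewrite /trans psi_phi.
Qed.

Lemma overlap_curve c t i j : dom i (c t) -> dom j (c t) -> overlap i j (phi i (c t)).
Proof. by move=> ic jc; split; [exact: img_phi|rewrite /= psi_phi]. Qed.

Lemma derive1_chart_change c t i j : {for t, continuous c} -> dom i (c t) -> dom j (c t) ->
  derivable (phi i \o c) t 1 ->
  derivable (phi j \o c) t 1 /\
  derive1 (phi j \o c) t = derive1 (phi i \o c) t *m 'J (phi j \o psi i) (phi i (c t)).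
Proof.
move=> cc ic jc di.
have dT := trans_differentiable (overlap_curve ic jc).
have dd : differentiable (phi i \o c) t by apply/derivable1_diffP.
have E : \forall s \near t, (trans i j \o (phi i \o c)) s = (phi j \o c) s.
  by have := near_trans_curve j cc ic; apply: filterS => s /= ->.
split.
  apply/derivable1_diffP; apply: (near_eq_differentiable E).
  exact: differentiable_comp.
rewrite !derive1E -(near_eq_derive _ E) deriveE; last exact: differentiable_comp.
by rewrite diff_comp//= -!deriveE// deriveEjacobian.
Qed.

(** The Gram matrix compensates the Jacobian of the transition map, so any chart around the point
    may replace the one picked by [speed]. *)
Lemma speed_chart c t i : dom i (c t) -> {for t, continuous c} -> derivable (phi i \o c) t 1 ->
  speed g c t = Num.sqrt ((derive1 (phi i \o c) t *m gram g i (phi i (c t)) *m (derive1 (phi i \o c) t)^T) 0 0).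
Proof.
move=> ic cc di; rewrite /speed; have [j [-> jc]] := pick_dom (X := X) (c t).
have oy := overlap_curve ic jc.
have [_ ->] := derive1_chart_change cc ic jc di.
have -> : gram g i (phi i (c t)) = 'J (phi j \o psi i) (phi i (c t)) *m
    gram g j (phi j (c t)) *m ('J (phi j \o psi i) (phi i (c t)))^T.
  rewrite {1}(gram_change g (img_phi ic) (j := j)) /=; last by rewrite psi_phi.
  by rewrite psi_phi.
by rewrite trmx_mul !mulmxA.
Qed.

Lemma near_eq_speed c c' t : (\forall s \near t, c s = c' s) -> speed g c t = speed g c' t.
Proof.
move=> h; have e : c t = c' t := nbhs_singleton h.
have [i [ei _]] := pick_dom (X := X) (c t).
have ei' : [pick i : chart X | c' t \in dom i] = Some i by rewrite -e.
rewrite /speed ei ei' e; have -> // : derive1 (phi i \o c) t = derive1 (phi i \o c') t.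
by rewrite !derive1E; apply: near_eq_derive; apply: filterS h => s /= ->.
Qed.

Lemma piecewise_C1_lt c a b : piecewise_C1 (X := X) c a b -> a < b.
Proof. by elim => // {}a d {}b _ ad db _; exact: lt_trans db. Qed.

Lemma piecewise_C1_ext c c' a b : piecewise_C1 (X := X) c a b ->
  (forall t, a <= t <= b -> c t = c' t) -> piecewise_C1 (X := X) c' a b.
Proof.
elim => {a b} [a b ab [e he] H|a d b p IH db [e he] H].
  by apply: piecewise_C1_one => //; exists e => t tab; have [-> ?] := he t tab; split => //; exact: H.
have ad := piecewise_C1_lt p.
apply: (piecewise_C1_cat (d := d)) => //.
  by apply: IH => t /andP[ta td]; apply: H; rewrite ta/= (le_trans td)// ltW.
exists e => t /andP[td tb]; have [|e1 e2] := he t; first by rewrite td tb.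
rewrite e1; split => //; by apply: H; rewrite tb (le_trans _ td)// ltW.
Qed.

Lemma rV_continuous_at (T : topologicalType) (f : T -> 'rV[R]_n) (t : T) :
  (forall k, {for t, continuous (fun s => f s 0 k)}) -> {for t, continuous f}.
Proof.
move=> H; apply/cvgrPdist_le => e e0.
have h : \forall s \near t, forall k, `|f t 0 k - f s 0 k| <= e.
  apply: (@filter_forall _ 'I_n (fun k => [set s | `|f t 0 k - f s 0 k| <= e]) (nbhs t)) => k.
  by have /cvgrPdist_le/(_ e e0) := H k.
by apply: filterS h => s h; apply: rV_norm_le => [|k]; [exact: ltW|rewrite !mxE].
Qed.

(** The time [b] is a parameter because the segment is later attached to a curve that ends at time
    [b]. *)
Lemma segment_C1_at i y (v : 'rV[R]_n) (b t : R) : img i (y + (t - b) *: v) ->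
  C1_at (X := X) (fun s => psi i (y + (s - b) *: v)) t.
Proof.
move=> it; pose l s := y + (s - b) *: v; pose e s := psi i (l s).
have dl s : differentiable l s.
  apply: differentiableD => //; apply: differentiableZl.
  by apply: differentiableB => //; exact: differentiable_cst.
have cl s : {for s, continuous l} by apply: differentiable_continuous.
have le s : l s = s *: v + (y - b *: v) by rewrite /l scalerBl addrCA.
have ce : {for t, continuous e} by apply: continuous_comp; [exact: cl|exact: psi_continuous].
split => // j jt.
have oy : overlap i j (l t) by split.
have no : \forall s \near t, overlap i j (l s).
  by apply: cl; exact: open_nbhs_nbhs (conj (@open_overlap _ _ _ X i j) oy).
have D s : overlap i j (l s) -> derivable (trans i j \o l) s 1 /\
    'D_1 (trans i j \o l) s = \sum_k v 0 k *: 'D_(delta_mx 0 k) (trans i j) (l s).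
  move=> os; have dT := trans_differentiable os.
  rewrite le in os dT *; have -> : trans i j \o l = (fun a => trans i j (a *: v + (y - b *: v))).
    by apply/funext => a /=; rewrite le.
  have [h1 h2] := line_is_derive (diff_derivable dT (v := v)).
  by split; [exact: h1|rewrite h2 (derive_partial _ dT)].
split; first by apply: filterS no => s /D[].
apply: rV_continuous_at => k.
have E : \forall s \near t, \sum_l0 v 0 l0 * partial l0 (fun z => trans i j z 0 k) (l s) = derive1 (phi j \o e) s 0 k.
  apply: filterS no => s os; have [_ h] := D s os.
  rewrite derive1E -[phi j \o e]/(trans i j \o l) h summxE; apply: eq_bigr => a _.
  by rewrite mxE (derive_coord _ _ (trans_differentiable os)).
have c1 : {for t, continuous (fun s => \sum_l0 v 0 l0 * partial l0 (fun z => trans i j z 0 k) (l s))}.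
  apply: continuous_at_sum => a; apply: (@continuousM _ _ (cst _)); first exact: cvg_cst.
  apply: (@continuous_comp _ _ _ l (partial a (fun z => trans i j z 0 k))); first exact: cl.
  exact: trans_partial_continuous.
suff : (fun s => derive1 (phi j \o e) s 0 k) @ t --> derive1 (phi j \o e) t 0 k by [].
rewrite -(nbhs_singleton E); apply: cvg_trans c1; apply: near_eq_cvg.
by apply: filterS E => s /= ->.
Qed.

(** [C1_at] gives continuity of [e] at [t] only. At nearby times it is recovered from derivability
    of the coordinates, since [e] is locally [psi i] composed with them. *)
Lemma near_C1 e t i : C1_at (X := X) e t -> dom i (e t) ->
  \forall s \near t, [/\ dom i (e s), {for s, continuous e} & derivable (phi i \o e) s 1].
Proof.
move=> [ce he] it; have [hd _] := he i it.
have h2 : \forall s \near t, \forall u \near s, dom i (e u).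
  by apply: nbhs_interior; exact: near_in_chart.
apply: filterS2 h2 hd => s h2 ds; have si := nbhs_singleton h2; split => //.
have cp : {for s, continuous (phi i \o e)}.
  by apply: differentiable_continuous; exact/derivable1_diffP.
have cpe : {for s, continuous (psi i \o (phi i \o e))}.
  by apply: continuous_comp => //; apply: psi_continuous; exact: img_phi.
have E : \forall u \near s, (psi i \o (phi i \o e)) u = e u.
  by apply: filterS h2 => u iu /=; rewrite psi_phi.
suff : e @ s --> e s by [].
by rewrite -(nbhs_singleton E); apply: cvg_trans cpe; exact: near_eq_cvg.
Qed.

Lemma speed_continuous e t : C1_at (X := X) e t -> {for t, continuous (speed g e)}.
Proof.
move=> he; have [i [_ it]] := pick_dom (X := X) (e t).
have [ce hi] := he; have [_ cD] := hi i it.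
pose q s := ((derive1 (phi i \o e) s) *m gram g i (phi i (e s)) *m (derive1 (phi i \o e) s)^T) 0 0.
have E : \forall s \near t, Num.sqrt (q s) = speed g e s.
  by apply: filterS (near_C1 he it) => s [si cs ds]; rewrite (speed_chart si).
have cDk k : {for t, continuous (fun s => derive1 (phi i \o e) s 0 k)}.
  apply: (@continuous_comp _ _ _ (derive1 (phi i \o e)) (fun A : 'rV[R]_n => A 0 k)) => //.
  exact: coord_continuous.
have cp : {for t, continuous (phi i \o e)}.
  by apply: continuous_comp => //; exact: phi_continuous.
have cq : {for t, continuous q}.
  have -> : q = (fun s => \sum_l (\sum_k derive1 (phi i \o e) s 0 k * gram g i (phi i (e s)) k l) *
      derive1 (phi i \o e) s 0 l).
    by apply/funext => s; rewrite /q mxE; apply: eq_bigr => l _; rewrite !mxE.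
  apply: continuous_at_sum => l; apply: continuousM; last exact: cDk.
  apply: continuous_at_sum => k; apply: continuousM; first exact: cDk.
  apply: (@continuous_comp _ _ _ (phi i \o e) (fun y => gram g i y k l)) => //.
  by apply: gram_continuous; exact: img_phi.
suff : speed g e @ t --> speed g e t by [].
rewrite -(nbhs_singleton E).
have : {for t, continuous (Num.sqrt \o q)} by apply: continuous_comp => //; exact: sqrt_continuous.
by apply: cvg_trans; exact: near_eq_cvg.
Qed.

Lemma near_eq_itv (T : Type) (c e : R -> T) (a b t : R) : a < t < b ->
  (forall t, a <= t <= b -> e t = c t) -> \forall s \near t, e s = c s.
Proof.
move=> tab ec; have : nbhs t `]a, b[%classic by apply: open_nbhs_nbhs; split; [exact: interval_open|rewrite /= in_itv].
by apply: filterS => s /=; rewrite in_itv/= => /andP[? ?]; apply: ec; rewrite !ltW.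
Qed.

Lemma measurable_fun_setU1 (D : set (measurableTypeR R)) (d : R) (f : measurableTypeR R -> R) :
  measurable D -> measurable_fun D f -> measurable_fun (D `|` [set d]) f.
Proof.
move=> mD mf; have m1 : measurable ([set d] : set (measurableTypeR R)) by exact: measurable_set1.
by apply/(measurable_funU f mD m1); split => //; exact: measurable_fun_set1.
Qed.

Lemma measurable_speed_piecewise c a b : piecewise_C1 (X := X) c a b ->
  measurable_fun (`]a, b[ : set (measurableTypeR R)) (speed g c : measurableTypeR R -> R).
Proof.
have one a' b' : C1_on (X := X) a' b' c -> measurable_fun (`]a', b'[ : set (measurableTypeR R)) (speed g c : measurableTypeR R -> R).
  move=> [e he]; apply: (@eq_measurable_fun _ _ _ _ _ (speed g e)).
    move=> t; rewrite inE/= in_itv/= => tab; apply: near_eq_speed; apply: (near_eq_itv tab).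
    by move=> s /he[].
  apply: open_continuous_measurable_fun; first exact: interval_open.
  move=> t; rewrite inE/= in_itv/= => /andP[? ?]; apply: speed_continuous.
  by apply: (he t _).2; rewrite !ltW.
elim => {a b} [a b ab C|a d b p IH db C]; first exact: one.
have ad := piecewise_C1_lt p.
have -> : `]a, b[%classic = (`]a, d[ `|` [set d] `|` `]d, b[ : set R).
  apply/seteqP; split => t /=; rewrite !in_itv/=.
    by move=> /andP[? ?]; case: (ltgtP t d) => [?|?|->]; [left; left; lra|right; lra|left; right].
  by move=> [[|->]|]; lra.
have m1 : measurable ([set d] : set (measurableTypeR R)) by exact: measurable_set1.
have mi a' b' : measurable (`]a', b'[ : set (measurableTypeR R)) by exact: measurable_itv.
apply/(measurable_funU (speed g c) (measurableU _ _ (mi a d) m1) (mi d b)); split; last exact: one.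
exact: measurable_fun_setU1.
Qed.

(** At the end points the speed depends on [c] outside the interval; these two points are null and
    are dropped, so that curves agreeing on the interval have the same length. *)
Lemma curve_length_oo c a b : a < b ->
  measurable_fun (`]a, b[ : set (measurableTypeR R)) (speed g c : measurableTypeR R -> R) ->
  curve_length g a b c = (\int[@lebesgue_measure R]_(t in `]a, b[) (speed g c t)%:E)%E.
Proof.
move=> ab m; rewrite /curve_length -integral_itv_bndo_bndc; last first.
  rewrite -(@setU1itv _ _ (BLeft b) a false) ?bnd_simp// setUC.
  by apply/measurable_EFinP; apply: measurable_fun_setU1 => //; exact: measurable_itv.
by rewrite -integral_itv_obnd_cbnd//; exact/measurable_EFinP.
Qed.

Lemma curve_length_cat c a d b : piecewise_C1 (X := X) c a d -> d < b -> C1_on (X := X) d b c ->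
  curve_length g a b c = (curve_length g a d c + curve_length g d b c)%E.
Proof.
move=> p db C; have ad := piecewise_C1_lt p; have pc := piecewise_C1_cat p db C.
have m := measurable_speed_piecewise pc.
have m1 := measurable_speed_piecewise p.
have m2 := measurable_speed_piecewise (piecewise_C1_one db C).
rewrite !curve_length_oo//; last exact: lt_trans db.
rewrite (integral_itv_obnd_cbnd (r := d)); last exact/measurable_EFinP.
have -> : `]a, b[%classic = (`]a, d[ `|` `[d, b[ : set R).
  apply/seteqP; split => t /=; rewrite !in_itv/=.
    by move=> /andP[? ?]; case: (ltP t d) => ?; [left; lra|right; lra].
  by move=> [|]; lra.
rewrite ge0_integral_setU//.
- apply/measurable_EFinP; apply: measurable_funS m => //.
  by move=> t [] /=; rewrite !in_itv/=; lra.
- by move=> t _; rewrite lee_fin speed_ge0.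
- by apply/disj_setPS => t [] /=; rewrite !in_itv/=; lra.
Qed.

(* Cauchy-Schwarz for [A]: the coordinate [v_k] is the [A]-product of [v] and [e_k A^-1]. *)
Lemma posdef_coord_le (A : 'M[R]_n) (v : 'rV[R]_n) k (C : R) : A^T = A -> posdef A ->
  0 < C -> invmx A k k <= C -> (v 0 k) ^+ 2 <= C * (v *m A *m v^T) 0 0.
Proof.
move=> sA pA C0 AC; pose u : 'rV[R]_n := delta_mx 0 k *m invmx A; pose l := v 0 k / C.
have uA : A \in unitmx by exact: posdef_unitmx.
have h : 0 <= ((v - l *: u) *m A *m (v - l *: u)^T) 0 0.
  have [->|n0] := eqVneq (v - l *: u) 0; first by rewrite !mul0mx mxE.
  by rewrite ltW// pA.
have uAE : u *m A = delta_mx 0 k by rewrite /u mulmxKV.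
have e1 : (u *m A *m v^T) 0 0 = v 0 k by rewrite uAE -rowE !mxE.
have e2 : (v *m A *m u^T) 0 0 = v 0 k.
  have -> : v *m A *m u^T = (u *m A *m v^T)^T by rewrite !trmx_mul trmxK sA mulmxA.
  by rewrite mxE.
have e3 : (u *m A *m u^T) 0 0 = invmx A k k.
  rewrite uAE /u trmx_mul trmx_inv sA -rowE trmx_delta.
  by rewrite -colE !mxE.
have E : ((v - l *: u) *m A *m (v - l *: u)^T) 0 0 =
    (v *m A *m v^T) 0 0 - 2 * l * v 0 k + l ^+ 2 * invmx A k k.
  have -> : (v - l *: u)^T = v^T - l *: u^T by rewrite linearB/= linearZ.
  rewrite !mulmxBl !mulmxBr -!(scalemxAl, scalemxAr).
  rewrite !mxE; rewrite !mxE in e1 e2 e3; rewrite e1 e2 e3; ring.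
rewrite E in h.
have lC : v 0 k = l * C by rewrite /l divfK// gt_eqF.
have : l ^+ 2 * invmx A k k <= l ^+ 2 * C by rewrite ler_wpM2l// sqr_ge0.
rewrite {}lC in h * => h2.
have E2 : 2 * l * (l * C) = 2 * (l ^+ 2 * C) by ring.
rewrite E2 in h; have h3 : l ^+ 2 * C <= (v *m A *m v^T) 0 0 by lra.
have -> : (l * C) ^+ 2 = C * (l ^+ 2 * C) by ring.
by rewrite ler_wpM2l// ltW.
Qed.

(** On a compact set the entries of the Gram matrix give the upper bound, and the diagonal of its
    inverse gives the lower one through [posdef_coord_le]. *)
Lemma gram_norm_equiv i (K : set 'rV[R]_n) : compact K -> K `<=` img i ->
  exists2 C : R, 0 < C & forall y (v : 'rV[R]_n), K y ->
    Num.sqrt ((v *m gram g i y *m v^T) 0 0) <= C * `|v| /\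
    `|v| <= C * Num.sqrt ((v *m gram g i y *m v^T) 0 0).
Proof.
move=> cK Ki.
have [|C1 C10 h1] := @continuous_le_compact R n K (fun y => \sum_k \sum_l `|gram g i y k l|) cK.
  move=> y /Ki iy; do 2 apply: continuous_at_sum => ?.
  by apply: continuous_comp; [exact: gram_continuous|exact: norm_continuous].
have [|C2 C20 h2] := @continuous_le_compact R n K (fun y => \sum_k `|invmx (gram g i y) k k|) cK.
  move=> y /Ki iy; apply: continuous_at_sum => k.
  by apply: continuous_comp; [exact: gram_inv_continuous|exact: norm_continuous].
exists (Num.sqrt (C1 + C2)) => [|y v Ky]; first by rewrite sqrtr_gt0 addr_gt0.
have iy := Ki y Ky; pose q := (v *m gram g i y *m v^T) 0 0.
have q0 : 0 <= q.
  rewrite /q; have [->|v0] := eqVneq v 0; first by rewrite !mul0mx mxE.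
  by rewrite ltW// gram_posdef.
have -> : (v *m gram g i y *m v^T) 0 0 = q by []. 
split.
  have -> : Num.sqrt (C1 + C2) * `|v| = Num.sqrt ((C1 + C2) * `|v| ^+ 2).
    by rewrite sqrtrM ?sqrtr_sqr ?normr_id// addr_ge0 ?ltW.
  apply: ler_wsqrtr.
  have := quadratic_form_le (gram g i y) (normr_ge0 v) (normr_ge0 v) (rV_norm_coord v) (rV_norm_coord v).
  rewrite -/q (ger0_norm q0) => /le_trans; apply; rewrite mulrC -expr2 ler_wpM2r ?sqr_ge0//.
  by apply: (le_trans (h1 y Ky)); rewrite lerDl ltW.
rewrite -sqrtrM; last by rewrite addr_ge0 ?ltW.
apply: rV_norm_le => [|k]; first exact: sqrtr_ge0.
rewrite -sqrtr_sqr; apply: ler_wsqrtr.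
apply: (@le_trans _ _ (C2 * q)); last by rewrite ler_wpM2r// lerDr ltW.
apply: posdef_coord_le => //; [exact: gram_sym|exact: gram_posdefW|].
apply: le_trans (h2 y Ky); rewrite (bigD1 k)//=; apply: (le_trans (ler_norm _)).
by rewrite lerDl sumr_ge0.
Qed.

Lemma speed_segment i y (v : 'rV[R]_n) (b t : R) : img i (y + (t - b) *: v) ->
  speed g (fun s => psi i (y + (s - b) *: v)) t =
  Num.sqrt ((v *m gram g i (y + (t - b) *: v) *m v^T) 0 0).
Proof.
move=> it; have [ce hd] := segment_C1_at it; have jt := dom_psi it.
have [D _] := hd i jt.
have e1 : derive1 (phi i \o (fun s => psi i (y + (s - b) *: v))) t = v.
  have cl : {for t, continuous (fun s : R => y + (s - b) *: v)}.
    apply: differentiable_continuous; apply: differentiableD => //; apply: differentiableZl.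
    by apply: differentiableB => //; exact: differentiable_cst.
  have E : \forall s \near t, (fun s => (s *: v + (y - b *: v))) s = (phi i \o (fun s => psi i (y + (s - b) *: v))) s.
    have nb : \forall s \near t, img i (y + (s - b) *: v).
      exact: (cl _ (open_nbhs_nbhs (conj (@img_open _ _ _ X i) it))).
    apply: filterS nb => s /= si.
    by rewrite phi_psi// scalerBl addrCA.
  rewrite derive1E -(near_eq_derive _ E).
  have did : derivable id (t *: v + (y - b *: v)) v by exact: derivable_id.
  have [_ ->] := line_is_derive did.
  exact: derive_id.
by rewrite (speed_chart jt ce (nbhs_singleton D)) e1 phi_psi.
Qed.

Section segment.
Variables (i : chart X) (K : set 'rV[R]_n) (C : R) (y v : 'rV[R]_n).
Hypotheses (Ki : K `<=` img i) (C0 : 0 <= C)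
  (gC : forall y (v : 'rV[R]_n), K y -> Num.sqrt ((v *m gram g i y *m v^T) 0 0) <= C * `|v|)
  (segK : forall t : R, 0 <= t <= 1 -> K (y + t *: v)).
Let e b := fun s : R => psi i (y + (s - b) *: v).

Let segi b t : b <= t <= b + 1 -> img i (y + (t - b) *: v).
Proof. by move=> tb; apply: Ki; apply: segK; lra. Qed.

Lemma segment_C1_on b : C1_on (X := X) b (b + 1) (e b).
Proof. by exists (e b) => t tb; split => //; apply: segment_C1_at; exact: segi. Qed.

Lemma segment_length b c : (forall t, b <= t <= b + 1 -> c t = e b t) ->
  (curve_length g b (b + 1) c <= (C * `|v|)%:E)%E.
Proof.
move=> ce.
have p : piecewise_C1 (X := X) c b (b + 1).
  apply: (@piecewise_C1_ext (e b)) => [|t tb]; last by rewrite ce.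
  by apply: piecewise_C1_one; [lra|exact: segment_C1_on].
have m := measurable_speed_piecewise p.
rewrite curve_length_oo//; last by lra.
set b1 := b + 1.
have mI : measurable (`]b, b1[ : set (measurableTypeR R)) by exact: measurable_itv.
apply: (@le_trans _ _ (\int[@lebesgue_measure R]_(t in `]b, b1[) (cst (C * `|v|)%:E t))%E).
  apply: ge0_le_integral => //.
  - by move=> t _; rewrite lee_fin speed_ge0.
  - exact/measurable_EFinP.
  - move=> t /=; rewrite in_itv/= => tb; rewrite /b1 in tb.
    have tb' : b <= t <= b + 1 by lra.
    have -> : speed g c t = speed g (e b) t.
      by apply: near_eq_speed; apply: (near_eq_itv tb) => s sb; rewrite ce.
    rewrite speed_segment ?lee_fin; last exact: segi.
    by apply: gC; apply: segK; lra.
have l1 : @lebesgue_measure R `]b, b1[%classic = 1%E.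
  by rewrite lebesgue_measure_itv/= /b1 lte_fin ltrDl ltr01 -EFinD addrAC subrr add0r.
rewrite integral_cst// -[leRHS]mule1; apply: lee_wpmul2l; first by rewrite lee_fin mulr_ge0.
by have /eqP := l1; rewrite eq_le => /andP[].
Qed.

Lemma dist_segment : (riemannian_dist g (psi i y) (psi i (y + v)) <= (C * `|v|)%:E)%E.
Proof.
apply: ge_ereal_inf; exists (curve_length g 0 (0 + 1) (e 0)); last exact: segment_length.
exists (e 0), 0, (0 + 1); split => //; rewrite /e.
- by apply: piecewise_C1_one; [lra|exact: segment_C1_on].
- by rewrite subrr scale0r addr0.
- by rewrite add0r subr0 scale1r.
Qed.

(* A curve from [z] to [psi i y] is prolonged by a straight segment of the chart. *)
Lemma dist_segment_triangle z :
  (riemannian_dist g z (psi i (y + v)) <= riemannian_dist g z (psi i y) + (C * `|v|)%:E)%E.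
Proof.
rewrite -leeBlDr//; apply: le_ereal_inf_tmp => _ [c [a [b [p ca cb ->]]]].
rewrite leeBlDr//; have ab := piecewise_C1_lt p.
pose c' t := if t <= b then c t else e b t.
have c'e t : b <= t <= b + 1 -> c' t = e b t.
  rewrite /c' => /andP[bt _]; case: ifPn => // tb.
  have -> : t = b by apply/eqP; rewrite eq_le tb bt.
  by rewrite cb /e subrr scale0r addr0.
have c'c t : t <= b -> c' t = c t by rewrite /c' => ->.
have p1 : piecewise_C1 (X := X) c' a b.
  by apply: (@piecewise_C1_ext c) => // t /andP[_ tb]; rewrite c'c.
have p2 : C1_on (X := X) b (b + 1) c'.
  have [f hf] := segment_C1_on b; exists f => t tb; have [e1 e2] := hf t tb.
  by rewrite c'e.
have bb : b < b + 1 by lra.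
apply: (@le_trans _ _ (curve_length g a (b + 1) c')).
  apply: ereal_inf_lbound; exists c', a, (b + 1); split.
  - exact: piecewise_C1_cat p1 bb p2.
  - by rewrite c'c ?(ltW ab).
  - rewrite c'e; first by rewrite /e addrAC subrr add0r scale1r.
    by rewrite lexx (ltW bb).
  - exact: erefl.
rewrite (curve_length_cat p1 bb p2); apply: leeD; last exact: (segment_length c'e).
rewrite (curve_length_oo ab (measurable_speed_piecewise p)) (curve_length_oo ab (measurable_speed_piecewise p1)).
rewrite le_eqVlt; apply/orP; left; apply/eqP; apply: eq_integral => t; rewrite inE/= in_itv/= => tab.
have c'ab s : a <= s <= b -> c' s = c s by move=> /andP[_ sb]; exact: c'c.
by rewrite (near_eq_speed (near_eq_itv tab c'ab)).
Qed.
End segment.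
End speed.

(** * Lower bounds for the distance *)

Section distance_lower.
Context {R : realType} {n : nat} {M : ptopologicalType} {X : closed_manifold R n M}.
Variable g : riemannian_metric X.

Lemma curve_length_ge0 a b (c : R -> M) : (0 <= curve_length g a b c)%E.
Proof. by apply: integral_ge0 => t _; rewrite lee_fin speed_ge0. Qed.

Lemma riemannian_dist_ge0 x y : (0 <= riemannian_dist g x y)%E.
Proof. by apply: le_ereal_inf_tmp => _ [c [a [b [_ _ _ ->]]]]; exact: curve_length_ge0. Qed.

(** Both A S - u and A S + u are nondecreasing. Here [S] stands for arc length and [sp] for the
    speed. *)
Lemma variation_le (u S sp : R -> R) (A a b : R) : a < b ->
  {within `[a, b], continuous S} -> {within `[a, b], continuous u} ->
  (forall t, t \in `]a, b[ -> derivable S t 1 /\ derive1 S t = sp t) ->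
  (forall t, t \in `]a, b[ -> derivable u t 1 /\ `|derive1 u t| <= A * sp t) ->
  `|u b - u a| <= A * (S b - S a).
Proof.
move=> ab cS cu dS du.
have main (w : R) : `|w| = 1 -> A * S a - w * u a <= A * S b - w * u b.
  move=> w1.
  have d t : t \in `]a, b[ -> is_derive t (1 : R) (A \*: S - w \*: u) (A *: sp t - w *: derive1 u t).
    move=> tab; have [d1 e1] := dS t tab; have [d2 _] := du t tab.
    have D1 : is_derive t 1 S (sp t) by apply: DeriveDef => //; rewrite -derive1E.
    have D2 : is_derive t 1 u (derive1 u t) by apply: DeriveDef => //; rewrite -derive1E.
    exact: is_deriveB.
  apply: (@ger0_derive1_le_cc _ (A \*: S - w \*: u) a b); rewrite ?in_itv/= ?lexx ?ltW//.
  - by move=> t /d[].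
  - move=> t tab; have [_ e2] := du t tab; rewrite derive1E; have [_ ->] := d t tab.
    rewrite subr_ge0; apply: le_trans e2; apply: (le_trans (ler_norm _)).
    by rewrite normrM w1 mul1r.
  - by move=> t; apply: cvgB; apply: cvgZr; [exact: cS|exact: cu].
have h1 := main 1 (normr1 _); have h2 := main (-1); rewrite normrN1 in h2; have {}h2 := h2 erefl.
by rewrite ler_norml; lra.
Qed.

Section variation.
Variables (j : chart X) (K : set 'rV[R]_n) (G : 'rV[R]_n -> R) (L C : R).
Hypotheses (cK : compact K) (Kj : K `<=` img j).
Hypotheses (dG : forall y, differentiable G y) (L0 : 0 < L) (C0 : 0 < C)
  (GL : forall y z, `|G y - G z| <= L * `|y - z|) (G0 : forall y, ~ K y -> G y = 0)
  (gC : forall y (v : 'rV[R]_n), K y -> `|v| <= C * Num.sqrt ((v *m gram g j y *m v^T) 0 0)).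
Let f := extend0 j G.

(** Where the curve meets the image of [K] this is the chain rule with the comparison of norms;
    elsewhere the composite vanishes on a neighbourhood, because the image of [K] is closed. *)
Lemma extend0_curve (e : R -> M) t : C1_at (X := X) e t ->
  derivable (f \o e) t 1 /\ `|derive1 (f \o e) t| <= L * C * speed g e t.
Proof.
move=> he; have [ce hi] := he.
have [[y Ky yE]|nK] := pselect ((psi j @` K) (e t)).
  have jt : dom j (e t) by rewrite -yE; apply: dom_psi; exact: Kj.
  have Kt : K (phi j (e t)) by rewrite -yE phi_psi//; exact: Kj.
  have dd : derivable (phi j \o e) t 1 by have [D _] := hi j jt; exact: (nbhs_singleton D).
  have df1 : differentiable (phi j \o e) t by apply/derivable1_diffP.
  have dGt : differentiable G ((phi j \o e) t) by exact: dG.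
  have E : \forall s \near t, (G \o (phi j \o e)) s = (f \o e) s.
    by apply: filterS (near_in_chart ce jt) => s js; rewrite /= /f extend0_dom.
  have dc : differentiable (G \o (phi j \o e)) t by exact: differentiable_comp.
  split; first by apply/derivable1_diffP; exact: (near_eq_differentiable E).
  rewrite derive1E -(near_eq_derive _ E) deriveE// diff_comp//= -(deriveE _ df1) -(deriveE _ dGt) -derive1E.
  apply: (@le_trans _ _ (L * `|derive1 (phi j \o e) t|)).
    by apply: derive_lipschitz => //; exact: diff_derivable.
  by rewrite -mulrA; apply: ler_wpM2l; [exact: ltW|rewrite (speed_chart g jt ce dd); exact: gC].
have E : \forall s \near t, (f \o e) s = 0.
  have oC : open (~` (psi j @` K)) by apply: closed_openC; exact: closed_psi_image.
  have nb : \forall s \near t, (~` (psi j @` K)) (e s) by apply: ce; exact: open_nbhs_nbhs (conj oC nK).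
  by apply: filterS nb => s nKs; apply: extend0_supp nKs.
split; last by rewrite derive1E near0_derive// normr0 !mulr_ge0 ?speed_ge0 ?ltW.
apply/derivable1_diffP; apply: (@near_eq_differentiable _ _ _ (cst 0)); last exact: differentiable_cst.
by apply: filterS E => s ->.
Qed.

Lemma extend0_variation (e : R -> M) a b : a < b -> (forall t, a <= t <= b -> C1_at (X := X) e t) ->
  (`|f (e b) - f (e a)|%:E <= (L * C)%:E * curve_length g a b e)%E.
Proof.
move=> ab he; pose sp : R -> R := speed g e; pose A := L * C; pose u := f \o e.
have csp : {within `[a, b], continuous sp}.
  by apply: continuous_in_subspaceT => t; rewrite inE/= in_itv/= => /he; exact: speed_continuous.
have isp : (@lebesgue_measure R).-integrable `[a, b] (EFin \o sp).
  by apply: continuous_compact_integrable => //; exact: segment_compact.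
pose S x := parameterized_integral (@lebesgue_measure R) a x sp.
have cS : {within `[a, b], continuous S} by apply: parameterized_integral_continuous => //; exact: ltW.
have dS t : t \in `]a, b[ -> derivable S t 1 /\ derive1 S t = sp t.
  rewrite in_itv/= => /andP[at_ tb]; apply: (@continuous_FTC1_closed _ sp a t b) => //.
  by apply: speed_continuous; apply: he; rewrite !ltW.
have cu : {within `[a, b], continuous u}.
  apply: continuous_in_subspaceT => t; rewrite inE/= in_itv/= => /he/extend0_curve[d _].
  by apply: differentiable_continuous; exact/derivable1_diffP.
have du t : t \in `]a, b[ -> derivable u t 1 /\ `|derive1 u t| <= A * sp t.
  by rewrite in_itv/= => /andP[at_ tb]; apply: extend0_curve; apply: he; rewrite !ltW.
have S0 : S a = 0 by rewrite /S /parameterized_integral set_itv1 Rintegral_set1.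
have := variation_le ab cS cu dS du; rewrite S0 subr0 => bnd.
have -> : (curve_length g a b e = (S b)%:E)%E.
  rewrite /S /parameterized_integral /Rintegral fineK//; exact: integrable_fin_num.
by rewrite -EFinM lee_fin.
Qed.

Lemma extend0_piecewise_variation c a b : piecewise_C1 (X := X) c a b ->
  (`|f (c b) - f (c a)|%:E <= (L * C)%:E * curve_length g a b c)%E.
Proof.
have one a' b' : a' < b' -> C1_on (X := X) a' b' c ->
    (`|f (c b') - f (c a')|%:E <= (L * C)%:E * curve_length g a' b' c)%E.
  move=> ab C1; have [e he] := C1.
  have [ea _] : e a' = c a' /\ C1_at (X := X) e a' by apply: he; rewrite lexx ltW.
  have [eb _] : e b' = c b' /\ C1_at (X := X) e b' by apply: he; rewrite lexx ltW.
  have pe : piecewise_C1 (X := X) e a' b'.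
    by apply: piecewise_C1_one => //; exists e => t /he[].
  have -> : curve_length g a' b' c = curve_length g a' b' e.
    rewrite (curve_length_oo ab (measurable_speed_piecewise g (piecewise_C1_one ab C1))).
    rewrite (curve_length_oo ab (measurable_speed_piecewise g pe)).
    apply: eq_integral => t; rewrite inE/= in_itv/= => tab.
    have ce s : a' <= s <= b' -> c s = e s by move=> /he[].
    by rewrite (near_eq_speed g (near_eq_itv tab ce)).
  by rewrite -ea -eb; apply: extend0_variation => // t /he[].
elim => {a b} [a b ab C1|a d b p IH db C1]; first exact: one.
rewrite (curve_length_cat g p db C1) ge0_muleDr ?curve_length_ge0//.
apply: (@le_trans _ _ (`|f (c d) - f (c a)| + `|f (c b) - f (c d)|)%:E).
  rewrite lee_fin; have -> : f (c b) - f (c a) = (f (c d) - f (c a)) + (f (c b) - f (c d)) by ring.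
  exact: ler_normD.
by rewrite EFinD; apply: leeD => //; exact: one.
Qed.

(** Every curve from [z] to [x] must be long enough to account for the change of [f], which varies
    at rate at most [L * C] per unit of length. *)
Lemma extend0_dist z x : ((`|f x - f z| / (L * C))%:E <= riemannian_dist g z x)%E.
Proof.
have A0 : 0 < L * C by rewrite mulr_gt0.
apply: le_ereal_inf_tmp => _ [c [a [b [p <- <- ->]]]].
rewrite mulrC EFinM lee_pdivrMl//; exact: extend0_piecewise_variation.
Qed.
End variation.

(* Along a curve leaving the ball of radius [s], a Lipschitz bump of height of order
   [s] supported in that ball varies by its height. *)
Lemma dist_ge (j : chart X) p r : 0 < r -> [set y | `|p - y| <= r] `<=` img j ->
  exists2 c : R, 0 < c & forall (z : M) (s : R), dom j z -> 0 < s -> `|p - phi j z| + s <= r ->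
    forall x, ~ (dom j x /\ `|phi j z - phi j x| < s) -> ((c * s)%:E <= riemannian_dist g z x)%E.
Proof.
move=> r0 Kj; have cK := @rV_closed_ball_compact R n p r.
have [C C0 gC] := gram_norm_equiv g cK Kj.
(* The bump has height s/2, and its differentiable approximation is within s/8 of it, hence at least
   3s/8 at the centre; its support has radius at most s/2 + s/8, below [s]. *)
exists (3 / 8 / C) => [|z s jz s0 zs x nx]; first by rewrite !divr_gt0.
pose q := phi j z; pose F y := Num.max 0 (s / 2 - `|q - y|).
have FL y y' : `|F y - F y'| <= 1 * `|y - y'|.
  rewrite mul1r; have h : `| `|q - y| - `|q - y'| | <= `|y - y'|.
    apply: (le_trans (ler_dist_dist _ _)); have -> : q - y - (q - y') = y' - y by rewrite opprB addrC addrA subrK.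
    by rewrite distrC.
  apply: le_trans h; rewrite /F; move: (`|q - y|) (`|q - y'|) => a b.
  by case: (lerP 0 (s / 2 - a)) => ?; case: (lerP 0 (s / 2 - b)) => ?; rewrite ler_norml;
    case: (lerP 0 (a - b)) => ?; [rewrite ger0_norm//|rewrite ltr0_norm//|rewrite ger0_norm//|rewrite ltr0_norm//|rewrite ger0_norm//|rewrite ltr0_norm//|rewrite ger0_norm//|rewrite ltr0_norm//]; lra.
have F0 y : s / 2 <= `|q - y| -> F y = 0 by move=> ?; rewrite /F max_l//; lra.
have [G [_ [dG [GL [GF [G0 _]]]]]] := lipschitz_gradient (divr_gt0 s0 (ltr0Sn R 1)) ler01 FL F0.
have [m _ hm] := near_infty_natSinv_lt (PosNum (divr_gt0 s0 (ltr0Sn R 7))).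
have {hm}mS : m.+1%:R^-1 < s / 8 := hm m (leqnn m).
have GK y : ~ [set y | `|p - y| <= r] y -> G m y = 0.
  move=> /= /negP; rewrite -ltNge => yr; apply: G0.
  have := ler_distD q p y; move: mS zs yr; rewrite -/q; move: (m.+1%:R^-1) => a; lra.
have := extend0_dist cK Kj (dG m) ltr01 C0 (GL m) GK (fun y v Ky => (gC y v Ky).2) z x.
apply: le_trans; rewrite lee_fin mul1r mulrAC ler_pM2r ?invr_gt0//.
have -> : extend0 j (G m) x = 0.
  rewrite /extend0; case: ifPn => //; rewrite inE => jx; apply: G0.
  have : ~ `|phi j z - phi j x| < s by move=> h; apply: nx.
  move=> /negP; rewrite -leNgt -/q; move: mS; move: (m.+1%:R^-1) => a; lra.
rewrite extend0_dom// sub0r normrN; apply: le_trans (ler_norm _).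
have Fq : F q = s / 2 by rewrite /F subrr normr0 subr0 max_r//; lra.
have := GF m q; rewrite mul1r ler_norml Fq.
rewrite -/q; move: mS; move: (m.+1%:R^-1) => a ? /andP[? _]; lra.
Qed.
End distance_lower.

(** * Locally Lipschitz functions *)

Section lip_at.
Context {R : realType} {V : normedModType R}.
Implicit Types (u v : V -> R) (x y z : V).

(** Both points range over a ball around [x], which makes the property stable under products and
    composition; a global constant is extracted only in [lip_at_global]. *)
Definition lip_at u x := exists L e : R, [/\ 0 < e, 0 <= L &
  forall y z, `|x - y| < e -> `|x - z| < e -> `|u y - u z| <= L * `|y - z|].

Lemma lip_at_near u v x : (\forall y \near x, u y = v y) -> lip_at u x -> lip_at v x.
Proof.
move=> /nbhs_normP[d /= d0 hd] [L [e [e0 L0 h]]]; exists L, (Num.min d e).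
split => // [|y z]; first by rewrite lt_min d0.
rewrite !lt_min => /andP[yd ye] /andP[zd ze].
by rewrite -(hd y yd) -(hd z zd); exact: h.
Qed.

Lemma lip_at_continuous u x : lip_at u x -> {for x, continuous u}.
Proof.
move=> [L [e [e0 L0 h]]]; apply/cvgrPdist_lt => d d0.
have L1 : 0 < L + 1 by rewrite ltr_wpDl.
near=> y; have xy : `|x - y| < e by near: y; apply: cvgr_dist_lt.
have xy2 : `|x - y| < d / (L + 1) by near: y; apply: cvgr_dist_lt => //; rewrite divr_gt0.
apply: (le_lt_trans (h x y _ xy)); first by rewrite subrr normr0.
apply: (@le_lt_trans _ _ ((L + 1) * `|x - y|)); first by rewrite ler_wpM2r// lerDl.
by rewrite mulrC -ltr_pdivlMr.
Unshelve. all: by end_near.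
Qed.

Lemma lip_at_cst (a : R) x : lip_at (cst a) x.
Proof. by exists 0, 1; split => // y z _ _; rewrite subrr normr0 mul0r. Qed.

Lemma lip_atD u v x : lip_at u x -> lip_at v x -> lip_at (fun y => u y + v y) x.
Proof.
move=> [L [e [e0 L0 h]]] [L' [e' [e'0 L'0 h']]]; exists (L + L'), (Num.min e e').
split; [by rewrite lt_min e0|by rewrite addr_ge0|] => y z.
rewrite !lt_min => /andP[ye ye'] /andP[ze ze']; rewrite mulrDl.
have -> : u y + v y - (u z + v z) = (u y - u z) + (v y - v z) by ring.
by apply: (le_trans (ler_normD _ _)); apply: lerD; [exact: h|exact: h'].
Qed.

Lemma lip_at_bounded u x : lip_at u x ->
  exists B e : R, [/\ 0 < e, 0 <= B & forall y, `|x - y| < e -> `|u y| <= B].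
Proof.
move=> [L [e [e0 L0 h]]]; exists (`|u x| + L * e), e.
split => // [|y xy]; first by rewrite addr_ge0// mulr_ge0// ltW.
have := h x y _ xy; rewrite subrr normr0 => /(_ e0) h1.
rewrite -lerBlDl; apply: (le_trans (lerB_dist _ _)); rewrite distrC; apply: (le_trans h1).
by rewrite ler_wpM2l// ltW.
Qed.

Lemma lip_atM u v x : lip_at u x -> lip_at v x -> lip_at (fun y => u y * v y) x.
Proof.
move=> lu lv; have [B [b [b0 B0 hB]]] := lip_at_bounded lu.
have [B' [b' [b'0 B'0 hB']]] := lip_at_bounded lv.
case: lu => [L [e [e0 L0 h]]]; case: lv => [L' [e' [e'0 L'0 h']]].
exists (B * L' + L * B'), (Num.min (Num.min e e') (Num.min b b')).
split; [by rewrite !lt_min e0 e'0 b0|by rewrite addr_ge0 ?mulr_ge0|] => y z.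
rewrite !lt_min => /andP[/andP[y1 y2] /andP[y3 y4]] /andP[/andP[z1 z2] /andP[z3 z4]].
have -> : u y * v y - u z * v z = u y * (v y - v z) + (u y - u z) * v z by ring.
apply: (le_trans (ler_normD _ _)); rewrite !normrM mulrDl; apply: lerD.
  by rewrite -mulrA; apply: ler_pM => //; [exact: hB|exact: h'].
by rewrite mulrAC; apply: ler_pM => //; [exact: h|exact: hB'].
Qed.

Lemma lip_at_sum (I : Type) (s : seq I) (u : I -> V -> R) x : (forall i, lip_at (u i) x) ->
  lip_at (fun y => \sum_(i <- s) u i y) x.
Proof.
move=> h; elim: s => [|i s IH].
  by have -> : (fun y => \sum_(i <- [::]) u i y) = cst 0; [apply/funext => y; rewrite big_nil|exact: lip_at_cst].
have -> : (fun y => \sum_(j <- i :: s) u j y) = (fun y => u i y + \sum_(j <- s) u j y).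
  by apply/funext => y; rewrite big_cons.
exact: lip_atD.
Qed.

Lemma lip_atX u x k : lip_at u x -> lip_at (fun y => u y ^+ k) x.
Proof.
move=> lu; elim: k => [|k IH]; first exact: lip_at_cst.
have -> : (fun y => u y ^+ k.+1) = (fun y => u y * u y ^+ k) by apply/funext => y; rewrite exprS.
exact: lip_atM.
Qed.
End lip_at.

Section lip_at_comp.
Context {R : realType}.

Lemma lip_at_comp (V : normedModType R) (b : R -> R) (u : V -> R) x :
  lip_at b (u x) -> lip_at u x -> lip_at (fun y => b (u y)) x.
Proof.
move=> [L' [e' [e'0 L'0 h']]] lu; have cu := lip_at_continuous lu.
have hu : \forall y \near x, `|u x - u y| < e' by move/cvgrPdist_lt : cu; exact.
have /nbhs_normP[d /= d0 hd] := hu.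
case: lu => [L [e [e0 L0 h]]]; exists (L' * L), (Num.min d e).
split; [by rewrite lt_min d0|by rewrite mulr_ge0|] => y z.
rewrite !lt_min => /andP[yd ye] /andP[zd ze]; rewrite -mulrA.
apply: (le_trans (h' _ _ (hd y yd) (hd z zd))).
by apply: ler_wpM2l => //; exact: h.
Qed.

Lemma lip_at_inv (r : R) : r != 0 -> lip_at (@GRing.inv R) r.
Proof.
move=> r0; have n0 : 0 < `|r| by rewrite normr_gt0.
exists ((`|r| / 2) ^- 2), (`|r| / 2); split; [by rewrite divr_gt0|by rewrite invr_ge0 sqr_ge0|].
have P (y : R) : `|r - y| < `|r| / 2 -> `|r| / 2 < `|y|.
  by have := lerB_dist r y; lra.
move=> y z /P yr /P zr; have y0 : 0 < `|y| by lra.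
have z0 : 0 < `|z| by lra.
have -> : y^-1 - z^-1 = (z - y) * (y * z)^-1.
  by field; rewrite -!normr_gt0 y0 z0.
rewrite normrM distrC mulrC normfV normrM ler_wpM2r// lef_pV2 ?posrE ?mulr_gt0 ?exprn_gt0 ?divr_gt0//.
by rewrite expr2 ler_pM ?divr_ge0 ?ltW.
Qed.

Lemma lip_at_sqrt (r : R) : 0 < r -> lip_at (@Num.sqrt R) r.
Proof.
move=> r0; have s0 : 0 < Num.sqrt r by rewrite sqrtr_gt0.
have s2 : 0 < Num.sqrt (r / 2) by rewrite sqrtr_gt0 divr_gt0.
exists (Num.sqrt (r / 2))^-1, (r / 2); split; [by rewrite divr_gt0|by rewrite invr_ge0 ltW|].
have P (y : R) : `|r - y| < r / 2 -> r / 2 <= y by rewrite ltr_norml; lra.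
move=> y z /P yr /P zr; have y0 : 0 <= y by lra.
have z0 : 0 <= z by lra.
rewrite mulrC ler_pdivlMr// -{2}(sqr_sqrtr y0) -{2}(sqr_sqrtr z0) subr_sqr normrM.
apply: ler_wpM2l => //; rewrite ger0_norm ?addr_ge0 ?sqrtr_ge0//.
by apply: (@le_trans _ _ (Num.sqrt y)); [exact: ler_wsqrtr|rewrite lerDl sqrtr_ge0].
Qed.

Lemma lip_at_max0 (r : R) : lip_at (fun t : R => Num.max 0 t) r.
Proof.
exists 1, 1; split => // y z _ _; rewrite mul1r.
case: (lerP 0 y) => hy; case: (lerP 0 z) => hz; rewrite ?subrr ?normr0//.
  by rewrite subr0 !ger0_norm//; lra.
by rewrite sub0r normrN distrC !ger0_norm//; lra.
Qed.

(** Compactness turns the local data into one index N serving both as Lipschitz constant and,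
    through the radius 1/(N+1), as scale. Pairs further apart are handled by boundedness of [F], and
    pairs outside the ball by its vanishing. *)
Lemma lip_at_global n (F : 'rV[R]_n -> R) p s : (forall y, lip_at F y) ->
  (forall y, s <= `|p - y| -> F y = 0) ->
  exists2 L : R, 0 <= L & forall y z, `|F y - F z| <= L * `|y - z|.
Proof.
move=> lF F0; pose K := [set y | `|p - y| <= s].
have cK : compact K by exact: rV_closed_ball_compact.
have [B hB] : exists B : R, forall y, K y -> `|F y| <= B.
  apply: locally_bounded_compact => // y _; have [B [e [e0 B0 h]]] := lip_at_bounded (lF y).
  by exists B; apply/nbhs_normP; exists e.
have nc := (compact_near_coveringP K).1 cK nat \oo
  (fun m y => forall z, `|y - z| < m.+1%:R^-1 -> `|F y - F z| <= m%:R * `|y - z|) _.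
have [|N _ hN] := nc.
  move=> y Ky; have [L [e [e0 L0 h]]] := lF y.
  have e2 : 0 < e / 2 by rewrite divr_gt0.
  have [N1 _ hN1] := near_infty_natSinv_lt (PosNum e2).
  pose N2 := (Num.truncn L).+1.
  exists ([set z | `|y - z| < e / 2], [set m | (maxn N1 N2 <= m)%N]).
    have nb : nbhs y [set z | `|y - z| < e / 2] by apply/nbhs_ballP; exists (e / 2) => // z; rewrite rV_ballE.
    by split; [exact: nb|exists (maxn N1 N2)].
  move=> [z m] /= [yz]; rewrite geq_max => /andP[Nm1 Nm2] w zw.
  have m1 : m.+1%:R^-1 < e / 2 := hN1 m Nm1.
  have yw : `|y - w| < e.
    by have := ler_distD z y w; move: m1 zw; move: (m.+1%:R^-1) => a; lra.
  apply: (@le_trans _ _ (L * `|z - w|)); first by apply: h => //; lra.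
  apply: ler_wpM2r => //; apply: (@le_trans _ _ (N2%:R : R)); last by rewrite ler_nat.
  by apply: ltW; exact: truncnS_gt.
have {}hN := hN N (leqnn N).
pose d : R := N.+1%:R^-1; have d0 : 0 < d by rewrite invr_gt0.
pose L := N%:R + (`|B| + `|B|) / d.
have B2 : 0 <= (`|B| + `|B|) / d by rewrite divr_ge0 ?addr_ge0// ltW.
have FB y : `|F y| <= `|B|.
  have [ys|ys] := leP `|p - y| s; first by apply: (le_trans (hB y ys)); exact: ler_norm.
  by rewrite F0 ?normr0// ltW.
have KL y z : K y -> `|F y - F z| <= L * `|y - z|.
  move=> Ky; have [yz|yz] := ltP `|y - z| d.
    apply: (le_trans (hN y Ky z yz)); rewrite ler_wpM2r// lerDl//.
  apply: (@le_trans _ _ (`|B| + `|B|)).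
    by apply: (le_trans (ler_normB _ _)); exact: lerD.
  apply: (@le_trans _ _ ((`|B| + `|B|) / d * `|y - z|)); last by rewrite ler_wpM2r// lerDr.
  by rewrite mulrAC ler_pdivlMr// ler_wpM2l// addr_ge0.
exists L => [|y z]; first by rewrite addr_ge0.
have [ys|ys] := leP `|p - y| s; first exact: KL.
have [zs|zs] := leP `|p - z| s; first by rewrite distrC (distrC y); exact: KL.
rewrite (F0 _ (ltW ys)) (F0 _ (ltW zs)) subrr normr0; apply: mulr_ge0 => //; exact: addr_ge0.
Qed.
End lip_at_comp.

Section test_integrals.
Context {R : realType} {n : nat}.
Implicit Types (U K : set 'rV[R]_n) (f h : 'rV[R]_n -> R).

Lemma test_function_partial U h k : test_function U h -> test_function U (partial k h).
Proof.
move=> [sh [K [cK KU h0]]]; split.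
  move=> s y _; have -> : iter_partial s (partial k h) = iter_partial (rcons s k) h.
    by rewrite /iter_partial foldr_rcons.
  exact: sh.
by exists K; split => //; exact: support_partial.
Qed.

Lemma test_function_continuous U h : test_function U h -> continuous h.
Proof.
by move=> [sh _] y; apply: differentiable_continuous; exact: (smooth_on_differentiable sh).
Qed.

Lemma loc_integrable_continuous U f : open U -> (forall y, U y -> {for y, continuous f}) ->
  loc_integrable U f.
Proof.
move=> oU cf; have mf := borel_continuous_on oU cf; split => // K cK KU.
have cK' : closed K by apply: compact_closed => //; exact: norm_hausdorff.
have [C hC] := continuous_bounded_compact cK (fun y Ky => cf y (KU y Ky)).
apply: (@bounded_integrable _ _ _ _ _ _ C) => //.
- exact: borel_closed.
- have [s s0 hs] := compact_rV_bounded cK; apply: le_lt_trans (leb_rV_ball_lty (0 : 'rV[R]_n) s0).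
  apply: le_measure; rewrite ?inE; [exact: borel_closed|by apply: borel_open; exact: ball_open|].
  by move=> y Ky; rewrite rV_ballE ltNge; apply/negP => /hs.
- by apply: measurable_funS mf; [exact: borel_open|].
Qed.

Lemma loc_integrable_test U f h : open U -> loc_integrable U f -> test_function U h ->
  (leb_rV n).-integrable (U : set (borel 'rV[R]_n)) (EFin \o (fun y => f y * h y)).
Proof.
move=> oU [mf fi] th; have ch := test_function_continuous th; case: th => [sh [K [cK KU h0]]].
have cK' : closed K by apply: compact_closed => //; exact: norm_hausdorff.
have mK : measurable (K : set (borel 'rV[R]_n)) by exact: borel_closed.
have mU : measurable (U : set (borel 'rV[R]_n)) by exact: borel_open.
have [C C0 hC] := continuous_bounded_support cK ch h0.
have mh : measurable_fun (K : set (borel 'rV[R]_n)) (h : borel 'rV[R]_n -> R).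
  by apply: measurable_funTS; exact: borel_continuousR.
have bh : [bounded h x | x in K].
  by exists C; split; [exact: num_real|move=> r Cr x _; apply: le_trans (hC x) (ltW Cr)].
have := integrableMl mK (fi K cK KU) mh bh; move/(integrable_mkcond _ mK) => hK.
apply/(integrable_mkcond _ mU); move: hK; congr ((leb_rV n).-integrable setT _).
apply/funext => y; rewrite !patchE; case: ifPn => [|]; case: ifPn => //.
- by rewrite notin_setE => nU; rewrite inE => /KU.
- by move=> _; rewrite notin_setE => nK; rewrite /= h0// mulr0.
Qed.
End test_integrals.

(** * Locally Lipschitz functions belong to the Sobolev space *)

Section sobolev_lipschitz.
Context {R : realType} {n : nat} {M : ptopologicalType} {X : closed_manifold R n M}.
Variables (g : riemannian_metric X) (vol : {measure set (borel M) -> \bar R}).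
Hypothesis hv : riemannian_volume g vol.
Implicit Types (u v : M -> R) (i j : chart X) (y : 'rV[R]_n) (x z : M).

Lemma weak_gradientD u v (w w' : chart X -> 'rV[R]_n -> 'rV[R]_n) : continuous u -> continuous v ->
  weak_gradient u w -> weak_gradient v w' ->
  weak_gradient (fun x => u x + v x) (fun i y => w i y + w' i y).
Proof.
move=> cu cv hu hv' i k; have [lw tw] := hu i k; have [lw' tw'] := hv' i k.
have oi := @img_open _ _ _ X i.
have mi : measurable (img i : set (borel 'rV[R]_n)) by exact: borel_open.
have cpsi (f : M -> R) : continuous f -> loc_integrable (img i) (fun y => f (psi i y)).
  move=> cf; apply: loc_integrable_continuous => // y iy.
  by apply: continuous_comp; [exact: psi_continuous|exact: cf].
split.
  have E : (fun y => (w i y + w' i y) 0 k) = (fun y => w i y 0 k + w' i y 0 k).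
    by apply/funext => y; rewrite mxE.
  rewrite E; case: lw => m1 i1; case: lw' => m2 i2; split; first exact: measurable_funD.
  move=> K cK Ki; have mK : measurable (K : set (borel 'rV[R]_n)).
    by apply: borel_closed; apply: compact_closed => //; exact: norm_hausdorff.
  exact: (integrableD mK (i1 K cK Ki) (i2 K cK Ki)).
move=> h th; have thk := test_function_partial k th.
have -> : (fun y => (u (psi i y) + v (psi i y)) * partial k h y) =
    (fun y => u (psi i y) * partial k h y + v (psi i y) * partial k h y).
  by apply/funext => y; rewrite mulrDl.
have -> : (fun y => (w i y + w' i y) 0 k * h y) =
    (fun y => w i y 0 k * h y + w' i y 0 k * h y).
  by apply/funext => y; rewrite mxE mulrDl.
rewrite !RintegralD//; try exact: loc_integrable_test.
- by rewrite tw// tw'// opprD.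
- by apply: loc_integrable_test => //; exact: cpsi.
- by apply: loc_integrable_test => //; exact: cpsi.
Qed.

Lemma grad_innerD_le (w w' : chart X -> 'rV[R]_n -> 'rV[R]_n) x :
  grad_inner g (fun i y => w i y + w' i y) (fun i y => w i y + w' i y) x <=
  2 * grad_inner g w w x + 2 * grad_inner g w' w' x.
Proof.
have := grad_inner_ge0 g (fun i y => w i y - w' i y) x.
rewrite /grad_inner; have [i [-> ix]] := pick_dom (X := X) x.
set A := invmx _; move: (w i _) (w' i _) => a b.
have -> : (a - b)^T = a^T - b^T by rewrite linearB.
have -> : (a + b)^T = a^T + b^T by rewrite linearD.
rewrite !mulmxBl !mulmxDl !mulmxBr !mulmxDr.
by move: (a *m A *m a^T) (b *m A *m b^T) (a *m A *m b^T) (b *m A *m a^T) => A1 A2 A3 A4; rewrite !mxE; lra.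
Qed.

Lemma L2_gradientD u v (w w' : chart X -> 'rV[R]_n -> 'rV[R]_n) : continuous u -> continuous v ->
  L2_gradient g vol u w -> L2_gradient g vol v w' ->
  L2_gradient g vol (fun x => u x + v x) (fun i y => w i y + w' i y).
Proof.
move=> cu cv [gu Eu] [gv Ev]; split; first exact: weak_gradientD.
have m1 : measurable_fun setT (grad_inner g w w : borel M -> R).
  by apply: measurable_grad_inner => i k; have [[]] := gu i k.
have m2 : measurable_fun setT (grad_inner g w' w' : borel M -> R).
  by apply: measurable_grad_inner => i k; have [[]] := gv i k.
have m3 : measurable_fun setT (grad_inner g (fun i y => w i y + w' i y) (fun i y => w i y + w' i y) : borel M -> R).
  by apply: measurable_grad_inner => i k; have [[]] := weak_gradientD cu cv gu gv i k.
apply: (@le_lt_trans _ _ (\int[vol]_x (2%:E * (grad_inner g w w x)%:E + 2%:E * (grad_inner g w' w' x)%:E))%E).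
  apply: ge0_le_integral => //.
  - by move=> x _; rewrite lee_fin grad_inner_ge0.
  - exact/measurable_EFinP.
  - by apply: emeasurable_funD; apply: measurable_funeM; exact/measurable_EFinP.
  - by move=> x _; rewrite -!EFinM -EFinD lee_fin grad_innerD_le.
rewrite ge0_integralD//; first last.
- by apply: measurable_funeM; exact/measurable_EFinP.
- by move=> x _; rewrite mule_ge0// lee_fin grad_inner_ge0.
- by apply: measurable_funeM; exact/measurable_EFinP.
- by move=> x _; rewrite mule_ge0// lee_fin grad_inner_ge0.
rewrite !ge0_integralZl//; try by [apply/measurable_EFinP|move=> x _; rewrite lee_fin grad_inner_ge0].
by apply: lte_add_pinfty; rewrite lte_mul_pinfty.
Qed.

Lemma Lfun_bounded (u : borel M -> R) (B : R) : measurable_fun setT u -> (forall x, `|u x| <= B) ->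
  u \in Lfun vol 2%:E /\ u \in Lfun vol +oo%E.
Proof.
move=> mu uB; have fin := vol_lty hv.
have B0 : 0 <= B by exact: le_trans (uB point).
have mum : u \in mfun by rewrite inE.
have ui : u \in Lfun vol +oo%E.
  rewrite inE; apply/andP; split => //; rewrite inE /= /finite_norm unlock /=.
  case: ifP => // _; apply: (@le_lt_trans _ _ B%:E); last exact: ltry.
  by apply/ess_sup_inf.ess_supP; apply: aeW => x /=; rewrite lee_fin.
split => //; apply: (@Lfun_subset _ _ _ vol 2%:E +oo%E) ui => //.
- by rewrite lee_fin ler1n.
- by rewrite leey.
- by rewrite ge0_fin_numE.
- by rewrite leey.
Qed.

Definition lip_chart (u : M -> R) := forall i y, img i y -> lip_at (fun y : 'rV[R]_n => u (psi i y)) y.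

Lemma lip_chart_continuous u : lip_chart u -> continuous u.
Proof.
move=> lu x; have [i ix] := chart_cover X x; have ip := img_phi ix.
have cu : {for x, continuous ((fun y => u (psi i y)) \o phi i)}.
  by apply: continuous_comp; [exact: phi_continuous|exact: lip_at_continuous (lu i _ ip)].
have E : \forall z \near x, ((fun y => u (psi i y)) \o phi i) z = u z.
  by have := open_nbhs_nbhs (conj (dom_open i) ix); apply: filterS => z iz /=; rewrite psi_phi.
suff : u @ x --> u x by [].
by rewrite -(nbhs_singleton E); apply: cvg_trans cu; exact: near_eq_cvg.
Qed.

Lemma continuous_manifold_bounded u : continuous u -> exists B : R, forall x, `|u x| <= B.
Proof.
move=> cu; have [B hB] := continuous_bounded_compact (manifold_compact X) (fun x _ => cu x).
by exists B => x; exact: hB.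
Qed.

(** Read in chart [j] and extended by 0, [u] becomes a compactly supported function on R^n, globally
    Lipschitz by compactness, to which [weak_gradient_extend0] applies. The margin from r/2 to [r]
    leaves room for the mollification. *)
Lemma L2_gradient_supported u j p r : 0 < r -> [set y | `|p - y| <= r] `<=` img j ->
  lip_chart u -> (forall x, ~ (dom j x /\ `|p - phi j x| < r / 2) -> u x = 0) ->
  exists w, L2_gradient g vol u w.
Proof.
move=> r0 Kj lu u0; have r2 : 0 < r / 2 by rewrite divr_gt0.
pose F y := if `|p - y| < r / 2 then u (psi j y) else 0.
have lF y : lip_at F y.
  have [yr|yr] := leP `|p - y| (r / 2).
    have jy : img j y by apply: Kj => /=; lra.
    apply: lip_at_near (lu j y jy).
    have := open_nbhs_nbhs (conj (@img_open _ _ _ X j) jy); apply: filterS => z jz.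
    rewrite /F; case: ifPn => // nz; apply: u0 => -[_]; rewrite phi_psi//.
    exact/negP.
  apply: (@lip_at_near _ _ (cst 0)); last exact: lip_at_cst.
  have e0 : 0 < `|p - y| - r / 2 by lra.
  apply/nbhs_normP; exists (`|p - y| - r / 2) => // z /= yz.
  rewrite /F; case: ifPn => // zr; have := ler_distD z p y; rewrite (distrC z y); lra.
have F0 y : r / 2 <= `|p - y| -> F y = 0 by rewrite /F leNgt => /negbTE ->.
have [L L0 FL] := lip_at_global lF F0.
have rr : r / 2 < r by lra.
have [W [mW WL W0 gW]] := weak_gradient_extend0 hv r2 rr Kj L0 FL F0.
have uE : u = extend0 j F.
  apply/funext => x; rewrite /extend0; case: ifPn => [|]; rewrite ?inE ?notin_setE => jx.
    by rewrite /F psi_phi//; case: ifPn => // /negP nx; apply: u0 => -[].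
  by apply: u0 => -[].
exists (fun i => pullback i j W); rewrite uE; split; first exact: gW.
have [C C0 hC] := energy_pullback_le hv Kj.
apply: le_lt_trans (hC W L p (r / 2) r2 L0 _ mW WL W0) (ltry _).
by rewrite subrr normr0 mulr2n; lra.
Qed.

Lemma lip_chart_sum (I : Type) (s : seq I) (f : I -> M -> R) : (forall a, lip_chart (f a)) ->
  lip_chart (fun x => \sum_(a <- s) f a x).
Proof. by move=> h i y iy; apply: lip_at_sum => a; exact: h. Qed.

Lemma L2_gradient0 : L2_gradient g vol (cst 0) (fun (_ : chart X) _ => 0 : 'rV[R]_n).
Proof.
split.
  move=> i k; have -> : (fun _ : 'rV[R]_n => (0 : 'rV[R]_n) 0 k) = cst 0.
    by apply/funext => y; rewrite mxE.
  split; first by apply: loc_integrable_continuous => [|y _]; [exact: img_open|exact: cst_continuous].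
  move=> h _; have -> : (fun y => cst 0 (psi i y) * partial k h y) = cst 0.
    by apply/funext => y; rewrite /= mul0r.
  have -> : (fun y => (0 : 'rV[R]_n) 0 k * h y) = cst 0.
    by apply/funext => y; rewrite mxE mul0r.
  by rewrite /Rintegral integral0 oppr0.
have -> : (fun x => (grad_inner g (fun (_ : chart X) _ => 0 : 'rV[R]_n) (fun _ _ => 0) x)%:E) = cst 0%E.
  apply/funext => x; rewrite /grad_inner; have [i [-> ix]] := pick_dom (X := X) x.
  by rewrite !mul0mx mxE.
by rewrite integral0 ltry.
Qed.

Lemma L2_gradient_sum (I : Type) (s : seq I) (f : I -> M -> R) : (forall a, lip_chart (f a)) ->
  (forall a, exists w, L2_gradient g vol (f a) w) ->
  exists w, L2_gradient g vol (fun x => \sum_(a <- s) f a x) w.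
Proof.
move=> lf hf; elim: s => [|a s [w IH]].
  have -> : (fun x => \sum_(a <- [::]) f a x) = cst 0 by apply/funext => x; rewrite big_nil.
  by exists (fun _ _ => 0); exact: L2_gradient0.
have [w' hw'] := hf a; exists (fun i y => w' i y + w i y).
have -> : (fun x => \sum_(b <- a :: s) f b x) = (fun x => f a x + \sum_(b <- s) f b x).
  by apply/funext => x; rewrite big_cons.
apply: L2_gradientD => //; apply: lip_chart_continuous => //.
exact: lip_chart_sum.
Qed.
(** Segments inside a convex coordinate ball bound the change of the distance to [z] by a multiple
    of the coordinate distance. If it is infinite at one point of the ball it is infinite on the
    whole ball; otherwise it is finite and Lipschitz there. *)
Lemma dist_chart_dichotomy z i y0 : img i y0 ->
  (\forall y \near y0, riemannian_dist g z (psi i y) = +oo%E) \/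
  ((\forall y \near y0, riemannian_dist g z (psi i y) \is a fin_num) /\
   lip_at (fun y : 'rV[R]_n => fine (riemannian_dist g z (psi i y))) y0).
Proof.
move=> iy; have /nbhs_ballP[e /= e0 he] := open_nbhs_nbhs (conj (@img_open _ _ _ X i) iy).
pose r := e / 2; have r0 : 0 < r by rewrite divr_gt0.
pose K := [set y : 'rV[R]_n | `|y0 - y| <= r].
have Ki : K `<=` img i.
  by move=> y /= yr; apply: he; rewrite rV_ballE (le_lt_trans yr)// /r; lra.
have cK : compact K by exact: (@rV_closed_ball_compact R n y0 r).
have [C C0 gC] := gram_norm_equiv g cK Ki.
have T y y' : K y -> K y' ->
    (riemannian_dist g z (psi i y') <= riemannian_dist g z (psi i y) + (C * `|y' - y|)%:E)%E.
  move=> /= Ky Ky'; have := @dist_segment_triangle R n M X g i K C y (y' - y) Ki (ltW C0) _ _ z.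
  rewrite (addrC y) subrK; apply.
    by move=> a v Ka; have [] := gC a v Ka.
  move=> t /andP[t0 t1]; suff : `|y0 - (y + t *: (y' - y))| <= r by [].
  have -> : y0 - (y + t *: (y' - y)) = (1 - t) *: (y0 - y) + t *: (y0 - y').
    by apply/rowP => k; rewrite !mxE; ring.
  apply: (le_trans (ler_normD _ _)); rewrite !normrZ (ger0_norm t0) ger0_norm; last by lra.
  have : (1 - t) * `|y0 - y| <= (1 - t) * r by rewrite ler_wpM2l//; lra.
  have : t * `|y0 - y'| <= t * r by rewrite ler_wpM2l.
  lra.
have nK : \forall y \near y0, K y.
  by apply/nbhs_ballP; exists r => // y; rewrite rV_ballE => /ltW.
have K0 : K y0 by rewrite /K /= subrr normr0 ltW.
have [d0|d0] := eqVneq (riemannian_dist g z (psi i y0)) +oo%E.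
  left; apply: filterS nK => y Ky; have := T y y0 Ky K0; rewrite d0.
  by case: (riemannian_dist g z (psi i y)) (riemannian_dist_ge0 g z (psi i y)).
have fin y : K y -> riemannian_dist g z (psi i y) \is a fin_num.
  move=> Ky; rewrite ge0_fin_numE ?riemannian_dist_ge0//.
  apply: le_lt_trans (T y0 y K0 Ky) _; rewrite lte_add_pinfty ?ltry//.
  by rewrite lt_neqAle d0 leey.
right; split; first exact: filterS nK.
have FT y y' : K y -> K y' -> fine (riemannian_dist g z (psi i y')) - fine (riemannian_dist g z (psi i y)) <= C * `|y' - y|.
  move=> Ky Ky'; rewrite lerBlDl -lee_fin EFinD !fineK ?fin//; exact: T.
exists C, r; split => // [|y y' /ltW Ky /ltW Ky']; first exact: ltW.
by rewrite ler_norml FT// andbT lerNl opprB distrC FT.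
Qed.

(** Points at finite and at infinite distance form two disjoint open sets, so the default value 0
    never meets the values of [b]. *)
Lemma lip_chart_dist z (b : R -> R) : (forall r, 0 <= r -> lip_at b r) ->
  lip_chart (fun x => if riemannian_dist g z x is r%:E then b r else 0).
Proof.
move=> lb i y0 iy; have [h|[h ld]] := dist_chart_dichotomy z iy.
  apply: (@lip_at_near _ _ (cst 0)); last exact: lip_at_cst.
  by apply: filterS h => y ->.
apply: (@lip_at_near _ _ (fun y => b (fine (riemannian_dist g z (psi i y))))).
  by apply: filterS h => y; case: (riemannian_dist g z (psi i y)).
apply: (lip_at_comp _ ld); apply: lb; apply: fine_ge0; exact: riemannian_dist_ge0.
Qed.

Lemma near_dist_lt z (t : R) : 0 < t -> \forall x \near z, (riemannian_dist g z x < t%:E)%E.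
Proof.
move=> t0; have [j [r [r0 jz Kj]]] := closed_ball_chart (X := X) z.
have cK := @rV_closed_ball_compact R n (phi j z) r.
have [C C0 gC] := gram_norm_equiv g cK Kj.
pose s := Num.min r (t / C); have s0 : 0 < s by rewrite lt_min r0 divr_gt0.
have nb : nbhs (phi j z) (ball (phi j z) s) by exact: nbhsx_ballx.
apply: filterS (near_phi jz nb) => x [jx]; rewrite rV_ballE lt_min => /andP[xr xt].
have := @dist_segment R n M X g j _ C (phi j z) (phi j x - phi j z) Kj (ltW C0) _ _.
rewrite (addrC (phi j z)) subrK !psi_phi// => H; apply: le_lt_trans (H _ _) _.
- by move=> a v Ka; have [] := gC a v Ka.
- move=> a /andP[a0 a1] /=; rewrite opprD addrA subrr add0r normrN normrZ (ger0_norm a0) distrC.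
  by apply: (@le_trans _ _ (1 * `|phi j z - phi j x|)); [exact: ler_wpM2r|rewrite mul1r ltW].
by rewrite lte_fin distrC mulrC -ltr_pdivlMr.
Qed.

(* The cutoffs [chi a] are functions of the distance to [a], hence locally Lipschitz in
   every chart without looking at the transition maps. *)
Lemma lip_chart_gradient u : lip_chart u -> exists w, L2_gradient g vol u w.
Proof.
move=> lu; have [c hc] := choice (closed_ball_chart (X := X)); have [r hr] := choice hc.
(* The metric ball of radius [t a] lies in a coordinate ball of half the available radius, so that
   [chi a] is supported in a single chart. *)
have hT a : exists t : R, 0 < t /\
    forall x, (riemannian_dist g a x < t%:E)%E -> dom (c a) x /\ `|phi (c a) a - phi (c a) x| < r a / 2.
  have [r0 ja Kj] := hr a.
  have [k k0 hk] := dist_ge g r0 Kj.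
  exists (k * (r a / 2)); split; first by rewrite !mulr_gt0.
  move=> x dx; apply: contrapT => nx; have := hk a (r a / 2) ja _ _ x nx.
  rewrite subrr normr0 add0r => H; move: dx; rewrite ltNge => /negP; apply; apply: H; last by lra.
  by rewrite divr_gt0.
have [t ht] := choice hT.
pose chi a x := if riemannian_dist g a x is d%:E then Num.max 0 (t a - d) else 0.
have lchi a : lip_chart (chi a).
  apply: lip_chart_dist => d _; apply: (@lip_at_comp _ _ (fun t => Num.max 0 t)).
    exact: lip_at_max0.
  apply: lip_atD; first exact: lip_at_cst.
  by exists 1, 1; split => // x y _ _; rewrite mul1r -opprD normrN.
have chi0 a x : 0 <= chi a x.
  by rewrite /chi; case: (riemannian_dist g a x) => // d; rewrite le_max lexx.
have chi_supp a x : ~ (dom (c a) x /\ `|phi (c a) a - phi (c a) x| < r a / 2) -> chi a x = 0.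
  move=> nx; have [t0 h] := ht a; rewrite /chi; case E : (riemannian_dist g a x) => [d| |] //.
  apply/max_idPl; rewrite leNgt; apply/negP => td; apply: nx; apply: h.
  by rewrite E lte_fin; lra.
have := manifold_compact X; rewrite compact_cover.
move=> /(_ _ setT (fun a => [set x | 0 < chi a x])) [].
- move=> a _; rewrite -[X in open X]/(chi a @^-1` [set x | 0 < x]).
  apply: open_comp; last exact: open_gt.
  by move=> x _; exact: lip_chart_continuous.
- move=> x _; exists x => //=; have [t0 _] := ht x.
  have := nbhs_singleton (near_dist_lt x t0); rewrite /chi.
  have := riemannian_dist_ge0 g x x.
  by case: (riemannian_dist g x x) => // d _; rewrite lte_fin => dt; rewrite lt_max; apply/orP; right; lra.
move=> D _ hD; pose S x := \sum_(a <- finmap.enum_fset D) chi a x.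
have S0 x : 0 < S x.
  have [a /= aD ax] := hD x I; rewrite /S (big_rem a)//= ltr_wpDr// sumr_ge0//.
have lS : lip_chart (fun x => (S x)^-1).
  move=> i y iy; apply: (@lip_at_comp _ _ (@GRing.inv R)); last exact: lip_chart_sum.
  by apply: lip_at_inv; rewrite gt_eqF.
(* The quotients of the [chi a] by their sum [S] form a partition of unity, which cuts [u] into
   pieces each supported in one chart. *)
pose f a x := chi a x * (u x * (S x)^-1).
have lf a : lip_chart (f a).
  by move=> i y iy; apply: lip_atM; [exact: lchi|apply: lip_atM; [exact: lu|exact: lS]].
have gf a : exists w, L2_gradient g vol (f a) w.
  have [r0 ja Kj] := hr a; apply: (L2_gradient_supported r0 Kj (lf a)) => x nx.
  by rewrite /f chi_supp// mul0r.
have [w hw] := L2_gradient_sum (finmap.enum_fset D) lf gf.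
exists w; suff -> : u = (fun x => \sum_(a <- finmap.enum_fset D) f a x) by [].
apply/funext => x; rewrite /f -mulr_suml -/(S x) mulrCA mulfV ?mulr1//.
by rewrite gt_eqF.
Qed.

Lemma lip_chart_H1 u : lip_chart u -> H1 g vol u /\ Linfty vol u.
Proof.
move=> lu; have cu := lip_chart_continuous lu; have [B hB] := continuous_manifold_bounded cu.
have [L2 Loo] := @Lfun_bounded u B (borel_continuousR cu) hB.
by split => //; split => //; exact: lip_chart_gradient.
Qed.

(** The power (n-2)/2 is rewritten as the (n-2)-th power of a square root, so that the stability
    rules for [lip_at] apply; the radicand stays positive. *)
Lemma bubble_lip_chart (m : R) z : (2 < n)%N -> 0 < m -> lip_chart (bubble g m z).
Proof.
move=> n2 m0; apply: lip_chart_dist => r r0.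
pose N : R := n%:R * (n%:R - 2).
have N0 : 0 < N by rewrite mulr_gt0 ?ltr0n ?(ltn_trans _ n2)// subr_gt0 ltr_nat.
have D0 s : 0 < m ^+ 2 + s ^+ 2 / N.
  by rewrite ltr_wpDr ?exprn_gt0// divr_ge0 ?sqr_ge0 ?ltW.
have -> : (fun r => (m / (m ^+ 2 + r ^+ 2 / N)) `^ ((n%:R - 2) / 2)) =
    (fun r => Num.sqrt (m * (m ^+ 2 + r ^+ 2 * N^-1)^-1) ^+ (n - 2)).
  apply/funext => s; have T0 : 0 <= m / (m ^+ 2 + s ^+ 2 / N) by rewrite divr_ge0 ?ltW.
  rewrite -powR12_sqrt// -[RHS]powR_mulrn ?powR_ge0// -powRrM; congr (_ `^ _).
  by rewrite natrB ?(ltnW n2)// mulrC.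
apply: lip_atX; apply: lip_at_comp; first by apply: lip_at_sqrt; rewrite divr_gt0.
apply: lip_atM; first exact: lip_at_cst.
apply: (@lip_at_comp _ _ (@GRing.inv R)); first by apply: lip_at_inv; rewrite gt_eqF.
apply: lip_atD; first exact: lip_at_cst.
apply: lip_atM; last exact: lip_at_cst.
by apply: lip_atX; exists 1, 1; split => // a b _ _; rewrite mul1r.
Qed.
End sobolev_lipschitz.

(** * The main estimate *)

Section finite_measure_integrals.
Context d {T : measurableType d} {R : realType} (mu : {measure set T -> \bar R}).
Hypothesis fin : (mu setT < +oo)%E.
Implicit Types f h : T -> R.

Let intg f := mu.-integrable setT (EFin \o f).

Lemma integrable_lin2 (a b : R) f h : intg f -> intg h -> intg (fun x => a * f x + b * h x).
Proof.
move=> hf hh; have h1 := integrableZl measurableT a hf; have h2 := integrableZl measurableT b hh.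
exact: (integrableD measurableT h1 h2).
Qed.

Lemma Rintegral_lin2 (a b : R) f h : intg f -> intg h ->
  \int[mu]_x (a * f x + b * h x) = a * \int[mu]_x f x + b * \int[mu]_x h x.
Proof.
move=> hf hh; have h1 := integrableZl measurableT a hf; have h2 := integrableZl measurableT b hh.
by rewrite RintegralD// !RintegralZl.
Qed.

Lemma integrable_bounded f (C : R) : measurable_fun setT f -> (forall x, `|f x| <= C) -> intg f.
Proof. by move=> mf fC; apply: (@bounded_integrable _ _ _ _ _ _ C). Qed.

Lemma integrable_Mbounded f h (C : R) : measurable_fun setT f -> (forall x, `|f x| <= C) -> intg h ->
  intg (fun x => f x * h x).
Proof.
move=> mf fC hh; apply: (integrableMr measurableT mf _ hh).
by exists C; split; [exact: num_real|move=> r Cr x _; apply: le_trans (fC x) (ltW Cr)].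
Qed.
End finite_measure_integrals.

Lemma normrM_le_sqr {R : realFieldType} (a b t : R) : 0 < t ->
  `|a * b| <= t / 2 * a ^+ 2 + (2 * t)^-1 * b ^+ 2.
Proof.
move=> t0; have tt : 0 < 2 * t by lra.
have -> : t / 2 * a ^+ 2 + (2 * t)^-1 * b ^+ 2 = ((t * a) ^+ 2 + b ^+ 2) / (2 * t) by field; lra.
rewrite ler_pdivlMr//; have -> : `|a * b| * (2 * t) = `|a * b * (2 * t)|.
  by rewrite [RHS]normrM (ger0_norm (ltW tt)).
have h1 := sqr_ge0 (t * a - b); have h2 := sqr_ge0 (t * a + b).
by rewrite ler_norml; apply/andP; split; nra.
Qed.

(** Used with u = B^2 and a = q v: |1 - a| is at most 1 + |a|, and |a| at most 1/(2 tau) + tau a^2 /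
    2. The last term is then controlled by int B^2 v^2. *)
Lemma cutoff_error_le {R : realFieldType} (u a eta tau : R) : 0 <= u -> 0 <= eta <= 1 -> 0 < tau ->
  u * `|(1 - a) * (1 - eta)| <= (1 + (2 * tau)^-1) * u + tau / 2 * (u * a ^+ 2).
Proof.
move=> u0 /andP[eta0 eta1] tau0.
have -> : (1 + (2 * tau)^-1) * u + tau / 2 * (u * a ^+ 2) = u * (1 + (2 * tau)^-1 + tau / 2 * a ^+ 2).
  by ring.
apply: ler_wpM2l => //; rewrite normrM; apply: (@le_trans _ _ (`|1 - a| * 1)).
  by apply: ler_wpM2l => //; rewrite ger0_norm; lra.
rewrite mulr1; apply: (le_trans (ler_normB _ _)); rewrite normr1 -addrA lerD2l.
by have := normrM_le_sqr a 1 tau0; rewrite mulr1 expr1n mulr1; lra.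
Qed.

(** To be read with E = int |dv|^2, Q = m1^2 int v^2, A = q^2 int B^2 v^2, V = q int B^2 v and I =
    int B^2. Half of [A] is absorbed on the left, and dropping E + Q gives A <= I. *)
Lemma energy_identity_le {R : realFieldType} (E Q A V I : R) : 0 <= E -> 0 <= Q -> 0 <= A ->
  E + (Q + A) = V -> V <= 2^-1 * A + 2^-1 * I -> E + Q <= I / 2 /\ A <= I.
Proof. by move=> *; split; lra. Qed.

(** Here [P] and [N] are the gradient and L^2 pairings of v with the cutoff, [E] and [Q] the
    energies of v, the primed letters those of the cutoff, and m = m1^2. The weight [t] favours the
    small energy of the cutoff. *)
Lemma pairing_le {R : realFieldType} (P N E Q E' Q' I G m t : R) : 0 <= m -> 0 < t ->
  `|P| <= t / 2 * E + (2 * t)^-1 * E' -> `|N| <= t / 2 * Q + (2 * t)^-1 * Q' ->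
  E + m * Q <= I / 2 -> E' + m * Q' <= G -> `|P + m * N| <= t / 4 * I + (2 * t)^-1 * G.
Proof.
move=> m0 t0 hP hN hI hG; have t20 : 0 <= (2 * t)^-1 by rewrite invr_ge0; lra.
apply: (le_trans (ler_normD _ _)); rewrite normrM (ger0_norm m0).
have h1 : m * `|N| <= m * (t / 2 * Q + (2 * t)^-1 * Q') by exact: ler_wpM2l.
have h2 : (2 * t)^-1 * (E' + m * Q') <= (2 * t)^-1 * G by exact: ler_wpM2l.
have h3 : t / 2 * (E + m * Q) <= t / 2 * (I / 2) by apply: ler_wpM2l => //; lra.
by move: hP h1 h2; move: (2 * t)^-1 => t'; lra.
Qed.

(** * Testing the equation for [Phi] *)

Section core_estimate.
Context {R : realType} {n : nat} {M : ptopologicalType} {X : closed_manifold R n M}.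
Variables (g : riemannian_metric X) (vol : {measure set (borel M) -> \bar R}).
Hypothesis hv : riemannian_volume g vol.

Lemma grad_inner_lin (a : R) (w w' : chart X -> 'rV[R]_n -> 'rV[R]_n) x :
  grad_inner g (fun i y => a *: w i y + w' i y) (fun i y => a *: w i y + w' i y) x =
  a ^+ 2 * grad_inner g w w x + 2 * a * grad_inner g w w' x + grad_inner g w' w' x.
Proof.
rewrite /grad_inner; have [i [-> ix]] := pick_dom (X := X) x.
set A := invmx _; move: (w i _) (w' i _) => u v.
have sA : A^T = A by rewrite /A trmx_inv gram_sym//; exact: img_phi.
have -> : (a *: u + v)^T = a *: u^T + v^T by rewrite linearD/= linearZ.
have S : (v *m A *m u^T) 0 0 = (u *m A *m v^T) 0 0.
  have -> : v *m A *m u^T = (u *m A *m v^T)^T by rewrite !trmx_mul trmxK sA mulmxA.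
  by rewrite mxE.
rewrite !mulmxDl !mulmxDr -!(scalemxAl, scalemxAr).
move: S; move: (u *m A *m u^T) (v *m A *m v^T) (u *m A *m v^T) (v *m A *m u^T) => A1 A2 A3 A4 S.
by rewrite !mxE S; ring.
Qed.

(** Both t w + w' and -t w + w' have nonnegative square norm; expanding the squares bounds the cross
    term with either sign. *)
Lemma grad_inner_amgm (t : R) (w w' : chart X -> 'rV[R]_n -> 'rV[R]_n) x : 0 < t ->
  `|grad_inner g w w' x| <= t / 2 * grad_inner g w w x + (2 * t)^-1 * grad_inner g w' w' x.
Proof.
move=> t0; have h1 := grad_inner_ge0 g (fun i y => t *: w i y + w' i y) x.
have h2 := grad_inner_ge0 g (fun i y => (- t) *: w i y + w' i y) x.
rewrite !grad_inner_lin in h1 h2.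
move: h1 h2; move: (grad_inner g w w x) (grad_inner g w' w' x) (grad_inner g w w' x) => a b c h1 h2.
have tt : 0 < 2 * t by lra.
have -> : t / 2 * a + (2 * t)^-1 * b = (t ^+ 2 * a + b) / (2 * t) by field; lra.
rewrite ler_pdivlMr//; have -> : `|c| * (2 * t) = `|c * (2 * t)| by rewrite normrM (ger0_norm (ltW tt)).
by rewrite ler_norml; lra.
Qed.

(* Here [v] stands for [Phi u], and [t] and [tau] are the parameters of the AM-GM
   inequalities for the gradient and the tail terms. *)
Lemma Phi_estimate (u v eta : borel M -> R) (w' : chart X -> 'rV[R]_n -> 'rV[R]_n)
    (S : set (borel M)) (q m1 t tau G B : R) :
  0 < q -> 0 < m1 -> 0 < t -> 0 < tau ->
  measurable_fun setT u -> (forall x, `|u x| <= B) -> is_Phi g vol q m1 u v -> measurable S ->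
  measurable_fun setT eta -> (forall x, 0 <= eta x <= 1) -> (forall x, S x -> eta x = 1) ->
  L2_gradient g vol eta w' ->
  \int[vol]_x grad_inner g w' w' x + m1 ^+ 2 * \int[vol]_x (eta x ^+ 2) <= G ->
  `|\int[vol]_x (u x ^+ 2) - q * \int[vol]_x (v x * u x ^+ 2)| <=
    (1 + (2 * tau)^-1) * \int[vol]_x (u x ^+ 2 * \1_(~` S) x) + tau / 2 * \int[vol]_x (u x ^+ 2)
    + q^-1 * (t / 4 * \int[vol]_x (u x ^+ 2) + (2 * t)^-1 * G).
Proof.
move=> q0 m0 t0 tau0 mu uB [[v2 [w gw]] voo eqv] mS meta eta01 eta1 gw' hG.
have fin := vol_lty hv.
have [e2 eoo] : eta \in Lfun vol 2%:E /\ eta \in Lfun vol +oo%E.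
  by apply: (Lfun_bounded hv (B := 1)) => // x; have /andP[? ?] := eta01 x; rewrite ger0_norm.
have mv : measurable_fun setT v by move: v2; rewrite inE => /andP[]; rewrite inE.
pose u2 x := u x ^+ 2.
have mu2 : measurable_fun setT u2 by exact: measurable_funX.
have u2B x : `|u2 x| <= B ^+ 2.
  by rewrite /u2 normrX ler_sqr ?nnegrE// (le_trans _ (uB x)).
have u20 x : 0 <= u2 x by exact: sqr_ge0.
have iv2 : vol.-integrable setT (EFin \o (fun x => v x ^+ 2)) by exact: Lfun2_integrable_sqr.
have ie2 : vol.-integrable setT (EFin \o (fun x => eta x ^+ 2)) by exact: Lfun2_integrable_sqr.
have c1 : (cst 1 : borel M -> R) \in Lfun vol 2%:E.
  by apply: (Lfun_bounded hv (B := 1) _ _).1 => // x; rewrite normr1.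
have iv : vol.-integrable setT (EFin \o v).
  have /Lfun1_integrable := Lfun2_mul_Lfun1 v2 c1.
  by congr (vol.-integrable setT _); apply/funext => x /=; rewrite mulr1.
have ive : vol.-integrable setT (EFin \o (fun x => v x * eta x)).
  by have /Lfun1_integrable := Lfun2_mul_Lfun1 v2 e2.
have iu2 : vol.-integrable setT (EFin \o u2) by exact: integrable_bounded mu2 u2B.
have iuv : vol.-integrable setT (EFin \o (fun x => u2 x * v x)) by exact: integrable_Mbounded u2B iv.
have iuv2 : vol.-integrable setT (EFin \o (fun x => u2 x * v x ^+ 2)) by exact: integrable_Mbounded u2B iv2.
have iuve : vol.-integrable setT (EFin \o (fun x => u2 x * (v x * eta x))) by exact: integrable_Mbounded u2B ive.
have iue : vol.-integrable setT (EFin \o (fun x => u2 x * eta x)).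
  apply: (integrable_Mbounded mu2 u2B); apply: (integrable_bounded fin meta (C := 1)) => x.
  by have /andP[? ?] := eta01 x; rewrite ger0_norm.
have iuS : vol.-integrable setT (EFin \o (fun x => u2 x * \1_(~` S) x)).
  apply: (integrable_Mbounded mu2 u2B); apply: (integrable_bounded fin (C := 1)).
    by apply: measurable_indic; exact: measurableC.
  by move=> x; rewrite indicE; case: (_ \in _); rewrite ?normr1 ?normr0.
have energy (f : M -> R) (w0 : chart X -> 'rV[R]_n -> 'rV[R]_n) : L2_gradient g vol f w0 ->
    vol.-integrable setT (EFin \o (grad_inner g w0 w0 : borel M -> R)).
  move=> [gf Ef]; apply/integrableP; split.
    by apply/measurable_EFinP; apply: measurable_grad_inner => i k; have [[]] := gf i k.
  under eq_integral => x _ do rewrite /= ger0_norm ?grad_inner_ge0//.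
  exact: Ef.
have iE := energy _ _ gw; have iE' := energy _ _ gw'.
have iEE : vol.-integrable setT (EFin \o (grad_inner g w w' : borel M -> R)).
  have := integrable_lin2 (1 / 2) (2 * 1)^-1 iE iE'.
  apply: le_integrable => //.
    by apply/measurable_EFinP; apply: measurable_grad_inner => i k; [have [[]] := gw.1 i k|have [[]] := gw'.1 i k].
  move=> x _ /=; rewrite lee_fin; apply: (le_trans (grad_inner_amgm w w' x ltr01)).
  exact: ler_norm.
have e1 := eqv v w w (conj v2 (ex_intro _ w gw)) voo gw gw.
have e2' := eqv eta w w' (conj e2 (ex_intro _ w' gw')) eoo gw gw'.
have {e1}e1 : \int[vol]_x grad_inner g w w x + (m1 ^+ 2 * \int[vol]_x (v x ^+ 2) + q ^+ 2 * \int[vol]_x (u2 x * v x ^+ 2)) =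
    q * \int[vol]_x (u2 x * v x).
  rewrite -Rintegral_lin2// -e1; congr (_ + _).
  by apply: eq_Rintegral => x _; rewrite /u2; ring.
have {e2'}e2' : \int[vol]_x grad_inner g w w' x + (m1 ^+ 2 * \int[vol]_x (v x * eta x) + q ^+ 2 * \int[vol]_x (u2 x * (v x * eta x))) =
    q * \int[vol]_x (u2 x * eta x).
  rewrite -Rintegral_lin2// -e2'; congr (_ + _).
  by apply: eq_Rintegral => x _; rewrite /u2; ring.
pose I := \int[vol]_x u2 x; pose A := \int[vol]_x (u2 x * v x ^+ 2); pose V := \int[vol]_x (u2 x * v x).
pose Q := \int[vol]_x (v x ^+ 2); pose E := \int[vol]_x grad_inner g w w x.
(* Integrated form of B^2 (q v - 1)^2 >= 0. *)
have hV : q * V <= 2^-1 * (q ^+ 2 * A) + 2^-1 * I.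
  rewrite mulrA /V /A /I -Rintegral_lin2// -RintegralZl//; apply: le_Rintegral => //.
  - exact: (integrableZl measurableT q iuv).
  - exact: integrable_lin2.
  - move=> x _; rewrite -subr_ge0.
    have -> : 2^-1 * q ^+ 2 * (u2 x * v x ^+ 2) + 2^-1 * u2 x - q * (u2 x * v x) =
        2^-1 * (u2 x * (q * v x - 1) ^+ 2) by field.
    by rewrite mulr_ge0 ?invr_ge0// mulr_ge0 ?sqr_ge0.
have A0 : 0 <= q ^+ 2 * A.
  by rewrite mulr_ge0 ?sqr_ge0//; apply: Rintegral_ge0 => x _; rewrite mulr_ge0// sqr_ge0.
have Q0 : 0 <= m1 ^+ 2 * Q by rewrite mulr_ge0 ?sqr_ge0//; apply: Rintegral_ge0 => x _; exact: sqr_ge0.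
have E0 : 0 <= E by apply: Rintegral_ge0 => x _; exact: grad_inner_ge0.
have {}e1 : E + (m1 ^+ 2 * Q + q ^+ 2 * A) = q * V by [].
have [hE hA] := energy_identity_le E0 Q0 A0 e1 hV.
pose P := \int[vol]_x grad_inner g w w' x; pose N := \int[vol]_x (v x * eta x).
pose E' := \int[vol]_x grad_inner g w' w' x; pose Q' := \int[vol]_x (eta x ^+ 2).
have hP : `|P| <= t / 2 * E + (2 * t)^-1 * E'.
  apply: (le_trans (le_normr_Rintegral measurableT iEE)); rewrite -Rintegral_lin2//.
  apply: le_Rintegral => //; [exact: integrable_norm|exact: integrable_lin2|].
  by move=> x _; exact: grad_inner_amgm.
have hN : `|N| <= t / 2 * Q + (2 * t)^-1 * Q'.
  apply: (le_trans (le_normr_Rintegral measurableT ive)); rewrite -Rintegral_lin2//.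
  apply: le_Rintegral => //; [exact: integrable_norm|exact: integrable_lin2|].
  by move=> x _; exact: normrM_le_sqr.
(* This is the integral of u^2 (1 - q v) eta; the equation tested with [eta] turns q K into the
   pairing of v with [eta] in the energy form. *)
pose K := \int[vol]_x (u2 x * eta x) - q * \int[vol]_x (u2 x * (v x * eta x)).
have hK : q * K = P + m1 ^+ 2 * N.
  rewrite /K mulrBr -e2' mulrA -expr2; rewrite -/P -/N; ring.
have hK2 : `|K| <= q^-1 * (t / 4 * I + (2 * t)^-1 * G).
  rewrite mulrC ler_pdivlMr// mulrC -[X in X * _](ger0_norm (ltW q0)) -normrM hK.
  exact: (pairing_le (sqr_ge0 m1) t0 hP hN hE hG).
(* The difference z1 - z2 is u^2 (1 - q v)(1 - eta), which vanishes on [S] and thus only sees the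
   tail. *)
pose z1 x := 1 * u2 x + (- q) * (u2 x * v x).
pose z2 x := 1 * (u2 x * eta x) + (- q) * (u2 x * (v x * eta x)).
have iz1 : vol.-integrable setT (EFin \o z1) by exact: integrable_lin2.
have iz2 : vol.-integrable setT (EFin \o z2) by exact: integrable_lin2.
have iz : vol.-integrable setT (EFin \o (fun x => 1 * z1 x + (-1) * z2 x)) by exact: integrable_lin2.
have ZE : I - q * V = K + \int[vol]_x (1 * z1 x + (-1) * z2 x).
  rewrite Rintegral_lin2// /z1 /z2 !Rintegral_lin2// -/I -/V /K; ring.
have hZ : `|\int[vol]_x (1 * z1 x + (-1) * z2 x)| <=
    (1 + (2 * tau)^-1) * \int[vol]_x (u2 x * \1_(~` S) x) + (tau / 2 * q ^+ 2) * A.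
  apply: (le_trans (le_normr_Rintegral measurableT iz)); rewrite -Rintegral_lin2//.
  apply: le_Rintegral => //; [exact: integrable_norm|exact: integrable_lin2|].
  move=> x _; have -> : 1 * z1 x + (-1) * z2 x = u2 x * ((1 - q * v x) * (1 - eta x)).
    by rewrite /z1 /z2; ring.
  have ux := u20 x; rewrite normrM (ger0_norm ux).
  have err := cutoff_error_le (q * v x) ux (eta01 x) tau0; rewrite exprMn in err.
  have -> : tau / 2 * q ^+ 2 * (u2 x * v x ^+ 2) = tau / 2 * (u2 x * (q ^+ 2 * v x ^+ 2)) by ring.
  have [Sx|nSx] := pselect (S x); last by rewrite indicE mem_set// mulr1.
  rewrite eta1// subrr mulr0 normr0 mulr0 indicE memNset ?mulr0 ?add0r; last by apply.
  apply: mulr_ge0; first by rewrite divr_ge0// ltW.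
  by apply: mulr_ge0 => //; apply: mulr_ge0; exact: sqr_ge0.
have -> : \int[vol]_x (v x * u x ^+ 2) = V by apply: eq_Rintegral => x _; rewrite mulrC.
rewrite -/I ZE; apply: (le_trans (ler_normD _ _)); rewrite addrC; apply: lerD => //.
apply: (le_trans hZ); rewrite lerD2l -mulrA; apply: ler_wpM2l => //.
by rewrite divr_ge0// ltW.
Qed.
End core_estimate.

(** [T s] is a tail beyond radius [s]. Doubling [s] leads to the range where the first bound holds,
    and each doubling at least halves s^-(e+1), so that (b + 2a)/2 + a <= b + 2a closes the
    induction. The positive exponent is what makes this work. *)
Lemma doubling_bound {R : realType} (T : R -> R) (a b s0 : R) e : 0 <= a -> 0 <= b -> 0 < s0 ->
  (forall s, s0 / 2 <= s <= s0 -> T s <= b * s ^- e.+1) ->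
  (forall s, 0 < s -> 2 * s <= s0 -> T s <= T (2 * s) + a * s ^- e.+1) ->
  forall s, 0 < s <= s0 -> T s <= (b + 2 * a) * s ^- e.+1.
Proof.
move=> a0 b0 s00 hb ha.
have pw (s : R) : 0 < s -> 0 < s ^- e.+1 by move=> sp; rewrite invr_gt0 exprn_gt0.
have base s : s0 / 2 <= s <= s0 -> T s <= (b + 2 * a) * s ^- e.+1.
  move=> sb; apply: (le_trans (hb s sb)); apply: ler_wpM2r; last by lra.
  by apply: ltW; apply: pw; lra.
have main m : forall s, 0 < s <= s0 -> s0 / 2 <= s * 2 ^+ m -> T s <= (b + 2 * a) * s ^- e.+1.
  elim: m => [s|m IH s] ss sm; first by apply: base; move: sm; rewrite expr0 mulr1; lra.
  have [sb|sb] := leP (s0 / 2) s; first by apply: base; lra.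
  have s1 : 0 < s by lra.
  have h : T (2 * s) <= (b + 2 * a) * (2 * s) ^- e.+1.
    have E : 2 * s * 2 ^+ m = s * 2 ^+ m.+1 by rewrite exprS; ring.
    by apply: IH; [lra|rewrite E].
  apply: (le_trans (ha s s1 _)); first by lra.
  have h2 : (2 * s) ^- e.+1 <= 2^-1 * s ^- e.+1.
    rewrite exprMn invfM ler_wpM2r ?(ltW (pw s s1))// lef_pV2 ?posrE ?exprn_gt0//.
    by rewrite exprS ler_peMr// exprn_ege1// ler1n.
  have : (b + 2 * a) * (2 * s) ^- e.+1 <= (b + 2 * a) * (2^-1 * s ^- e.+1) by rewrite ler_wpM2l//; lra.
  have : 0 <= b * s ^- e.+1 by rewrite mulr_ge0// ltW// pw.
  move: h; move: ((2 * s) ^- e.+1) (s ^- e.+1) => A1 A2; nra.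
move=> s ss; pose m := (Num.truncn (s0 / s)).+1; apply: (main m) => //.
have s1 : 0 < s by lra.
have h1 : s0 / s < m%:R by exact: truncnS_gt.
have h2 : (m%:R : R) <= 2 ^+ m by rewrite -natrX ler_nat ltnW// ltn_expl.
rewrite ltr_pdivrMr// in h1.
have : s * m%:R <= s * 2 ^+ m by rewrite ler_wpM2l// ltW.
lra.
Qed.

(** The profile of the cutoff: 1 up to distance 1 and 0 from distance 2 on, distances being measured
    in units of [rho]. *)
Lemma clamp_lipschitz {R : realFieldType} (a b : R) :
  `|Num.max 0 (Num.min 1 (2 - a)) - Num.max 0 (Num.min 1 (2 - b))| <= `|a - b|.
Proof.
wlog ab : a b / a <= b.
  by move=> H; have [/H//|/ltW/H] := leP a b; rewrite distrC (distrC b).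
rewrite [leRHS]distrC ger0_norm 1?[leRHS]ger0_norm ?subr_ge0//;
  by rewrite !minEle !maxEle; do ![case: ifPn => /=]; rewrite -?ltNge; lra.
Qed.

(** * Balls and cutoffs in a fixed chart *)

Section geometry.
Context {R : realType} {n : nat} {M : ptopologicalType} {X : closed_manifold R n M}.
Variables (g : riemannian_metric X) (vol : {measure set (borel M) -> \bar R}).
Hypothesis hv : riemannian_volume g vol.
Variables (j : chart X) (p : 'rV[R]_n) (r : R).
Hypotheses (r0 : 0 < r) (Kj : [set y | `|p - y| <= r] `<=` img j).

Definition chart_ball (z : M) (s : R) : set (borel M) := dom j `&` phi j @^-1` ball (phi j z) s.

Lemma measurable_chart_ball z s : measurable (chart_ball z s).
Proof. by apply: borel_open; apply: open_phi_preimage; exact: ball_open. Qed.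

Lemma dist_le_chart_ball : exists2 C : R, 0 < C & forall z s x, dom j z -> 0 < s ->
  `|p - phi j z| + s <= r -> chart_ball z s x -> (riemannian_dist g z x <= (C * s)%:E)%E.
Proof.
have cK := @rV_closed_ball_compact R n p r; have [C C0 gC] := gram_norm_equiv g cK Kj.
exists C => // z s x jz s0 zs [jx]; rewrite /preimage/= rV_ballE => xs.
have := @dist_segment R n M X g j _ C (phi j z) (phi j x - phi j z) Kj (ltW C0) _ _.
rewrite (addrC (phi j z)) subrK !psi_phi// => H; apply: le_trans (H _ _) _.
- by move=> a v Ka; have [] := gC a v Ka.
- move=> a /andP[a0 a1] /=; rewrite opprD addrA; apply: (le_trans (ler_normB _ _)).
  rewrite normrZ (ger0_norm a0) distrC; apply: le_trans zs; rewrite (distrC p) lerD2l.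
  apply: (@le_trans _ _ (1 * `|phi j z - phi j x|)); first by rewrite distrC; exact: ler_wpM2r.
  by rewrite mul1r ltW.
by rewrite lee_fin distrC ler_wpM2l// ltW.
Qed.

Lemma Rintegral_indic (A : set (borel M)) : measurable A -> \int[vol]_x (\1_A x : R) = fine (vol A).
Proof. by move=> mA; rewrite /Rintegral integral_indic// setIT. Qed.

(** The cutoff has Lipschitz constant 1/rho and support of radius 2 rho, hence gradient energy of
    order rho^(n-2); since rho <= 1 the mass term, of order rho^n, fits in the same bound. The room
    4 rho comes from the doubled radius in [energy_pullback_le]. *)
Lemma cutoff_exists (m1 : R) : exists2 C : R, 0 < C & forall z rho, dom j z -> 0 < rho -> rho <= 1 ->
  `|p - phi j z| + 4 * rho <= r ->
  exists (eta : borel M -> R) (w : chart X -> 'rV[R]_n -> 'rV[R]_n),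
  [/\ measurable_fun setT eta, (forall x, 0 <= eta x <= 1), (forall x, chart_ball z rho x -> eta x = 1),
    L2_gradient g vol eta w &
    \int[vol]_x grad_inner g w w x + m1 ^+ 2 * \int[vol]_x (eta x ^+ 2) <= C * (rho ^- 2 * rho ^+ n)].
Proof.
have [C1 C10 hC1] := energy_pullback_le hv Kj; have [C2 C20 hC2] := vol_ball_le hv Kj.
exists (C1 * 2 ^+ n + m1 ^+ 2 * C2 * 2 ^+ n).
  apply: ltr_pwDl; first by rewrite mulr_gt0// exprn_gt0.
  by apply: mulr_ge0; [apply: mulr_ge0; [exact: sqr_ge0|exact: ltW]|exact: exprn_ge0].
move=> z rho jz rho0 rho1 zr; pose y0 := phi j z.
pose F y := Num.max 0 (Num.min 1 (2 - `|y0 - y| / rho)).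
have F01 y : 0 <= F y <= 1.
  by rewrite /F le_max lexx/= ge_max ler01/= ge_min lexx.
have ri0 : 0 <= rho^-1 by rewrite invr_ge0 ltW.
have FL y y' : `|F y - F y'| <= rho^-1 * `|y - y'|.
  have h : `| `|y0 - y| - `|y0 - y'| | <= `|y - y'|.
    apply: (le_trans (ler_dist_dist _ _)).
    have -> : y0 - y - (y0 - y') = y' - y by rewrite opprB addrC addrA subrK.
    by rewrite distrC.
  have h' : `| `|y0 - y| / rho - `|y0 - y'| / rho | <= rho^-1 * `|y - y'|.
    by rewrite -mulrBl normrM [leRHS]mulrC (ger0_norm ri0) ler_wpM2r.
  exact: le_trans (clamp_lipschitz _ _) h'.
have F0 y : 2 * rho <= `|y0 - y| -> F y = 0.
  move=> h; apply/max_idPl; rewrite ge_min; apply/orP; right.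
  by rewrite subr_le0 ler_pdivlMr.
have F1 y : `|y0 - y| < rho -> F y = 1.
  move=> h; have hh : `|y0 - y| / rho <= 1 by rewrite ler_pdivrMr// mul1r ltW.
  by rewrite /F min_l ?max_r//; lra.
have r2 : 0 < 2 * rho by lra.
have r3 : 2 * rho < 3 * rho by lra.
have K3 : [set y | `|y0 - y| <= 3 * rho] `<=` img j.
  by move=> y /= h; apply: Kj => /=; have := ler_distD y0 p y; rewrite -/y0 in zr; lra.
have [W [mW WL W0 gW]] := weak_gradient_extend0 hv r2 r3 K3 ri0 FL F0.
have E := hC1 W rho^-1 y0 (2 * rho) r2 ri0 _ mW WL W0.
pose eta : borel M -> R := extend0 j F.
have eta01 x : 0 <= eta x <= 1.
  by rewrite /eta /extend0; case: ifPn => // _; rewrite lexx ler01.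
have meta : measurable_fun setT eta.
  have -> : eta = (F \o phi j) \_ (dom j : set (borel M)).
    by apply/funext => x; rewrite patchE.
  apply/(measurable_restrictT _ _).1 => //; first exact: measurable_dom.
  apply: borel_continuous_on => [|x jx]; first exact: dom_open.
  apply: continuous_comp; first exact: phi_continuous.
  exact: (lipschitz_continuous FL).
exists eta, (fun i => pullback i j W); split => //.
- by move=> x [jx]; rewrite /preimage/= rV_ballE => xr; rewrite /eta extend0_dom// F1.
- split; first exact: gW.
  apply: le_lt_trans (E _) (ltry _); rewrite -/y0 in zr; rewrite mulr2n; lra.
have hE : \int[vol]_x grad_inner g (fun i => pullback i j W) (fun i => pullback i j W) x <=
    C1 * rho^-1 ^+ 2 * (2 * rho) ^+ n.
  rewrite -lee_fin /Rintegral fineK; first by apply: E; rewrite -/y0 in zr; rewrite mulr2n; lra.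
  rewrite ge0_fin_numE; last by apply: integral_ge0 => x _; rewrite lee_fin grad_inner_ge0.
  by apply: le_lt_trans (E _) (ltry _); rewrite -/y0 in zr; rewrite mulr2n; lra.
have hQ : \int[vol]_x (eta x ^+ 2) <= C2 * (2 * rho) ^+ n.
  have fin := vol_lty hv.
  apply: (@le_trans _ _ (\int[vol]_x (\1_(chart_ball z (2 * rho)) x : R))).
    apply: le_Rintegral => //.
    - apply: (integrable_bounded fin (C := 1)); first exact: measurable_funX.
      move=> x; have /andP[e0 e1] := eta01 x.
      by rewrite normrX ger0_norm// expr_le1.
    - apply: (integrable_bounded fin (C := 1)); first by apply: measurable_indic; exact: measurable_chart_ball.
      by move=> x; rewrite indicE; case: (_ \in _); rewrite ?normr1 ?normr0.
    - move=> x _; have /andP[e0 e1] := eta01 x; rewrite indicE.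
      have [xA|nx] := pselect (chart_ball z (2 * rho) x); first by rewrite mem_set// expr_le1.
      rewrite memNset//; suff -> : eta x = 0 by rewrite expr0n.
      rewrite /eta /extend0; case: ifPn => //; rewrite inE => jx; apply: F0.
      by rewrite leNgt; apply/negP => xr; apply: nx; split => //; rewrite /preimage/= rV_ballE.
  rewrite Rintegral_indic; last exact: measurable_chart_ball.
  rewrite -lee_fin fineK; first by apply: hC2 => //; rewrite -/y0 in zr; lra.
  rewrite ge0_fin_numE//; apply: le_lt_trans fin; apply: le_measure; rewrite ?inE//.
  exact: measurable_chart_ball.
apply: (le_trans (lerD hE (ler_wpM2l (sqr_ge0 m1) hQ))).
rewrite exprMn exprVn mulrDl lerD//.
  by rewrite le_eqVlt; apply/orP; left; apply/eqP; ring.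
have : m1 ^+ 2 * C2 * 2 ^+ n * (1 * rho ^+ n) <= m1 ^+ 2 * C2 * 2 ^+ n * (rho ^- 2 * rho ^+ n).
  apply: ler_wpM2l; first by apply: mulr_ge0; [apply: mulr_ge0; [exact: sqr_ge0|exact: ltW]|exact: exprn_ge0].
  by apply: ler_wpM2r; [rewrite exprn_ge0// ltW|rewrite invf_ge1 ?exprn_gt0// expr_le1// ltW].
by apply: le_trans; rewrite le_eqVlt; apply/orP; left; apply/eqP; ring.
Qed.
End geometry.

(** * Integrals of bubbles *)

Section bubble_estimates.
Context {R : realType} {n : nat} {M : ptopologicalType} {X : closed_manifold R n M}.
Variables (g : riemannian_metric X) (vol : {measure set (borel M) -> \bar R}).
Hypothesis hv : riemannian_volume g vol.
(* With [n = e + 5], the exponents n - 2 and n - 4 become [e + 3] and [e + 1]. *)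
Variable e : nat.
Hypothesis ne : n = (e + 5)%N.

Let N : R := n%:R * (n%:R - 2).

Lemma dim_const_gt0 : 0 < N.
Proof. by rewrite /N ne mulr_gt0 ?ltr0n ?addnS// subr_gt0 ltr_nat; lia. Qed.

(** Squaring turns the real exponent (n-2)/2 into the natural number n - 2 = e + 3; all later
    estimates concern this square. *)
Lemma bubble_sqr (m : R) z x : 0 < m -> bubble g m z x ^+ 2 =
  if riemannian_dist g z x is d%:E then (m / (m ^+ 2 + d ^+ 2 / N)) ^+ (e + 3) else 0.
Proof.
move=> m0; rewrite /bubble; case: (riemannian_dist g z x) => [d| |]; rewrite ?expr0n//.
have D0 : 0 < m ^+ 2 + d ^+ 2 / N.
  by rewrite ltr_pwDl ?exprn_gt0// divr_ge0 ?sqr_ge0// ltW// dim_const_gt0.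
have t0 : 0 <= m / (m ^+ 2 + d ^+ 2 / N) by rewrite divr_ge0// ltW.
rewrite -[LHS]powR_mulrn ?powR_ge0// -powRrM -[RHS]powR_mulrn//; congr (_ `^ _).
by rewrite ne !natrD; lra.
Qed.

Lemma bubble_sqr_ge (C m : R) z x : 0 < C -> 0 < m -> (riemannian_dist g z x <= (C * m)%:E)%E ->
  ((1 + C ^+ 2 / N) * m) ^- (e + 3) <= bubble g m z x ^+ 2.
Proof.
move=> C0 m0; rewrite bubble_sqr//; have N0 := dim_const_gt0.
case: (riemannian_dist g z x) (riemannian_dist_ge0 g z x) => [d| |] //.
rewrite !lee_fin => d0 dC.
have D0 : 0 < m ^+ 2 + d ^+ 2 / N by rewrite ltr_pwDl ?exprn_gt0// divr_ge0 ?sqr_ge0 ?ltW.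
rewrite -exprVn; apply: lerXn2r; rewrite ?nnegrE.
- by rewrite invr_ge0 mulr_ge0 ?ltW// ltr_pwDl// divr_ge0 ?sqr_ge0 ?ltW.
- by rewrite divr_ge0 ?ltW.
have k0 : 0 < (1 + C ^+ 2 / N) * m by rewrite mulr_gt0// ltr_pwDl// divr_ge0 ?sqr_ge0 ?ltW.
rewrite ler_pdivlMr// mulrC ler_pdivrMr//.
have -> : m * ((1 + C ^+ 2 / N) * m) = m ^+ 2 + (C * m) ^+ 2 / N by ring.
rewrite lerD2l; apply: ler_wpM2r; first by rewrite invr_ge0 ltW.
by apply: lerXn2r; rewrite ?nnegrE// mulr_ge0 ?(ltW C0) ?(ltW m0).
Qed.

(** Far from the centre the term [m ^+ 2] in the denominator is discarded; at infinite distance the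
    bubble is 0. *)
Lemma bubble_sqr_le (c m s : R) z x : 0 < c -> 0 < m -> 0 < s ->
  ((c * s)%:E <= riemannian_dist g z x)%E ->
  bubble g m z x ^+ 2 <= (N / c ^+ 2) ^+ (e + 3) * m ^+ (e + 3) * s ^- (2 * (e + 3)).
Proof.
move=> c0 m0 s0; rewrite bubble_sqr//; have N0 := dim_const_gt0.
have P : 0 <= N / c ^+ 2 * m / s ^+ 2.
  by apply: divr_ge0; [apply: mulr_ge0; [apply: divr_ge0; [exact: ltW|exact: sqr_ge0]|exact: ltW]|exact: sqr_ge0].
have -> : (N / c ^+ 2) ^+ (e + 3) * m ^+ (e + 3) * s ^- (2 * (e + 3)) =
    (N / c ^+ 2 * m / s ^+ 2) ^+ (e + 3).
  by rewrite [RHS]exprMn [in RHS]exprMn exprVn -exprM.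
case: (riemannian_dist g z x) => [d| |] //; last by move=> _; exact: exprn_ge0.
rewrite lee_fin => cd; have cs0 : 0 < c * s by rewrite mulr_gt0.
have d0 : 0 < d by exact: lt_le_trans cd.
have D0 : 0 < m ^+ 2 + d ^+ 2 / N by rewrite ltr_pwDl ?exprn_gt0// divr_ge0 ?sqr_ge0 ?ltW.
apply: lerXn2r; rewrite ?nnegrE//; first by rewrite divr_ge0 ?ltW.
rewrite ler_pdivrMr//.
have -> : N / c ^+ 2 * m / s ^+ 2 * (m ^+ 2 + d ^+ 2 / N) =
    m * (N * m ^+ 2 + d ^+ 2) / (c * s) ^+ 2.
  by field; rewrite !gt_eqF.
rewrite ler_pdivlMr ?exprn_gt0// ler_wpM2l//; first exact: ltW.
apply: (@le_trans _ _ (d ^+ 2)); first by apply: lerXn2r; rewrite ?nnegrE ?(ltW cs0) ?(ltW d0).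
by rewrite lerDr mulr_ge0 ?sqr_ge0 ?ltW.
Qed.

Let expr_dim (x : R) : x ^+ n = x ^+ (e + 3) * x ^+ 2.
Proof. by rewrite -exprD ne -addnA. Qed.

Let exprV_split (x : R) : x ^- (2 * (e + 3)) = x ^- (e + 5) * x ^- e.+1.
Proof. by rewrite -invfM -exprD; congr (_ ^- _); lia. Qed.

Let exprn5 (x : R) : x ^+ n = x ^+ (e + 5).
Proof. by rewrite ne. Qed.

Lemma bubble_bounded (m : R) z : 0 < m -> measurable_fun setT (bubble g m z : borel M -> R) /\
  exists B : R, forall x, `|bubble g m z x| <= B.
Proof.
move=> m0; have n2 : (2 < n)%N by rewrite ne; lia.
have cb := lip_chart_continuous (bubble_lip_chart g z n2 m0).
by split; [exact: borel_continuousR|exact: (@continuous_manifold_bounded R n M X)].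
Qed.

Variables (j : chart X) (p : 'rV[R]_n) (r : R).
Hypotheses (r0 : 0 < r) (Kj : [set y | `|p - y| <= r] `<=` img j).

(** For the lower bound, on the ball of radius [m] the squared bubble is at least of order m^-(n-2)
    and the volume of order m^n. For the tail, the shell between radii s and 2s contributes at most
    a multiple of m^(n-2) s^(-2(n-2)) s^n = m^(n-2) s^(4-n), and [doubling_bound] sums the
    shells. *)
Lemma bubble_integrals : exists2 c : R, 0 < c & exists2 K : R, 0 < K &
  forall z m, dom j z -> 0 < m -> `|p - phi j z| <= r / 2 -> m <= r / 2 ->
    c * m ^+ 2 <= \int[vol]_x (bubble g m z x ^+ 2) /\
    forall s, 0 < s <= r / 2 -> \int[vol]_x (bubble g m z x ^+ 2 * \1_(~` chart_ball j z s) x) <=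
      K * m ^+ (e + 3) * s ^- e.+1.
Proof.
have fin := vol_lty hv; have N0 := dim_const_gt0.
have [C C0 hC] := dist_le_chart_ball g Kj; have [c c0 hc] := dist_ge g r0 Kj.
have [v1 v10 hv1] := vol_ball_ge hv Kj; have [v2 v20 hv2] := vol_ball_le hv Kj.
pose k := 1 + C ^+ 2 / N; pose D := (N / c ^+ 2) ^+ (e + 3).
have k0 : 0 < k by rewrite ltr_pwDl// divr_ge0 ?sqr_ge0 ?ltW.
have D0 : 0 < D by rewrite exprn_gt0// divr_gt0// exprn_gt0.
pose V := fine (vol setT); have V0 : 0 <= V by exact: fine_ge0.
pose s0 := r / 2; have s00 : 0 < s0 by rewrite divr_gt0.
(* The constant [b] pays for the radii between s0/2 and s0, where the whole volume is used; [a] pays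
   for one shell, contained in the ball of radius 2s. *)
pose b := D * V * (2 / s0) ^+ (e + 5); pose a := D * v2 * 2 ^+ (e + 5).
have a0 : 0 < a by rewrite !mulr_gt0// exprn_gt0.
have b0 : 0 <= b.
  by apply: mulr_ge0; [apply: mulr_ge0 => //; exact: ltW|apply: exprn_ge0; apply: divr_ge0 => //; exact: ltW].
exists (k ^- (e + 3) * v1); first by rewrite mulr_gt0// invr_gt0 exprn_gt0.
exists (b + 2 * a); first by lra.
move=> z m jz m0 zr mr; have [mB [B hB]] := bubble_bounded z m0.
pose u2 x := bubble g m z x ^+ 2.
have mu2 : measurable_fun setT (u2 : borel M -> R) by exact: measurable_funX.
have u2B x : `|u2 x| <= B ^+ 2 by rewrite /u2 normrX ler_sqr ?nnegrE// (le_trans _ (hB x)).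
have u20 x : 0 <= u2 x by exact: sqr_ge0.
have iu2 : vol.-integrable setT (EFin \o (u2 : borel M -> R)) by exact: integrable_bounded mu2 u2B.
have iI (A : set (borel M)) : measurable A -> vol.-integrable setT (EFin \o (\1_A : borel M -> R)).
  move=> mA; apply: (integrable_bounded fin (C := 1)); first exact: measurable_indic.
  by move=> x; rewrite indicE; case: (_ \in _); rewrite ?normr1 ?normr0.
have iuI (A : set (borel M)) : measurable A -> vol.-integrable setT (EFin \o (fun x : borel M => u2 x * \1_A x)).
  by move=> mA; apply: (integrable_Mbounded mu2 u2B); exact: iI.
have mA s : measurable (chart_ball j z s) by exact: measurable_chart_ball.
have vfin A : measurable A -> (vol A < +oo)%E.
  by move=> mAA; apply: le_lt_trans fin; apply: le_measure; rewrite ?inE.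
split.
  apply: (@le_trans _ _ (\int[vol]_x ((k * m) ^- (e + 3) * \1_(chart_ball j z m) x))).
    rewrite RintegralZl//; last exact: iI.
    rewrite Rintegral_indic//.
    have hm : v1 * m ^+ n <= fine (vol (chart_ball j z m)).
      rewrite -lee_fin fineK ?ge0_fin_numE ?vfin//; apply: hv1 => //; lra.
    have -> : k ^- (e + 3) * v1 * m ^+ 2 = (k * m) ^- (e + 3) * (v1 * m ^+ n).
      rewrite expr_dim exprMn; have : m ^+ (e + 3) != 0 by rewrite expf_neq0// gt_eqF.
      have : k ^+ (e + 3) != 0 by rewrite expf_neq0// gt_eqF.
      move: (k ^+ (e + 3)) (m ^+ (e + 3)) => x y x0 y0; field.
      by rewrite x0 y0.
    by apply: ler_wpM2l => //; rewrite invr_ge0 exprn_ge0// mulr_ge0 ?ltW.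
  apply: le_Rintegral => //.
  - by apply: (integrableZl measurableT _ (iI _ (mA m))).
  - move=> x _; rewrite indicE; have [xA|nx] := pselect (chart_ball j z m x).
      rewrite mem_set// mulr1; apply: bubble_sqr_ge => //; apply: (hC z m x) => //; lra.
    by rewrite memNset// mulr0 sqr_ge0.
pose T s := \int[vol]_x (u2 x * \1_(~` chart_ball j z s) x).
have F1 s x : 0 < s <= s0 -> ~ chart_ball j z s x -> u2 x <= D * m ^+ (e + 3) * s ^- (2 * (e + 3)).
  move=> /andP[sp ss] nx; apply: bubble_sqr_le => //; apply: (hc z s) => //.
    by rewrite /s0 in ss; lra.
  by move=> [jx xs]; apply: nx; split => //; rewrite /preimage/= rV_ballE.
have mk0 : 0 <= m ^+ (e + 3) by rewrite exprn_ge0// ltW.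
have Ds0 s : 0 < s -> 0 <= D * m ^+ (e + 3) * s ^- (2 * (e + 3)).
  move=> sp; apply: mulr_ge0; first by apply: mulr_ge0 => //; exact: ltW.
  by rewrite invr_ge0 exprn_ge0// ltW.
move=> s ss; have -> : (b + 2 * a) * m ^+ (e + 3) = b * m ^+ (e + 3) + 2 * (a * m ^+ (e + 3)) by ring.
apply: (@doubling_bound R T (a * m ^+ (e + 3)) (b * m ^+ (e + 3)) s0 e) => //.
- by rewrite mulr_ge0// ltW.
- by rewrite mulr_ge0.
- move=> {ss}s sb; have sp : 0 < s by lra.
  apply: (@le_trans _ _ (\int[vol]_(_ in [set: borel M]) (D * m ^+ (e + 3) * s ^- (2 * (e + 3))))).
    apply: le_Rintegral => //.
    + by apply: iuI; exact: measurableC.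
    + by apply: (integrable_bounded fin (C := D * m ^+ (e + 3) * s ^- (2 * (e + 3)))) => // x; rewrite ger0_norm// Ds0.
    + move=> x _; rewrite indicE; have [xA|nx] := pselect (chart_ball j z s x).
        by rewrite memNset ?mulr0 ?Ds0//=; apply.
      by rewrite mem_set// mulr1; apply: F1 => //; lra.
  rewrite Rintegral_cst// -/V.
  have h1 : s ^- (e + 5) <= (2 / s0) ^+ (e + 5).
    have q0 : 0 < 2 / s0 by exact: divr_gt0.
    rewrite -exprVn; apply: lerXn2r; rewrite ?nnegrE ?invr_ge0 ?(ltW q0) ?(ltW sp)//.
    by rewrite -[2 / s0]invrK invf_div lef_pV2 ?posrE ?divr_gt0//; lra.
  rewrite exprV_split.
  have -> : D * m ^+ (e + 3) * (s ^- (e + 5) * s ^- e.+1) * V = D * V * m ^+ (e + 3) * s ^- e.+1 * s ^- (e + 5) by ring.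
  have -> : b * m ^+ (e + 3) / s ^+ e.+1 = D * V * m ^+ (e + 3) * s ^- e.+1 * (2 / s0) ^+ (e + 5) by rewrite /b; ring.
  apply: ler_wpM2l => //; apply: mulr_ge0; last by rewrite invr_ge0 exprn_ge0// ltW.
  by apply: mulr_ge0 => //; apply: mulr_ge0 => //; exact: ltW.
- move=> {ss}s sp ss; have ss0 : 0 < s <= s0 by rewrite sp/=; lra.
  have s2 : 0 < 2 * s by lra.
  have hA : fine (vol (chart_ball j z (2 * s))) <= v2 * (2 * s) ^+ n.
    rewrite -lee_fin fineK ?ge0_fin_numE ?vfin//; apply: hv2 => //; rewrite /s0 in ss; lra.
  pose Ds := D * m ^+ (e + 3) * s ^- (2 * (e + 3)).
  apply: (@le_trans _ _ (\int[vol]_x (1 * (u2 x * \1_(~` chart_ball j z (2 * s)) x) + Ds * \1_(chart_ball j z (2 * s)) x))).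
    apply: le_Rintegral => //.
    + by apply: iuI; exact: measurableC.
    + by apply: integrable_lin2; [apply: iuI; exact: measurableC|exact: iI].
    + move=> x _; rewrite mul1r !indicE; have [xs|nxs] := pselect (chart_ball j z s x).
        rewrite memNset ?mulr0; last by apply.
        by apply: addr_ge0; apply: mulr_ge0; rewrite ?ler0n// Ds0.
      rewrite [in leLHS]mem_set// mulr1; have [x2|nx2] := pselect (chart_ball j z (2 * s) x).
        rewrite memNset; last by apply.
        by rewrite mem_set// mulr0 add0r mulr1; apply: F1.
      by rewrite mem_set// memNset// mulr1 mulr0 addr0.
  rewrite Rintegral_lin2//; [|by apply: iuI; exact: measurableC|exact: iI].
  rewrite mul1r -/(T (2 * s)) lerD2l Rintegral_indic//.
  apply: (@le_trans _ _ (Ds * (v2 * (2 * s) ^+ n))); first by apply: ler_wpM2l => //; exact: Ds0.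
  rewrite le_eqVlt; apply/orP; left; apply/eqP; rewrite /Ds /a exprn5 exprMn exprV_split.
  have : s ^+ (e + 5) != 0 by rewrite expf_neq0// gt_eqF.
  have : s ^+ e.+1 != 0 by rewrite expf_neq0// gt_eqF.
  move: (s ^+ (e + 5)) (s ^+ e.+1) (2 ^+ (e + 5)) (m ^+ (e + 3)) => A1 A2 A3 A4 x0 y0; field.
  by rewrite x0 y0.
Qed.
End bubble_estimates.

(** * Choice of the parameters and passage to the limit *)

Lemma ratio_bound {R : realFieldType} (I V T G q K L t tau e1 : R) :
  0 < I -> 0 < q -> 0 < t -> 0 < tau -> 0 <= K -> 0 <= L ->
  `|I - q * V| <= (1 + (2 * tau)^-1) * T + tau / 2 * I + q^-1 * (t / 4 * I + (2 * t)^-1 * G) ->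
  T <= K * I -> G <= L * I ->
  (1 + (2 * tau)^-1) * K + tau / 2 + q^-1 * (t / 4 + (2 * t)^-1 * L) <= q * e1 ->
  `|q^-1 - V / I| <= e1.
Proof.
move=> I0 q0 t0 tau0 K0 L0 h hT hG he.
have -> : q^-1 - V / I = (I - q * V) / (q * I) by field; rewrite !gt_eqF.
have qI : 0 < q * I by rewrite mulr_gt0.
rewrite normrM normfV (gtr0_norm qI) ler_pdivrMr//; apply: (le_trans h).
have tau1 : 0 <= (2 * tau)^-1 by rewrite invr_ge0; lra.
have t1 : 0 <= (2 * t)^-1 by rewrite invr_ge0; lra.
have q1 : 0 <= q^-1 by rewrite invr_ge0 ltW.
apply: (@le_trans _ _ (((1 + (2 * tau)^-1) * K + tau / 2 + q^-1 * (t / 4 + (2 * t)^-1 * L)) * I)); last first.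
  by rewrite mulrA [e1 * q]mulrC; apply: ler_wpM2r => //; exact: ltW.
have a1 : (1 + (2 * tau)^-1) * T <= (1 + (2 * tau)^-1) * (K * I) by apply: ler_wpM2l => //; lra.
have a2 : (2 * t)^-1 * G <= (2 * t)^-1 * (L * I) by exact: ler_wpM2l.
have a3 : q^-1 * (t / 4 * I + (2 * t)^-1 * G) <= q^-1 * (t / 4 * I + (2 * t)^-1 * (L * I)).
  by apply: ler_wpM2l => //; lra.
rewrite [leRHS](_ : _ = (1 + (2 * tau)^-1) * (K * I) + tau / 2 * I + q^-1 * (t / 4 * I + (2 * t)^-1 * (L * I))); last by ring.
lra.
Qed.

(** At radius s = L m the tail is (K / L) m^2 / L^e. The one factor 1/L kept here is enough to make
    it small relative to [I], and m^2 <= I / c is the lower bound on the total mass. *)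
Lemma bubble_tail_scaling {R : realFieldType} (K c L m I : R) e : 0 < K -> 1 <= L -> 0 < m ->
  m ^+ 2 <= I / c -> K * m ^+ (e + 3) / (L * m) ^+ e.+1 <= K / c / L * I.
Proof.
move=> K0 L1 m0 mI; have L0 : 0 < L by lra.
have Le : 0 < L ^+ e by rewrite exprn_gt0.
have me : 0 < m ^+ e by rewrite exprn_gt0.
have -> : K * m ^+ (e + 3) / (L * m) ^+ e.+1 = K / L * (m ^+ 2 / L ^+ e).
  rewrite exprMn exprD !exprS; move: (m ^+ e) (L ^+ e) me Le => a b a0 b0.
  by field; rewrite !gt_eqF.
have -> : K / c / L * I = K / L * (I / c) by ring.
apply: ler_wpM2l; first by rewrite divr_ge0// ltW.
by apply: le_trans mI; rewrite ler_pdivrMr// ler_peMr ?sqr_ge0// exprn_ege1.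
Qed.

(** With rho = L m the energy rho^(n-2) equals L^(e+3) m^(e+3); after m^2 is compared with [I] and
    m^e with 1, one factor [m] is left, which tends to 0 for fixed [L]. *)
Lemma cutoff_energy_scaling {R : realFieldType} (C c L m I : R) e : 0 <= C -> 0 < L -> 0 < m -> m <= 1 ->
  m ^+ 2 <= I / c ->
  C * ((L * m) ^- 2 * (L * m) ^+ (e + 5)) <= C / c * L ^+ (e + 3) * m * I.
Proof.
move=> C0 L0 m0 m1 mI.
have -> : C * ((L * m) ^- 2 * (L * m) ^+ (e + 5)) = C * L ^+ (e + 3) * m * (m ^+ 2 * m ^+ e).
  rewrite !exprMn !exprD; move: (m ^+ e) (L ^+ e) => a b.
  by field; rewrite !gt_eqF.
have -> : C / c * L ^+ (e + 3) * m * I = C * L ^+ (e + 3) * m * (I / c) by ring.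
apply: ler_wpM2l.
  by apply: mulr_ge0; [apply: mulr_ge0 => //; rewrite exprn_ge0// ltW|exact: ltW].
by apply: le_trans mI; rewrite ler_piMr ?sqr_ge0// exprn_ile1// ltW.
Qed.

Theorem corollary2p1 (R : realType) (n : nat) (M : ptopologicalType)
    (X : closed_manifold R n M) (g : riemannian_metric X)
    (vol : {measure set (borel M) -> \bar R})
    (q m1 : R) (Phi : (M -> R) -> (M -> R))
    (x : nat -> M) (mu : nat -> R) :
  (5 <= n)%N ->
  riemannian_volume g vol ->
  0 < q -> 0 < m1 ->
  (forall u : M -> R, H1 g vol u -> is_Phi g vol q m1 u (Phi u)) ->
  (exists x0 : M, x @ \oo --> x0) ->
  (forall a, 0 < mu a) ->
  mu @ \oo --> (0 : R) ->
  let B := fun a : nat => bubble g (mu a) (x a) in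
  (fun a : nat => (\int[vol]_y (Phi (B a) y * B a y ^+ 2)) /
                  (\int[vol]_y (B a y ^+ 2))) @ \oo --> q^-1.
Proof.
move=> n5 hv q0 m0 hPhi [x0 xx0] mu0 muc B.
pose e := (n - 5)%N; have ne : n = (e + 5)%N by rewrite subnK.
have n2 : (2 < n)%N by exact: leq_trans n5.
have [j [r [r0 jx Kj]]] := closed_ball_chart (X := X) x0.
have [c c0 [K K0 hI]] := bubble_integrals hv ne r0 Kj.
have [C C0 hC] := cutoff_exists hv Kj m1.
have mu_lt d : 0 < d -> \forall a \near \oo, mu a < d.
  move=> d0; have /cvgrPdist_lt/(_ d d0) := muc; apply: filterS => a.
  by rewrite sub0r normrN (gtr0_norm (mu0 a)).
have xnear : \forall a \near \oo, dom j (x a) /\ `|phi j x0 - phi j (x a)| < r / 2.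
  have nb : nbhs (phi j x0) (ball (phi j x0) (r / 2)) by apply: nbhsx_ballx; rewrite divr_gt0.
  have h : \forall a \near \oo, dom j (x a) /\ ball (phi j x0) (r / 2) (phi j (x a)).
    exact: (xx0 _ (near_phi jx nb)).
  by apply: filterS h => a [ja]; rewrite rV_ballE.
apply/cvgrPdist_le => eps eps0.
(* After multiplication by [q] the error budget is q eps, split into four equal parts: tau/2 and
   q^-1 t/4 are exactly q eps / 4, [L] below brings the tail under q eps / 4, and then [mu a] is
   taken small for the cutoff energy. *)
pose tau := q * eps / 2; pose t := q ^+ 2 * eps.
have tau0 : 0 < tau by rewrite divr_gt0// mulr_gt0.
have t0 : 0 < t by rewrite mulr_gt0// exprn_gt0.
pose a1 := (1 + (2 * tau)^-1) * (K / c).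
have a10 : 0 < a1 by rewrite mulr_gt0 ?divr_gt0// ltr_pwDl// invr_ge0; lra.
have qe : 0 < q * eps / 4 by rewrite divr_gt0// mulr_gt0.
pose L := Num.max 1 (a1 / (q * eps / 4)).
have L1 : 1 <= L by rewrite le_max lexx.
have hL : a1 / L <= q * eps / 4.
  by rewrite ler_pdivrMr ?(lt_le_trans _ L1)// mulrC -ler_pdivrMr// le_max lexx orbT.
have L0 : 0 < L by lra.
(* The factor of [mu a] in the contribution of the cutoff energy; it depends on [L] and [t], so
   these are fixed before [mu a] is made small. *)
pose D := q^-1 * (2 * t)^-1 * (C / c * L ^+ (e + 3)).
have D0 : 0 < D.
  rewrite !mulr_gt0 ?invr_gt0 ?exprn_gt0//; lra.
(* The bounds 1 and r/2 meet the hypotheses on the bubble; 1/L gives rho <= 1, r/8/L gives 4 rho <=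
   r/2 and so keeps the cutoff inside the chart; the last bound makes the cutoff energy small. *)
have d1 : 0 < Num.min (Num.min 1 (r / 2)) (Num.min (Num.min (L^-1) (r / 8 / L)) (q * eps / 4 / D)).
  by rewrite !lt_min ltr01 invr_gt0 L0 !divr_gt0// ?mulr_gt0.
near=> a.
have [ja xr] : dom j (x a) /\ `|phi j x0 - phi j (x a)| < r / 2 by near: a.
have : mu a < Num.min (Num.min 1 (r / 2)) (Num.min (Num.min (L^-1) (r / 8 / L)) (q * eps / 4 / D)).
  by near: a; exact: mu_lt.
rewrite !lt_min => /andP[/andP[mu1 mur] /andP[/andP[muL muL8] muD]].
have ma := mu0 a; pose rho := L * mu a; have rho0 : 0 < rho by rewrite mulr_gt0.
have rho1 : rho <= 1 by rewrite /rho mulrC -ler_pdivlMr// div1r ltW.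
have rho8 : rho <= r / 8 by rewrite /rho mulrC -ler_pdivlMr// ltW.
have [hI1 hI2] := hI (x a) (mu a) ja ma (ltW xr) (ltW mur).
have rr : `|phi j x0 - phi j (x a)| + 4 * rho <= r by lra.
have [eta [w [meta eta01 eta1 gw hG]]] := hC (x a) rho ja rho0 rho1 rr.
have [mB [B0 hB]] := bubble_bounded g ne (x a) ma.
have hT := hI2 rho; have := hT _ => {}hT.
have HB := hPhi _ (lip_chart_H1 hv (bubble_lip_chart g (x a) n2 ma)).1.
have est := Phi_estimate hv q0 m0 t0 tau0 mB hB HB (measurable_chart_ball _ _ _) meta eta01 eta1 gw hG.
rewrite -/(B a) in est hT hI1 HB *.
set I := \int[vol]_y (B a y ^+ 2) in est hI1 *.
have I0 : 0 < I by apply: lt_le_trans hI1; rewrite mulr_gt0// exprn_gt0.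
have muI : mu a ^+ 2 <= I / c by rewrite ler_pdivlMr// mulrC.
have hT2 : \int[vol]_y (B a y ^+ 2 * \1_(~` chart_ball j (x a) rho) y) <= K / c / L * I.
  by apply: (le_trans (hT _)); [lra|exact: bubble_tail_scaling].
have hG2 : C * (rho ^- 2 * rho ^+ n) <= C / c * L ^+ (e + 3) * mu a * I.
  by rewrite ne; apply: cutoff_energy_scaling => //; exact: ltW.
apply: (ratio_bound I0 q0 t0 tau0 _ _ est hT2 hG2).
- by rewrite !divr_ge0// ltW.
- by apply: ltW; apply: mulr_gt0 => //; rewrite mulr_gt0 ?divr_gt0 ?exprn_gt0.
have h1 : (1 + (2 * tau)^-1) * (K / c / L) <= q * eps / 4 by rewrite mulrA.
have h2 : D * mu a <= q * eps / 4 by rewrite mulrC -ler_pdivlMr// ltW.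
have -> : q^-1 * (t / 4 + (2 * t)^-1 * (C / c * L ^+ (e + 3) * mu a)) = q * eps / 4 + D * mu a.
  by rewrite /D /t; field; rewrite !gt_eqF.
have -> : tau / 2 = q * eps / 4 by rewrite /tau; field.
by move: h1 h2; move: ((1 + (2 * tau)^-1) * (K / c / L)) (D * mu a) (q * eps) => A1 A2 A3; lra.
Unshelve. all: by end_near.
Qed.
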